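(* Suppose $(S^{d-1},g_S)=(S^{d-1},d\Omega^2)$, where $d\Omega^2$ is the round metric. Within the class of warping functions $c$ that are (real) analytic on $[0,1]$, the Steklov spectrum of $(M,g)$ determines uniquely the warping function $c$; that is, if $c,\tilde c$ are analytic on $[0,1]$ and the associated manifolds $(M,g)$, $(M,\tilde g)$ have the same Steklov spectrum, then $c=\tilde c$ on $[0,1]$.
   Context: Setting. Let $d\ge 3$, $M=(0,1]\times S^{d-1}$ with boundary $\partial M=\{1\}\times S^{d-1}$, and $g=c^4(r)[dr^2+r^2g_S]$ (respectively $\tilde g=\tilde c^4(r)[dr^2+r^2g_S]$), where $g_S$ is a smooth Riemannian metric on $S^{d-1}$ and the warping functions $c,\tilde c$ are positive on $[0,1]$ with $c(0)=\tilde c(0)=1$. The metric may be singular at $r=0$. With $x=-\log r\in[0,\infty)$ and $f(x)=c(e^{-x})e^{-x/2}$ one has $g=f^4(x)[dx^2+g_S]$, and $\partial M=\{x=0\}$. Put $q_f(x)=\frac{(f^{d-2})''(x)}{f^{d-2}(x)}-\frac{(d-2)^2}{4}$. Let $0=\mu_0<\mu_1\le\mu_2\le\dots$ be the eigenvalues (with multiplicity) of $-\Delta_{g_S}$ on $S^{d-1}$, with orthonormal eigenfunctions $Y_k$, and $\kappa_k=\sqrt{\mu_k+\frac{(d-2)^2}{4}}$. Steklov spectrum. For boundary data $\psi=\sum_k\psi_kY_k\in H^{1/2}(\partial M)$, the unique solution $u$ of $-\Delta_g u=0$ on $M$, $u=\psi$ on $\partial M$, is obtained by separation of variables: $u=f^{-(d-2)}\sum_k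 v_k(x)Y_k$, where $-v_k''+q_fv_k=-\kappa_k^2v_k$ on $[0,\infty)$, $v_k(0)=f^{d-2}(0)\psi_k$ and $v_k\in L^2(0,\infty)$ (when $g$ is smooth this is the usual $H^1(M)$ solution). The Dirichlet-to-Neumann map is $\Lambda_g\psi=\partial_\nu u|_{\partial M}=-f(0)^{-2}\,\partial_xu|_{x=0}$. The Steklov spectrum $0=\sigma_0<\sigma_1\le\sigma_2\le\dots\to\infty$ is the spectrum of $\Lambda_g$, counted with multiplicity. *)

(* Defs.v *)
From HB Require Import structures.
From mathcomp Require Import all_boot all_order all_algebra.
From mathcomp Require Import all_classical all_reals all_analysis.
From mathcomp Require Import measurable_realfun.

Set Implicit Arguments.
Unset Strict Implicit.
Unset Printing Implicit Defensive.

Import Order.TTheory GRing.Theory Num.Theory.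
Import numFieldNormedType.Exports.

Local Open Scope classical_set_scope.
Local Open Scope ring_scope.

(* Points of R^n, with the product (= Borel) sigma-algebra; the norm of
   'rV[R]_n is the sup norm, hence the explicit Euclidean norm below. *)
Notation euclidean R n := (n.-tuple (measurableTypeR R)).

Lemma product_sigma_finite (d1 d2 : measure_display) (T1 : measurableType d1)
    (T2 : measurableType d2) (R : realType)
    (m1 : {sigma_finite_measure set T1 -> \bar R})
    (m2 : {sigma_finite_measure set T2 -> \bar R}) :
  sigma_finite setT (m1 \x m2)%E.
Proof.
have /sigma_finiteP[F [TF ndF Foo]] := sigma_finiteT m1.
have /sigma_finiteP[G [TG ndG Goo]] := sigma_finiteT m2.
exists (fun n => F n `*` G n).
  rewrite -setXTT TF TG predeqE => -[x y]; split.
    move=> [/= [n _ Fnx] [k _ Gky]]; exists (maxn n k) => //; split.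
    - by move: x Fnx; exact/subsetPset/ndF/leq_maxl.
    - by move: y Gky; exact/subsetPset/ndG/leq_maxr.
  by move=> [n _ []/= ? ?]; split; exists n.
move=> k; have [? ?] := Foo k; have [? ?] := Goo k.
split; first exact: measurableX.
by rewrite product_measure1E// lte_mul_pinfty// ge0_fin_numE.
Qed.

Section EuclideanSpace.
Variable R : realType.

Definition enorm n (t : euclidean R n) : R :=
  Num.sqrt (\sum_(i < n) (tnth t i : R) ^+ 2).

Definition normalize n (t : euclidean R n) : euclidean R n :=
  [tuple (tnth t i : R) / enorm t | i < n].

Definition punctured_ball n : set (euclidean R n) :=
  [set t | 0 < enorm t <= 1].

(* Lebesgue measure on R^n, by recursion on n: lebesgue_measure on R times
   Lebesgue measure on R^n, transported by (x, t) |-> x :: t. *)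
Definition tuple_cons n (p : measurableTypeR R * euclidean R n) : euclidean R n.+1 :=
  [tuple of p.1 :: p.2].

Lemma measurable_tuple_cons n : measurable_fun setT (@tuple_cons n).
Proof. exact: measurable_cons. Qed.

Section LebesgueStep.
Variables (m1 : {sigma_finite_measure set (measurableTypeR R) -> \bar R}).
Variables (n : nat) (m : {sigma_finite_measure set (euclidean R n) -> \bar R}).

Definition lebesgue_step : set (euclidean R n.+1) -> \bar R :=
  pushforward (m1 \x m)%E (@tuple_cons n).

Let step0 : lebesgue_step set0 = 0%E.
Proof. by rewrite /lebesgue_step /pushforward preimage_set0 measure0. Qed.

Let mpre A : measurable A -> measurable (@tuple_cons n @^-1` A).
Proof.
by move=> mA; rewrite -[X in measurable X]setTI; exact: measurable_tuple_cons.
Qed.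

Let step_ge0 A : (0 <= lebesgue_step A)%E.
Proof. exact: integral_ge0. Qed.

Let step_sigma_additive : semi_sigma_additive lebesgue_step.
Proof.
move=> F mF tF mUF; rewrite /lebesgue_step /pushforward preimage_bigcup.
apply: measure_semi_sigma_additive.
- by move=> k; exact: mpre.
- apply/trivIsetP => /= i j _ _ ij; rewrite -preimage_setI.
  by move/trivIsetP : tF => /(_ _ _ _ _ ij) ->//; rewrite preimage_set0.
- by rewrite -preimage_bigcup; exact: mpre.
Qed.

HB.instance Definition _ := isMeasure.Build _ _ _ lebesgue_step
  step0 step_ge0 step_sigma_additive.

Let tuple_uncons (t : euclidean R n.+1) : measurableTypeR R * euclidean R n :=
  (tnth t ord0, [tuple of behead t]).

Let step_sigma_finite : sigma_finite setT lebesgue_step.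
Proof.
have [F TF Foo] := product_sigma_finite m1 m.
have muncons : measurable_fun setT tuple_uncons.
  apply/measurable_fun_pairP; split; first exact: measurable_tnth.
  exact: measurable_behead.
exists (fun k => tuple_uncons @^-1` F k).
  by rewrite -preimage_bigcup -TF preimage_setT.
move=> k; have [mF Fk] := Foo k; split.
  by rewrite -[X in measurable X]setTI; exact: muncons.
rewrite /= /lebesgue_step /pushforward -comp_preimage (_ : _ \o _ = id) //.
apply/funext => -[x t] /=; rewrite /tuple_uncons /tuple_cons /=.
by congr pair; exact: val_inj.
Qed.

HB.instance Definition _ := Measure_isSigmaFinite.Build _ _ _ lebesgue_step
  step_sigma_finite.

End LebesgueStep.

Fixpoint lebesgue_rn n : {sigma_finite_measure set (euclidean R n) -> \bar R} :=
  match n with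
  | 0 => \d_([tuple] : euclidean R 0)
  | n'.+1 => lebesgue_step (@lebesgue_measure R) (lebesgue_rn n')
  end.

Lemma measurable_sqsum n : measurable_fun setT
  (fun t : euclidean R n => \sum_(i < n) (tnth t i : R) ^+ 2).
Proof.
apply: measurable_sum => i.
apply: (measurable_funX 2).
exact: measurable_tnth.
Qed.

Lemma sqsum_ge0 n (t : euclidean R n) : 0 <= \sum_(i < n) (tnth t i : R) ^+ 2.
Proof. by apply: sumr_ge0 => i _; exact: sqr_ge0. Qed.

Lemma measurable_enorm n : measurable_fun setT (@enorm n).
Proof.
rewrite (_ : @enorm n =
  (fun y : R => y `^ 2^-1) \o fun t => \sum_(i < n) (tnth t i : R) ^+ 2).
  apply: measurableT_comp; first exact: measurable_powR.
  exact: measurable_sqsum.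
by apply/funext => t /=; rewrite /enorm powR12_sqrt // sqsum_ge0.
Qed.

Lemma measurable_normalize n : measurable_fun setT (@normalize n).
Proof.
apply/measurable_fun_tnthP => i.
rewrite (_ : _ \o _ = fun t : euclidean R n => (tnth t i : R) * enorm t `^ (-1)).
  apply: measurable_funM; first exact: measurable_tnth.
  apply: (measurableT_comp (measurable_powR (-1))); exact: measurable_enorm.
by apply/funext => t /=; rewrite tnth_mktuple powR_inv1 // sqrtr_ge0.
Qed.

Lemma measurable_punctured_ball n : measurable (@punctured_ball n).
Proof.
rewrite (_ : @punctured_ball n = @enorm n @^-1` `]0, 1]).
  by rewrite -[X in measurable X]setTI; apply: measurable_enorm.
by apply/seteqP; split => t /=; rewrite in_itv.
Qed.

(* The measure of the round metric on the unit sphere: the cone over A in the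
   unit ball of R^n has volume |A| / n. *)
Definition sphere_measure n : {measure set (euclidean R n) -> \bar R} :=
  mscale (n%:R%:nng : {nonneg R})
    (measure_function_pushforward__canonical__measure_function_Measure
      (mrestr (lebesgue_rn n) (@measurable_punctured_ball n))
      (@measurable_normalize n)).

End EuclideanSpace.

(* A function on the unit sphere S^(d-1) of R^d is represented by a function on
   R^d of which only the values on the sphere are relevant. *)
Section RoundSphere.
Variables (R : realType) (d : nat).
Implicit Types Z psi phi : euclidean R d -> R.

Definition hom_ext Z (x : 'rV[R]_d) : R :=
  Z (normalize ([tuple x 0 i | i < d] : euclidean R d)).

(* For an open subset of R^d, existence and continuity of all second-order
   partial derivatives is C^2 regularity. *)
Definition sphere_C2 Z : Prop :=
  forall x : 'rV[R]_d, x != 0 -> forall i j : 'I_d,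
  [/\ derivable (hom_ext Z) x 'e_i,
      derivable ('D_'e_i (hom_ext Z)) x 'e_j
    & {for x, continuous ('D_'e_j ('D_'e_i (hom_ext Z)))}].

(* The Laplace-Beltrami operator of the round metric: the Euclidean Laplacian
   of the extension that is constant along rays. *)
Definition sphere_laplacian Z (w : euclidean R d) : R :=
  \sum_(i < d) 'D_'e_i ('D_'e_i (hom_ext Z)) (\row_j tnth w j).

Definition sphere_eigenfun (lam : R) Z : Prop :=
  sphere_C2 Z /\ forall w, enorm w = 1 -> - sphere_laplacian Z w = lam * Z w.

Local Notation S := (sphere_measure R d).

(* mu lists the eigenvalues of the negative Laplacian with multiplicity, with
   orthonormal eigenfunctions Y; the last clause says that the Y k with
   mu k = lam span the whole eigenspace of lam. *)
Record sphere_eigenbasis (mu : nat -> R) (Y : nat -> euclidean R d -> R) : Prop := {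
  eigenbasis_mu0 : mu 0 = 0;
  eigenbasis_mu1 : 0 < mu 1;
  eigenbasis_nondecreasing : nondecreasing_seq mu;
  eigenbasis_eigenfun : forall k, sphere_eigenfun (mu k) (Y k);
  eigenbasis_L2 : forall k, Y k \in Lfun S 2%:E;
  eigenbasis_orthonormal : forall j k,
    \int[S]_w (Y j w * Y k w) = (j == k)%:R;
  eigenbasis_multiplicity : forall lam Z, sphere_eigenfun lam Z ->
    exists (n : nat) (a : nat -> R), forall w, enorm w = 1 ->
      Z w = \sum_(k < n | mu k == lam) a k * Y k w }.

Definition L2dist psi phi : \bar R :=
  'N[S]_2%:E[EFin \o (psi \- phi)%R]%E.

Definition L2_sum (g : nat -> euclidean R d -> R) psi : Prop :=
  psi \in Lfun S 2%:E /\
  L2dist psi (fun w => \sum_(k < n) g k w) @[n --> \oo] --> 0%E.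

End RoundSphere.

Section WarpingFunction.
Variable R : realType.
Implicit Types (c : R -> R) (x r : R).

(* Analyticity relative to [0, 1]: at the endpoints the power series is only
   required to represent c on the side that lies in [0, 1]. *)
Definition analytic_on01 c : Prop :=
  forall r0, 0 <= r0 <= 1 -> exists (a : nat -> R) (rho : R), 0 < rho /\
  forall r, 0 <= r <= 1 -> `|r - r0| < rho ->
    series (fun n => a n * (r - r0) ^+ n) @ \oo --> c r.

Definition warping c : Prop :=
  (forall r, 0 <= r <= 1 -> 0 < c r) /\ c 0 = 1.

(* With x = - ln r, c(r)^4 (dr^2 + r^2 g_S) = f(x)^4 (dx^2 + g_S). *)
Definition warp_f c x : R := c (expR (- x)) * expR (- x / 2).

Variable d : nat.

Definition potential c x : R :=
  let F := fun y => warp_f c y ^+ (d - 2) in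
  derive1 (derive1 F) x / F x - (d - 2)%:R ^+ 2 / 4.

Definition kappa (m : R) : R := Num.sqrt (m + (d - 2)%:R ^+ 2 / 4).

(* - v'' + q v = - k^2 v on [0, oo), with v in L^2(0, oo).  As q extends
   continuously to x = 0, a solution on ]0, oo[ that is continuous at 0+ is C^2
   up to x = 0; stated this way, only c on [0, 1] matters. *)
Definition radial_solution c (k : R) (v : R -> R) : Prop :=
  [/\ v x @[x --> 0^'+] --> v 0,
      forall x, 0 < x ->
        [/\ derivable v x 1, derivable (derive1 v) x 1
          & - derive1 (derive1 v) x + potential c x * v x = - k ^+ 2 * v x]
    & (\int[@lebesgue_measure R]_(x in [set x : R | (0 < x)%R])
          (v x ^+ 2)%:E < +oo)%E].

End WarpingFunction.

Section DirichletToNeumann.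
Variables (R : realType) (d : nat) (mu : nat -> R) (Y : nat -> euclidean R d -> R).
Variable c : R -> R.
Implicit Types psi phi : euclidean R d -> R.

Local Notation S := (sphere_measure R d).
Local Notation f := (warp_f c).

Definition coef psi (k : nat) : R := \int[S]_w (psi w * Y k w).

Definition H_half psi : Prop :=
  L2_sum (fun k w => coef psi k * Y k w) psi /\
  cvgn (series (fun k => Num.sqrt (1 + mu k) * coef psi k ^+ 2)).

(* u x is the restriction to {x} * S^(d-1) of the solution of the Dirichlet
   problem with data psi, expanded in separated variables. *)
Definition harmonic_extension psi (u : R -> euclidean R d -> R) : Prop :=
  exists v : nat -> R -> R,
  (forall k, radial_solution d c (kappa d (mu k)) (v k) /\
             v k 0 = f 0 ^+ (d - 2) * coef psi k) /\
  (forall x, 0 <= x ->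
     L2_sum (fun k w => (f x ^+ (d - 2))^-1 * v k x * Y k w) (u x)).

(* The graph of Lambda_g as an operator in L^2 of the boundary: the
   x-derivative of u at x = 0 is the one-sided limit of the difference
   quotients in L^2. *)
Definition DN psi phi : Prop :=
  [/\ H_half psi, phi \in Lfun S 2%:E
    & exists2 u, harmonic_extension psi u &
        L2dist (fun w => - (f 0 ^- 2) * ((u x w - u 0 w) / x)) phi
          @[x --> 0^'+] --> 0%E].

Definition steklov_eigenspace (s : R) : set (euclidean R d -> R) :=
  [set psi | DN psi (fun w => s * psi w)].

(* Dimension modulo equality almost everywhere. *)
Definition has_dim (E : set (euclidean R d -> R)) (n : nat) : Prop :=
  exists b : 'I_n -> euclidean R d -> R,
  [/\ forall i, E (b i),
      forall a : 'I_n -> R,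
        (fun w => \sum_(i < n) a i * b i w) = cst 0 %[ae S] ->
        forall i, a i = 0
    & forall psi, E psi -> exists a : 'I_n -> R,
        psi = (fun w => \sum_(i < n) a i * b i w) %[ae S]].

(* Each s occurs in sigma as often as the dimension of its eigenspace, which is
   0 when s is not an eigenvalue. *)
Definition steklov_spectrum (sigma : nat -> R) : Prop :=
  nondecreasing_seq sigma /\
  forall s, exists n, has_dim (steklov_eigenspace s) n /\
    ([set j | sigma j = s] #= `I_n)%card.

End DirichletToNeumann.

(* Main.v *)
Require Import Defs.
From HB Require Import structures.
From mathcomp Require Import all_boot all_order all_algebra.
From mathcomp Require Import all_classical all_reals all_analysis.
From mathcomp Require Import measurable_realfun.
From mathcomp Require Import ring lra.
From mathcomp Require finmap.
Import Order.TTheory GRing.Theory Num.Theory.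
Import numFieldNormedType.Exports.
Local Open Scope classical_set_scope.
Local Open Scope ring_scope.
Set Implicit Arguments.
Unset Strict Implicit.
Unset Printing Implicit Defensive.

(** Let n = d - 2, F = f^n and u = v / F, where v solves the radial equation.
Separation of variables turns harmonicity into (F^2 u')' = mu F^2 u, one
equation for each eigenvalue mu of the sphere, and the Steklov eigenvalue
attached to mu is - f(0)^-2 u'(0) for the decaying solution with u(0) = 1.

The proof compares these solutions directly.

1. A decaying solution exists and is unique up to a factor (weyl_exists,
weyl_unique).  Existence comes from a Volterra equation in r = exp (- x);
uniqueness holds because u^2 increases at least like exp (2 a x), a = n / 2,
as soon as it increases somewhere.

2. The Wronskian of two decaying solutions is monotone and vanishes at
infinity, so the Steklov eigenvalue is nondecreasing in mu
(steklov_value_monotone).  Since the Dirichlet-to-Neumann map is diagonal in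
the eigenbasis (steklov_eigenfunction, DN_coef), sorting the spectrum costs no
information: the k-th Steklov eigenvalue belongs to the k-th eigenvalue of the
sphere (spectrum_eq_steklov_value), and two metrics with the same spectrum have
the same Steklov eigenvalue for every k.

3. The logarithmic derivative - u' / u satisfies a Riccati equation and stays
within a fixed distance of sqrt mu (weyl_riccati_lower, weyl_riccati_upper).
As mu k is unbounded, with explicit spherical harmonics as witnesses
(sphere_eigenvalues_unbounded), the leading term gives f(0).

4. Take two profiles F, F' with F(0) = F'(0) and
E = F^2 u_x u' - F'^2 u'_x u, where u' belongs to F'.  Then
E_x = (F^2 - F'^2) (mu u u' + u_x u'_x), and both products are nonnegative.
If F > F' on some interval (0, e), then E increases there by at least
exp (- 2 (sqrt mu + b) x) times a constant with x in (0, e) close to 0, whereas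
E at the far end is of the order of exp (- 2 (sqrt mu - b) x) with a larger x.
For large mu this contradicts E(0) = 0, which expresses the equality of the
Steklov eigenvalues (weyl_comparison).  For analytic warping functions that
differ, the difference has a constant sign in a punctured neighbourhood of
r = 1 (analytic_sign), so that one of the two profiles is larger near x = 0. *)

(** * Differential calculus on the line *)
Section Calculus.
Variable R : realType.
Implicit Types (f g : R -> R) (x a b : R).

Lemma der_eq f x a b : is_derive x 1 f a -> a = b -> is_derive x 1 f b.
Proof. by move=> fa <-. Qed.

Lemma derD f g x a b : is_derive x 1 f a -> is_derive x 1 g b ->
  is_derive x 1 (fun y => f y + g y) (a + b).
Proof. by move=> fa gb; exact: is_deriveD. Qed.

Lemma derN f x a : is_derive x 1 f a -> is_derive x 1 (fun y => - f y) (- a).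
Proof. by move=> fa; exact: is_deriveN. Qed.

Lemma derB f g x a b : is_derive x 1 f a -> is_derive x 1 g b ->
  is_derive x 1 (fun y => f y - g y) (a - b).
Proof. by move=> fa gb; exact: is_deriveB. Qed.

Lemma derM f g x a b : is_derive x 1 f a -> is_derive x 1 g b ->
  is_derive x 1 (fun y => f y * g y) (a * g x + f x * b).
Proof.
move=> fa gb; apply: der_eq (is_deriveM fa gb) _.
by rewrite addrC; congr (_ + _); rewrite /GRing.scale /= mulrC.
Qed.

Lemma derC (k : R) x : is_derive x 1 (fun=> k) 0.
Proof. exact: is_derive_cst. Qed.

Lemma derZ k f x a : is_derive x 1 f a -> is_derive x 1 (fun y => k * f y) (k * a).
Proof.
move=> fa; have := derM (derC k x) fa.
by rewrite mul0r add0r.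
Qed.

Lemma derX n f x a : is_derive x 1 f a ->
  is_derive x 1 (fun y => f y ^+ n.+1) (n.+1%:R * f x ^+ n * a).
Proof.
move=> fa; elim: n => [|n ih].
  by apply: der_eq fa _; rewrite mul1r expr0 mul1r.
have h := derM fa ih.
rewrite (_ : (fun y => _) = (fun y => f y * f y ^+ n.+1)); last first.
  by apply/funext => y; rewrite exprS.
by apply: der_eq h _; rewrite [in RHS]mulrSr !exprS; ring.
Qed.

Lemma derV f x a : f x != 0 -> is_derive x 1 f a ->
  is_derive x 1 (fun y => (f y)^-1) (- a / f x ^+ 2).
Proof.
move=> fx0 fa; apply: der_eq (is_deriveV fx0 fa) _.
by rewrite /GRing.scale /= mulNr mulrC mulNr.
Qed.

Lemma der_comp f g x a b : is_derive (g x) 1 f a -> is_derive x 1 g b ->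
  is_derive x 1 (fun y => f (g y)) (a * b).
Proof. by move=> fa gb; exact: is_derive1_comp. Qed.

Lemma der_expM k x : is_derive x 1 (fun y => expR (k * y)) (k * expR (k * x)).
Proof.
have h : is_derive x 1 (fun y => k * y) k.
  by apply: der_eq (derZ k (is_derive_id x 1)) _; rewrite mulr1.
by apply: der_eq (der_comp (is_derive_expR _) h) _; rewrite mulrC.
Qed.

Lemma der_expN x : is_derive x 1 (fun y => expR (- y)) (- expR (- x)).
Proof.
have h := derN (is_derive_id x (1 : R)).
by apply: der_eq (der_comp (is_derive_expR _) h) _; rewrite mulrN1.
Qed.

Lemma der_cont f x a : is_derive x 1 f a -> {for x, continuous f}.
Proof. by move=> [d _]; exact/differentiable_continuous/derivable1_diffP. Qed.

Lemma der_near f g x a : (\near x, f x = g x) -> is_derive x 1 f a ->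
  is_derive x 1 g a.
Proof. by move=> fg; exact: near_eq_is_derive. Qed.

Lemma der_derive1 f x a : is_derive x 1 f a -> derive1 f x = a.
Proof. by move=> fa; rewrite derive1E derive_val. Qed.

Lemma der_within f (f1 : R -> R) a b :
  (forall x, a <= x <= b -> is_derive x 1 f (f1 x)) ->
  {within `[a, b], continuous f}.
Proof.
move=> d; apply: continuous_in_subspaceT => x.
by rewrite inE /= in_itv /= => /d/der_cont.
Qed.

(** Estimates of primitives are obtained from this criterion, by comparing
derivatives. *)
Lemma der_homo f (f1 : R -> R) a b : a <= b ->
  (forall x, a <= x <= b -> is_derive x 1 f (f1 x)) ->
  (forall x, a < x < b -> 0 <= f1 x) -> f a <= f b.
Proof.
move=> ab d p; rewrite -subr_ge0.
have [->|ne] := eqVneq a b; first by rewrite subrr.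
have lt_ab : a < b by rewrite lt_neqAle ne.
have [|c + ->] := @MVT R f f1 a b lt_ab _ (der_within d).
  by move=> x; rewrite in_itv /= => /andP[ax xb]; apply: d; rewrite !ltW.
by rewrite in_itv /= => /p ?; rewrite mulr_ge0 ?subr_ge0.
Qed.

Lemma der_homo_lt f (f1 : R -> R) a b : a < b ->
  (forall x, a <= x <= b -> is_derive x 1 f (f1 x)) ->
  (forall x, a < x < b -> 0 < f1 x) -> f a < f b.
Proof.
move=> ab d p; rewrite -subr_gt0.
have [|c + ->] := @MVT R f f1 a b ab _ (der_within d).
  by move=> x; rewrite in_itv /= => /andP[ax xb]; apply: d; rewrite !ltW.
by rewrite in_itv /= => /p ?; rewrite mulr_gt0 ?subr_gt0.
Qed.

End Calculus.

(** * A Volterra equation with a singular point *)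
Section Primitive.
Variable R : realType.
Implicit Types (f g b : R -> R) (r s : R).

Definition primitive g r : R := \int[lebesgue_measure]_(t in `[0, r]) g t.

Lemma continuous_integrable g r : continuous g ->
  (@lebesgue_measure R).-integrable `[0, r] (EFin \o g).
Proof.
move=> cg; apply: continuous_compact_integrable; first exact: segment_compact.
exact: continuous_subspaceT.
Qed.

Lemma der_primitive g r : continuous g -> 0 < r ->
  is_derive r 1 (primitive g) (g r).
Proof.
move=> cg r0.
have [|d e] := @continuous_FTC1_closed R g 0 r (r + 1) _
  (continuous_integrable _ cg) r0 (cg r); first by rewrite ltrDl.
by apply: DeriveDef => //; rewrite -derive1E.
Qed.

Lemma primitive_le g b r : continuous g -> continuous b ->
  (forall s, 0 <= s <= r -> `|g s| <= b s) -> `|primitive g r| <= primitive b r.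
Proof.
move=> cg cb gb.
have ig := continuous_integrable r cg.
apply: (le_trans (le_normr_Rintegral _ ig)) => //.
apply: le_Rintegral => //.
- by apply: continuous_integrable => t; apply: continuous_comp (cg t) _; exact: norm_continuous.
- exact: continuous_integrable.
Qed.

Lemma primitiveB f g r : continuous f -> continuous g ->
  primitive (fun s => f s - g s) r = primitive f r - primitive g r.
Proof. by move=> cf cg; apply: RintegralB => //; exact: continuous_integrable. Qed.

Lemma primitiveZ k g r : continuous g ->
  primitive (fun s => k * g s) r = k * primitive g r.
Proof. by move=> cg; apply: RintegralZl => //; exact: continuous_integrable. Qed.

Lemma primitive_cst k r : 0 <= r -> primitive (fun=> k) r = k * r.
Proof.
move=> r0; rewrite /primitive Rintegral_cst //; congr (_ * _).
have e : (@lebesgue_measure R) `[0, r]%classic = r%:E.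
  rewrite lebesgue_measure_itv /= lte_fin.
  by case: ltgtP r0 => // [r0 _|<- _] /=; rewrite ?sube0 // oppr0 addr0.
exact: (congr1 fine e).
Qed.

Lemma primitive_exp l r : 0 < l -> 0 < r ->
  primitive (fun s => expR (l * s)) r = (expR (l * r) - 1) / l.
Proof.
move=> l0 r0; rewrite /primitive /Rintegral.
have d (x : R) : is_derive x 1 (fun s => expR (l * s) / l) (expR (l * x)).
  have h := derM (der_expM l x) (derC l^-1 x).
  by apply: der_eq h _; field; rewrite gt_eqF.
have c (x : R) : {for x, continuous (fun s => expR (l * s))}.
  exact: (der_cont (der_expM l x)).
rewrite (@continuous_FTC2 R _ (fun s => expR (l * s) / l)) //=.
- by rewrite mulr0 expR0; field; rewrite gt_eqF.
- by apply: continuous_subspaceT.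
- split.
  + by move=> x _; have [] := d x.
  + by apply: cvg_at_right_filter; exact: (der_cont (d 0)).
  + by apply: cvg_at_left_filter; exact: (der_cont (d r)).
- by move=> x _; rewrite (der_derive1 (d x)).
Qed.

Lemma continuous_bounded01 g : continuous g ->
  exists2 M, 0 <= M & forall s, 0 <= s <= 1 -> `|g s| <= M.
Proof.
move=> cg.
have [|c _ h] := @EVT_max R (fun s => `|g s|) 0 1 ler01 _.
  apply: continuous_subspaceT => t.
  by apply: continuous_comp (cg t) _; exact: norm_continuous.
exists `|g c| => // s s01; by apply: h; rewrite in_itv.
Qed.

End Primitive.

Section Volterra.
Variables (R : realType) (k : R).
Hypothesis k0 : 0 < k.
Implicit Types (f g b z : R -> R) (r s : R).

(** The power s^(2 k), which vanishes for s <= 0 so as to be continuous on the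
whole line. *)
Definition weight s : R := if 0 < s then s `^ (2 * k) else 0.

Lemma weight_gt0 s : 0 < s -> 0 < weight s.
Proof. by move=> s0; rewrite /weight s0 powR_gt0. Qed.

Lemma weight_le s r : s <= r -> 0 < r -> 0 <= weight s <= weight r.
Proof.
move=> sr r0; rewrite /weight r0; case: ifP => s0; last by rewrite lexx powR_ge0.
rewrite powR_ge0 /=; apply: ge0_ler_powR => //; rewrite ?nnegrE ltW //.
exact: mulr_gt0.
Qed.

Lemma der_weight s : 0 < s -> is_derive s 1 weight (2 * k * weight s / s).
Proof.
move=> s0.
have h := @is_derive1_powR R (2 * k) s s0.
apply: (@der_near R (fun s => s `^ (2 * k))).
  near=> t; rewrite /weight ifT //.
  by near: t; exact: lt_nbhsr.
apply: der_eq h _; rewrite /weight s0 powRB; last by rewrite (gt_eqF s0) implybT.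
by rewrite powRr1 ?mulrA // ltW.
Unshelve. all: by end_near. Qed.

Lemma weight_continuous : continuous weight.
Proof.
move=> s; have [s0|s0|<-] := ltgtP 0 s.
- exact: (der_cont (der_weight s0)).
- apply: (@der_cont R weight s 0).
  apply: (@der_near R (fun=> 0)).

  near=> t; rewrite /weight ifF //; apply/negbTE; rewrite -leNgt ltW //.
  by near: t; exact: lt_nbhsl.
- apply/left_right_continuousP; rewrite /weight ltxx; split.
    apply: cvg_near_cst; near=> t; rewrite ifF //.
    by apply/negbTE; rewrite -leNgt.
  have h : x `^ (2 * k) @[x --> 0^'+] --> 0 by apply: powR_cvg0; rewrite mulr_gt0.
  apply: cvg_trans h; apply: near_eq_cvg; near=> t.
  by rewrite ifT.
Unshelve. all: by end_near. Qed.

Lemma continuousMw g : continuous g -> continuous (fun s => weight s * g s).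
Proof. by move=> cg s; apply: cvgM; [exact: weight_continuous|exact: cg]. Qed.

(** With v = exp (- k x) z(r) and r = exp (- x), the equation
v'' = (k^2 + r H(r)) v becomes (r^(2 k + 1) z')' = r^(2 k) H z.  For g = H z the
function [slope g] is z' and [volterra g] is its integral from 0, written with
single integrals only. *)
Definition slope g r : R := primitive (fun s => weight s * g s) r / (weight r * r).

Definition volterra g r : R :=
  if 0 < r then
    (primitive g r - primitive (fun s => weight s * g s) r / weight r) / (2 * k)
  else 0.

Lemma der_volterra g r : continuous g -> 0 < r ->
  is_derive r 1 (volterra g) (slope g r).
Proof.
move=> cg r0.
have w0 := weight_gt0 r0.
have wV : is_derive r 1 (fun x => (weight x)^-1) (- (2 * k * weight r / r) / weight r ^+ 2).
  by apply: derV (der_weight r0); rewrite gt_eqF.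
have h := derM (derB (der_primitive cg r0)
  (derM (der_primitive (continuousMw cg) r0) wV)) (derC (2 * k)^-1 r).
apply: (@der_near R (fun y => (primitive g y -
  primitive (fun s => weight s * g s) y * (weight y)^-1) * (2 * k)^-1)).
  near=> t; rewrite /volterra ifT //.
  by near: t; exact: lt_nbhsr.
apply: der_eq h _; rewrite /slope.
by field; rewrite !gt_eqF.
Unshelve. all: by end_near. Qed.

Lemma der_slope g r : continuous g -> 0 < r ->
  is_derive r 1 (slope g) ((g r - (2 * k + 1) * slope g r) / r).
Proof.
move=> cg r0.
have w0 := weight_gt0 r0.
have h1 := derM (der_weight r0) (is_derive_id r (1:R)).
have wr0 : weight r * r != 0 by rewrite gt_eqF ?mulr_gt0.
have h := derM (der_primitive (continuousMw cg) r0) (@derV R (fun x => weight x * x) r _ wr0 h1).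
apply: der_eq h _; rewrite /slope.
by field; rewrite !gt_eqF.
Qed.

(** The kernel (1 - (s / r)^(2 k)) / (2 k) lies between 0 and 1 / (2 k), which
gives the bound of [volterra_le] by a plain primitive. *)
Lemma volterra_kernel g r : continuous g -> 0 < r ->
  volterra g r = primitive (fun s => (1 - weight s / weight r) / (2 * k) * g s) r.
Proof.
move=> cg r0; rewrite /volterra r0.
rewrite (_ : (fun s => (1 - weight s / weight r) / (2 * k) * g s) =
  (fun s => (2 * k)^-1 * g s -
   (2 * k * weight r)^-1 * (weight s * g s))); last first.
  by apply/funext => s; field; rewrite !gt_eqF ?weight_gt0.
have c1 (j : R) h : continuous h -> continuous (fun s => j * h s).
  by move=> ch s; apply: cvgM; [exact: cvg_cst|exact: ch].
rewrite primitiveB ?primitiveZ //; [|exact: continuousMw|exact: c1|].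
  by field; rewrite !gt_eqF ?weight_gt0.
by apply: c1; exact: continuousMw.
Qed.

Lemma volterra_le g b r : continuous g -> continuous b -> 0 < r ->
  (forall s, 0 <= s <= r -> `|g s| <= b s) ->
  `|volterra g r| <= primitive b r / (2 * k).
Proof.
move=> cg cb r0 gb; rewrite volterra_kernel //.
have c2 : continuous (fun s => (2 * k)^-1 * b s).
  by move=> s; apply: cvgM; [exact: cvg_cst|exact: cb].
rewrite [leRHS]mulrC -primitiveZ //; apply: primitive_le => //.
- move=> s; apply: cvgM; [apply: cvgM|exact: cg].
    apply: cvgB; [exact: cvg_cst|apply: cvgM;[exact: weight_continuous|exact: cvg_cst]].
  exact: cvg_cst.
- move=> s /andP[s0 sr]; have /andP[w1 w2] := weight_le sr r0.
  have wr := weight_gt0 r0.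
  have q0 : 0 <= weight s / weight r by rewrite divr_ge0 // ltW.
  have q1 : weight s / weight r <= 1 by rewrite ler_pdivrMr // mul1r.
  have i0 : 0 < (2 * k)^-1 by rewrite invr_gt0 mulr_gt0.
  rewrite !normrM (gtr0_norm i0) ger0_norm ?subr_ge0 //.
  rewrite -mulrA; apply: (le_trans _ (_ : (2 * k)^-1 * `|g s| <= _)).
    by rewrite ler_piMl ?gerBl // mulr_ge0 // ltW.
  by rewrite ler_pM2l // gb // s0.
Qed.

Lemma slope_le g (M : R) r : continuous g -> 0 < r -> 0 <= M ->
  (forall s, 0 <= s <= r -> `|g s| <= M) -> `|slope g r| <= M.
Proof.
move=> cg r0 M0 gM; have wr := weight_gt0 r0.
have wr0 : 0 < weight r * r by rewrite mulr_gt0.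
rewrite /slope normrM normfV (gtr0_norm wr0).
rewrite ler_pdivrMr // mulrA -(@primitive_cst _ (M * weight r) r (ltW r0)).
apply: primitive_le; [exact: continuousMw|exact: cst_continuous|].
move=> s /andP[s0 sr]; have /andP[w1 w2] := weight_le sr r0.
by rewrite normrM ger0_norm // mulrC ler_pM // gM // s0.
Qed.

Lemma volterra_continuous g : continuous g -> continuous (volterra g).
Proof.
move=> cg r; have [r0|r0|<-] := ltgtP 0 r.
- exact: (der_cont (der_volterra cg r0)).
- apply: (@der_cont R _ r 0).
  apply: (@der_near R (fun=> 0)).
  near=> t; rewrite /volterra ifF //; apply/negbTE; rewrite -leNgt ltW //.
  by near: t; exact: lt_nbhsl.
- apply/left_right_continuousP; rewrite /volterra ltxx; split.
    apply: cvg_near_cst; near=> t; rewrite ifF //.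
    by apply/negbTE; rewrite -leNgt.
  have [M M0 gM] := continuous_bounded01 cg.
  have h : r / (2 * k) * M @[r --> 0^'+] --> (0 : R).
    have i : r @[r --> (0:R)^'+] --> (0:R) by apply: cvg_at_right_filter; exact: cvg_id.
    have := cvgM (cvgM i (cvg_cst (2 * k)^-1)) (cvg_cst M).
    by rewrite !mul0r => h; exact: h.
  apply/cvgrPdist_le => e e0; near=> t.
  rewrite sub0r normrN.
  have t0 : 0 < t by [].
  have := @volterra_le g (fun=> M) t cg (@cst_continuous _ _ _) t0.
  rewrite /volterra t0 => /(_ _)/le_trans; apply.
    move=> s /andP[s0 st]; apply: gM; rewrite s0 (le_trans st) //.
    by near: t; exact: nbhs_right_le.
  rewrite (primitive_cst _ (ltW t0)).
  rewrite (_ : _ * _ = t / (2 * k) * M); last by field; rewrite gt_eqF.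
  near: t; move/cvgrPdist_le : h => /(_ e e0).
  apply: filterS => t; rewrite sub0r normrN; apply: le_trans; exact: ler_norm.
Unshelve. all: by end_near. Qed.

Lemma volterraB f g r : continuous f -> continuous g ->
  volterra (fun s => f s - g s) r = volterra f r - volterra g r.
Proof.
move=> cf cg; rewrite /volterra; case: ifP; last by rewrite subr0.
move=> r0; rewrite primitiveB //.
rewrite (_ : (fun s => weight s * (f s - g s)) =
  (fun s => weight s * f s - weight s * g s)); last first.
  by apply/funext => s; rewrite mulrBr.
rewrite primitiveB; [|exact: continuousMw..].
by field; rewrite !gt_eqF ?weight_gt0.
Qed.

End Volterra.

(** Picard iteration for z = 1 + volterra (H z).  In the norm
sup |z(r)| exp (- K r / k) the iteration contracts by 1 / 2 whatever the size
of K = sup |H|, so that the solution is global. *)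
Section FixedPoint.
Variables (R : realType) (k : R) (H : R -> R) (K : R).
Hypotheses (k0 : 0 < k) (cH : continuous H) (K0 : 0 < K)
  (HK : forall s, `|H s| <= K).
Implicit Types (g z : R -> R) (r s : R).

Let E r := expR (K / k * r).
Let S g := volterra k (fun s => H s * g s).

Let E_continuous : continuous E.
Proof. by move=> r; exact: (der_cont (der_expM _ _)). Qed.

Let E_gt0 r : 0 < E r. Proof. exact: expR_gt0. Qed.

Let E_ge0 r : 0 <= E r. Proof. exact: expR_ge0. Qed.

Lemma continuousHg g : continuous g -> continuous (fun s => H s * g s).
Proof. by move=> cg s; apply: cvgM; [exact: cH|exact: cg]. Qed.

Lemma volterra_contraction g M : continuous g -> 0 <= M ->
  (forall s, 0 <= s -> `|g s| <= M * E s) -> forall r, `|S g r| <= M / 2 * E r.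
Proof.
move=> cg M0 gM r.
have [r0|r0] := ltP 0 r; last first.
  by rewrite /S /volterra ltNge r0 /= normr0 mulr_ge0 ?divr_ge0 // ltW.
have c2 (j : R) : continuous (fun s => j * E s).
  by move=> s; apply: cvgM; [exact: cvg_cst|exact: E_continuous].
have := @volterra_le R k k0 _ (fun s => K * M * E s) r (continuousHg cg) (c2 _) r0.
move=> /(_ _)/le_trans -> //.
  by move=> s /andP[s0 _]; rewrite normrM -mulrA ler_pM // ?HK // gM.
rewrite primitiveZ // primitive_exp ?divr_gt0 // -/(E r).
rewrite (_ : _ / (2 * k) = M / 2 * (E r - 1)); last by field; rewrite !gt_eqF.
by rewrite ler_wpM2l ?divr_ge0 // gerBl.
Qed.

Fixpoint picard n : R -> R :=
  if n is n'.+1 then fun r => 1 + S (picard n') r else fun=> 1.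

Lemma picard_continuous n : continuous (picard n).
Proof.
elim: n => [|n ih] /= r; first exact: cvg_cst.
apply: cvgD; first exact: cvg_cst.
by apply: volterra_continuous => //; exact: continuousHg.
Qed.

Lemma volterraHB f g r : continuous f -> continuous g ->
  S (fun s => f s - g s) r = S f r - S g r.
Proof.
move=> cf cg; rewrite /S -volterraB //; [|exact: continuousHg..].
by congr (volterra _ _ r); apply/funext => s; rewrite mulrBr.
Qed.

Lemma picard_step n r : `|picard n.+1 r - picard n r| <= 2^-1 ^+ n.+1 * E r.
Proof.
elim: n r => [|n ih] r.
  rewrite /= addrAC subrr add0r expr1.
  rewrite -[2^-1]mul1r; apply: volterra_contraction => //.
    exact: cst_continuous.
  by move=> s s0; rewrite normr1 mul1r -expR0 ler_expR mulr_ge0 // divr_ge0 // ltW.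
have -> : picard n.+2 r - picard n.+1 r = S (fun s => picard n.+1 s - picard n s) r.
  rewrite volterraHB; [|exact: picard_continuous..].
  by rewrite /=; ring.
rewrite exprSr; apply: volterra_contraction => //.
by move=> s; apply: cvgB; exact: picard_continuous.
Qed.

Lemma picard_cauchy m n r : (n <= m)%N ->
  `|picard m r - picard n r| <= (2^-1 ^+ n - 2^-1 ^+ m) * E r.
Proof.
elim: m => [|m ih]; first by rewrite leqn0 => /eqP ->; rewrite !subrr normr0 mul0r.
rewrite leq_eqVlt => /predU1P[->|]; first by rewrite !subrr normr0 mul0r.
rewrite ltnS => /ih {}ih.
have -> : picard m.+1 r - picard n r =
  (picard m.+1 r - picard m r) + (picard m r - picard n r) by ring.
apply: (le_trans (ler_normD _ _)).
apply: (le_trans (lerD (picard_step m r) ih)).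
rewrite -mulrDl ler_wpM2r ?E_ge0 // exprS.
lra.
Qed.

Lemma half_small (e : R) : 0 < e -> exists n, 2^-1 ^+ n < e.
Proof.
move=> e0; have h : `|2^-1 : R| < 1 by rewrite ger0_norm; lra.
have /cvgrPdist_lt/(_ e e0)[n _ /(_ n (leqnn n))] := cvg_expr h.
by rewrite sub0r normrN ger0_norm ?exprn_ge0 //; exists n.
Qed.

Lemma half_le (n m : nat) : (n <= m)%N -> 2^-1 ^+ m <= 2^-1 ^+ n :> R.
Proof. by move=> nm; apply: ler_wiXn2l => //; lra. Qed.

Definition picard_lim r : R := limn (picard ^~ r).

Lemma picard_cvg r : picard ^~ r @ \oo --> picard_lim r.
Proof.
suff : cvgn (picard ^~ r) by [].
apply/cauchy_cvgP/cauchy_ballP => e e0.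
have [|n hn] := half_small (e := e / E r); first exact: divr_gt0.
rewrite near_map2; exists ([set m | (n <= m)%N], [set m | (n <= m)%N]) => /=.
  by split; exists n.
have key i j : (n <= i)%N -> (i <= j)%N -> `|picard j r - picard i r| < e.
  move=> ni ij; apply: (le_lt_trans (picard_cauchy r ij)).
  rewrite -ltr_pdivlMr // (le_lt_trans _ hn) //.
  rewrite (le_trans _ (half_le ni)) // gerBl exprn_ge0 //.
move=> [i j] [/= ni nj]; rewrite /ball /=.
have [ij|/ltnW ji] := leqP i j; last exact: key.
by rewrite distrC; exact: key.
Qed.

Lemma picard_lim_dist n r : `|picard_lim r - picard n r| <= 2^-1 ^+ n * E r.
Proof.
apply/ler_addgt0Pr => e e0.
have /cvgrPdist_lt/(_ e e0)[m _ hm] := @picard_cvg r.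
have := hm (maxn m n) (leq_maxl _ _); set j := maxn m n => hj.
have -> : picard_lim r - picard n r =
  (picard j r - picard n r) + (picard_lim r - picard j r) by ring.
apply: (le_trans (ler_normD _ _)); apply: lerD; last exact: ltW.
apply: (le_trans (picard_cauchy r (leq_maxr _ _))).
by rewrite ler_wpM2r ?E_ge0 // gerBl exprn_ge0.
Qed.

(** The convergence is uniform on each half-line r <= r0 + 1. *)
Lemma picard_lim_continuous : continuous picard_lim.
Proof.
move=> r; apply/cvgrPdist_le => e e0.
have E1 : 0 < E (r + 1) by [].
have [|n hn] := half_small (e := e / 3 / E (r + 1)).
  by rewrite !divr_gt0.
have hb y : y <= r + 1 -> `|picard_lim y - picard n y| <= e / 3.
  move=> yr; apply: (le_trans (picard_lim_dist n y)).
  rewrite ltr_pdivlMr // in hn; apply: le_trans (ltW hn).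
  rewrite ler_wpM2l ?exprn_ge0 // ler_expR ler_wpM2l // divr_ge0 // ltW //.
have e3 : 0 < e / 3 by rewrite divr_gt0.
have /cvgrPdist_le/(_ _ e3) h := @picard_continuous n r.
near=> y.
have -> : picard_lim r - picard_lim y = (picard_lim r - picard n r) +
  (picard n r - picard n y) + (picard n y - picard_lim y) by ring.
have h1 : `|picard_lim r - picard n r| <= e / 3 by apply: hb; lra.
have h2 : `|picard n r - picard n y| <= e / 3 by near: y.
have h3 : `|picard n y - picard_lim y| <= e / 3.
  rewrite distrC; apply: hb; apply: ltW; near: y; apply: lt_nbhsl; lra.
have := ler_normD (picard_lim r - picard n r + (picard n r - picard n y)) (picard n y - picard_lim y).
have := ler_normD (picard_lim r - picard n r) (picard n r - picard n y).
lra.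
Unshelve. all: by end_near. Qed.

Lemma volterra_fixed r : picard_lim r = 1 + volterra k (fun s => H s * picard_lim s) r.
Proof.
apply/eqP; rewrite -subr_eq0 -normr_eq0 eq_le normr_ge0 andbT.
apply/ler_addgt0Pr => e e0; rewrite add0r.
have [|n hn] := half_small (e := e / E r); first exact: divr_gt0.
rewrite ltr_pdivlMr // in hn.
rewrite -/(S picard_lim r).
have -> : picard_lim r - (1 + S picard_lim r) = (picard_lim r - picard n.+1 r) +
  (S (picard n) r - S picard_lim r) by rewrite /=; ring.
rewrite -volterraHB; [|exact: picard_continuous|exact: picard_lim_continuous].
apply: (le_trans (ler_normD _ _)).
have h1 := picard_lim_dist n.+1 r.
have h2 : `|S (fun s => picard n s - picard_lim s) r| <= 2^-1 ^+ n / 2 * E r.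
  apply: volterra_contraction => //; first by move=> s; apply: cvgB; [exact: picard_continuous|exact: picard_lim_continuous].
  by move=> s _; rewrite distrC picard_lim_dist.
apply: (le_trans (lerD h1 h2)); apply: le_trans (ltW hn).
by rewrite exprSr -mulrDl -mulrDr; lra.
Qed.

End FixedPoint.

Section DecayingSolution.
Variable R : realType.

Lemma continuous_at_ge01 (z : R -> R) : continuous z -> 0 < z 0 ->
  exists X : R, 0 <= X /\ forall x, X <= x -> 0 < z (expR (- x)).
Proof.
move=> cz z0.
have /cvgr_gt/(_ _ z0) h : z x @[x --> (0:R)] --> z 0 by exact: cz.
have /nbhs_ballP[e /= e0 he] := h.
exists (Num.max 0 (- ln e + 1)); split; first by rewrite le_max lexx.
move=> x; rewrite ge_max => /andP[_ xe]; apply: he.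
rewrite /ball /= sub0r normrN ger0_norm ?expR_ge0 //.
by rewrite -[ltRHS]lnK ?posrE // ltr_expR; lra.
Qed.

(** The solution v = exp (- k x) z(exp (- x)) with z(0) = 1: it decays like
exp (- k x) together with its derivative, and is positive far out. *)
Lemma decaying_solution (k : R) (H : R -> R) (K : R) : 0 < k -> continuous H ->
  (forall s, `|H s| <= K) ->
  exists (v v1 : R -> R) (C : R),
  [/\ forall x : R, is_derive x 1 v (v1 x),
      forall x : R, is_derive x 1 v1 ((k ^+ 2 + expR (- x) * H (expR (- x))) * v x),
      forall x, 0 <= x -> `|v x| <= C * expR (- k * x) /\ `|v1 x| <= C * expR (- k * x)
    & exists X, 0 <= X /\ forall x, X <= x -> 0 < v x].
Proof.
move=> k0 cH HK0.
have [K' K'0 HK] : exists2 K', 0 < K' & forall s, `|H s| <= K'.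
  exists (`|K| + 1); first by rewrite ltr_wpDl.
  by move=> s; apply: (le_trans (HK0 s)); rewrite (le_trans (ler_norm _)) // lerDl.
pose z := picard_lim k H.
have cz : continuous z := picard_lim_continuous k0 cH K'0 HK.
have fz := volterra_fixed k0 cH K'0 HK.
pose g s := H s * z s.
have cg : continuous g := continuousHg cH cz.
pose y := slope k g.
have dz (r : R) : 0 < r -> is_derive r 1 z (y r).
  move=> r0; have -> : z = fun r => 1 + volterra k g r by apply/funext => t; exact: fz.
  by apply: der_eq (derD (derC 1 r) (der_volterra k0 cg r0)) _; rewrite add0r.
have dy (r : R) : 0 < r -> is_derive r 1 y ((g r - (2 * k + 1) * y r) / r) by exact: der_slope.
pose v (x : R) := expR (- k * x) * z (expR (- x)).
pose v1 (x : R) := - expR (- k * x) * (k * z (expR (- x)) + expR (- x) * y (expR (- x))).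
have dzx (x : R) := @der_comp R z (fun t => expR (- t)) x _ _ (dz _ (expR_gt0 (- x))) (der_expN x).
have dyx (x : R) := @der_comp R y (fun t => expR (- t)) x _ _ (dy _ (expR_gt0 (- x))) (der_expN x).
have [M M0 zM] := continuous_bounded01 cz.
have [N N0 gN] := continuous_bounded01 cg.
exists v, v1, (k * M + N + M); split.
- move=> x; apply: der_eq (derM (der_expM (- k) x) (dzx x)) _.
  by rewrite /v1; ring.
- move=> x; apply: der_eq (derM (derN (der_expM (- k) x))
    (derD (derZ k (dzx x)) (derM (der_expN x) (dyx x)))) _.
  by rewrite /v /g; field; rewrite gt_eqF ?expR_gt0.
- move=> x x0.
  have r0 := expR_gt0 (- x).
  have r1 : expR (- x) <= 1 by rewrite -expR0 ler_expR oppr_le0.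
  have zb : `|z (expR (- x))| <= M by apply: zM; rewrite (ltW r0).
  have yb : `|y (expR (- x))| <= N.
    apply: slope_le => // s /andP[s0 sr]; apply: gN; rewrite s0.
    exact: le_trans sr r1.
  have E0 : 0 < expR (- k * x) by exact: expR_gt0.
  rewrite /v /v1 !normrM normrN (gtr0_norm E0) ![expR (- k * x) * _]mulrC.
  split; apply: ler_wpM2r; rewrite ?(ltW E0) //.
    apply: (le_trans zb); rewrite lerDr addr_ge0 // mulr_ge0 // ltW //.
  apply: (le_trans (ler_normD _ _)).
  rewrite (normrM k) (normrM (expR (- x))) (gtr0_norm k0) (gtr0_norm r0).
  have h1 : k * `|z (expR (- x))| <= k * M by rewrite ler_pM2l.
  have h2 : expR (- x) * `|y (expR (- x))| <= N by apply: (le_trans _ yb); rewrite ler_piMl.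
  lra.
- have z0 : z 0 = 1 by rewrite /z fz /volterra ltxx addr0.
  have [|X [X0 h]] := continuous_at_ge01 cz; first by rewrite z0.
  exists X; split => // x /h hx; rewrite /v mulr_gt0 ?expR_gt0 //.
Qed.

End DecayingSolution.

(** * The radial equation and its decaying solutions *)
Section RadialEquation.
Variable R : realType.
Notation leb := (@lebesgue_measure R).
Notation halfline := ([set x : R | 0 < x]).

(** The radial data of a metric: F stands for f^(d - 2), F1 for its
derivative, a for (d - 2) / 2, and the potential is exp (- x) H(exp (- x)).
All derivatives are two-sided, also at x = 0, which is possible because an
analytic warping function extends beyond r = 1. *)
Record profile (a : R) (F F1 H : R -> R) (m M B : R) : Prop := Profile {
  profile_a : 0 < a;
  profile_m : 0 < m;
  profile_der : forall x : R, 0 <= x -> is_derive x 1 F (F1 x);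
  profile_der1 : forall x : R, 0 <= x ->
    is_derive x 1 F1 ((a ^+ 2 + expR (- x) * H (expR (- x))) * F x);
  profile_bounds : forall x, 0 <= x ->
    m * expR (- a * x) <= F x <= M * expR (- a * x);
  profile_log_der : forall x, 0 <= x -> `|F1 x| <= B * F x;
  profile_cont : continuous H;
  profile_bounded : exists K, forall s, `|H s| <= K }.

(** The decaying solution of the radial equation, normalized by v(0) = F(0),
that is u(0) = 1. *)
Record weyl (a : R) (F H : R -> R) (mu : R) (v v1 : R -> R) : Prop := Weyl {
  weyl_der : forall x : R, 0 <= x -> is_derive x 1 v (v1 x);
  weyl_der1 : forall x : R, 0 <= x ->
    is_derive x 1 v1 ((mu + a ^+ 2 + expR (- x) * H (expR (- x))) * v x);
  weyl_gt0 : forall x, 0 <= x -> 0 < v x;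
  weyl_0 : v 0 = F 0;
  weyl_decay : exists C, forall x, 0 <= x ->
    `|v x| <= C * expR (- a * x) /\ `|v1 x| <= C * expR (- a * x) }.

Lemma exp_small (a C e : R) : 0 < a -> 0 < e ->
  exists X, 0 <= X /\ forall x, X <= x -> C * expR (- a * x) < e.
Proof.
move=> a0 e0; pose D := `|C| + 1.
have D0 : 0 < D by rewrite ltr_wpDl.
have CD : C < D by rewrite (le_lt_trans (ler_norm C)) // ltrDl.
exists (Num.max 0 (ln (D / e) / a)); split; first by rewrite le_max lexx.
move=> x; rewrite ge_max => /andP[x0 hx].
rewrite ler_pdivrMr // in hx.
apply: (@lt_le_trans _ _ (D * expR (- a * x))); first by rewrite ltr_pM2r ?expR_gt0.
have De : D / e <= expR (a * x).
  by rewrite -[leLHS]lnK ?posrE ?divr_gt0 // ler_expR [a * x]mulrC.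
rewrite ler_pdivrMr // in De.
by rewrite mulNr expRN ler_pdivrMr ?expR_gt0 // mulrC.
Qed.

Section OneProfile.
Variables (a : R) (F F1 H : R -> R) (m M B : R).
Hypothesis pF : profile a F F1 H m M B.

Lemma profile_gt0 x : 0 <= x -> 0 < F x.
Proof.
move=> /(profile_bounds pF)/andP[+ _]; apply: lt_le_trans.
by rewrite mulr_gt0 ?(profile_m pF) ?expR_gt0.
Qed.

Lemma profile_M_gt0 : 0 < M.
Proof.
have := profile_bounds pF (lexx 0) => /andP[_].
rewrite mulr0 expR0 mulr1; apply: lt_le_trans; exact: profile_gt0.
Qed.

(** The Wronskian of v with F, the solution for mu = 0: if u = v / F then
u' = wronsk / F^2, and the equation reads wronsk' = mu v F. *)
Definition wronsk (v v1 : R -> R) x := v1 x * F x - v x * F1 x.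

Lemma der_quotient (v v1 : R -> R) (x : R) : 0 <= x -> is_derive x 1 v (v1 x) ->
  is_derive x 1 (fun t => v t / F t) (wronsk v v1 x / F x ^+ 2).
Proof.
move=> x0 dv; have Fx := profile_gt0 x0.
have Fx0 : F x != 0 by rewrite gt_eqF.
apply: der_eq (derM dv (derV Fx0 (profile_der pF x0))) _.
by rewrite /wronsk; field.
Qed.

Lemma der_wronsk mu (v v1 : R -> R) (x : R) : 0 <= x -> is_derive x 1 v (v1 x) ->
  is_derive x 1 v1 ((mu + a ^+ 2 + expR (- x) * H (expR (- x))) * v x) ->
  is_derive x 1 (wronsk v v1) (mu * v x * F x).
Proof.
move=> x0 dv dv1.
apply: der_eq (derB (derM dv1 (profile_der pF x0)) (derM dv (profile_der1 pF x0))) _.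
ring.
Qed.

Lemma integral_bounded_below (g : R -> R) (c X : R) : 0 < c -> 0 <= X ->
  {in `]0, +oo[%R, continuous g} ->
  (forall x, 0 < x -> 0 <= g x) ->
  (forall x, X < x -> c <= g x) ->
  (\int[leb]_(x in halfline) (g x)%:E = +oo)%E.
Proof.
move=> c0 X0 cg g0 gc.
have hE : halfline = `]0, +oo[%classic :> set R.
  by apply/seteqP; split => x /=; rewrite in_itv /= andbT.
have mg : measurable_fun (`]0, +oo[%classic : set R) (EFin \o g).
  by apply/measurable_EFinP; apply: open_continuous_measurable_fun => // x; rewrite inE => /cg.
apply/eqP; rewrite -leye_eq.
have sub : (`]X, +oo[%classic : set R) `<=` `]0, +oo[%classic.
  by move=> x /=; rewrite !in_itv /= !andbT; exact: le_lt_trans.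
have -> : (+oo = \int[leb]_(x in `]X, +oo[) c%:E :> \bar R)%E.
  rewrite integral_cst //= lebesgue_measure_itv /= ltry /=.
  by rewrite gt0_muley // lte_fin.
rewrite hE; apply: (@le_trans _ _ (\int[leb]_(x in `]X, +oo[) (g x)%:E)%E).
  apply: ge0_le_integral => //.
  - by move=> x _; rewrite lee_fin ltW.
  - exact: measurable_funS mg.
  - by move=> x /=; rewrite in_itv /= andbT lee_fin; exact: gc.
apply: ge0_subset_integral => //.
by move=> x /=; rewrite in_itv /= andbT lee_fin; exact: g0.
Qed.

(** Let u = v / F and W the Wronskian, so that (u W)' = W^2 / F^2 + mu v^2 >= 0.
If u W is positive at x1 it stays bounded below; then (u^2)' = 2 u W / F^2 grows
like exp (2 a x), and v^2 = F^2 u^2 is bounded below near infinity, against the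
integrability of v^2. *)
Lemma wronsk_sq_le0 mu (v v1 : R -> R) : 0 <= mu ->
  (forall x : R, 0 < x -> is_derive x 1 v (v1 x)) ->
  (forall x : R, 0 < x ->
    is_derive x 1 v1 ((mu + a ^+ 2 + expR (- x) * H (expR (- x))) * v x)) ->
  (\int[leb]_(x in halfline) (v x ^+ 2)%:E < +oo)%E ->
  forall x, 0 < x -> v x * wronsk v v1 x <= 0.
Proof.
move=> mu0 dv dv1 L2 x1 x10; rewrite leNgt; apply/negP => pos.
have a0 := profile_a pF; have m0 := profile_m pF; have M0 := profile_M_gt0.
pose u x := v x / F x; pose W := wronsk v v1.
have du (x : R) : 0 < x -> is_derive x 1 u (W x / F x ^+ 2).
  by move=> x0; apply: der_quotient (ltW x0) (dv _ x0).
have dW (x : R) : 0 < x -> is_derive x 1 W (mu * v x * F x).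
  by move=> x0; apply: der_wronsk (ltW x0) (dv _ x0) (dv1 _ x0).
pose c := u x1 * W x1.
have c0 : 0 < c.
  by rewrite /c /u mulrAC divr_gt0 // profile_gt0 // ltW.
have gt0 x : x1 <= x -> 0 < x by exact: lt_le_trans.
have uW x : x1 <= x -> c <= u x * W x.
  move=> x1x; apply: (@der_homo R (fun t => u t * W t)
    (fun t => W t ^+ 2 / F t ^+ 2 + mu * v t ^+ 2)) => //.
    move=> t /andP[x1t _]; have t0 := gt0 _ x1t.
    apply: der_eq (derM (du _ t0) (dW _ t0)) _; rewrite /u.
    by field; rewrite gt_eqF // profile_gt0 // ltW.
  move=> t _; apply: addr_ge0; first exact: divr_ge0 (sqr_ge0 _) (sqr_ge0 _).
  exact: mulr_ge0 mu0 (sqr_ge0 _).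
pose d := c / (a * M ^+ 2).
have d0 : 0 < d by rewrite divr_gt0 // mulr_gt0 // exprn_gt0.
have uu x : x1 <= x -> d * (expR (2 * a * x) - expR (2 * a * x1)) <= u x ^+ 2.
  move=> x1x.
  suff : u x1 ^+ 2 - d * expR (2 * a * x1) <= u x ^+ 2 - d * expR (2 * a * x).
    by have := sqr_ge0 (u x1); rewrite mulrBr; lra.
  apply: (@der_homo R (fun t => u t ^+ 2 - d * expR (2 * a * t))
    (fun t => 2 * (u t * W t) / F t ^+ 2 - d * (2 * a * expR (2 * a * t)))) => //.
    move=> t /andP[x1t _]; have t0 := gt0 _ x1t.
    apply: der_eq (derB (derX 1 (du _ t0)) (derZ d (der_expM (2 * a) t))) _.
    by rewrite expr1; field; rewrite gt_eqF // profile_gt0 // ltW.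
  move=> t /andP[x1t _]; have t0 := gt0 _ (ltW x1t).
  have F0 := profile_gt0 (ltW t0).
  have /andP[_ FM] := profile_bounds pF (ltW t0).
  rewrite subr_ge0 ler_pdivlMr ?exprn_gt0 //.
  have uWt := uW _ (ltW x1t).
  have h1 : F t ^+ 2 <= M ^+ 2 * expR (- (2 * a * t)).
    have -> : expR (- (2 * a * t)) = expR (- a * t) ^+ 2.
      by rewrite -expRM_natl; congr expR; ring.
    rewrite -exprMn; apply: lerXn2r => //; rewrite nnegrE ?(ltW F0) //.
    by rewrite mulr_ge0 ?expR_ge0 // ltW.
  have e0 := expR_gt0 (2 * a * t).
  apply: (@le_trans _ _ (d * (2 * a * expR (2 * a * t)) * (M ^+ 2 * expR (- (2 * a * t))))).
    by apply: ler_wpM2l h1; apply: ltW; do !apply: mulr_gt0 => //.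
  rewrite expRN (_ : _ * _ = 2 * c); first lra.
  by rewrite /d; field; rewrite !gt_eqF.
have a20 : 0 < 2 * a by rewrite mulr_gt0.
have [X [X0 hX]] := @exp_small (2 * a) (2 * expR (2 * a * x1)) 1 a20 ltr01.
have vE x : 0 < x -> v x ^+ 2 = u x ^+ 2 * F x ^+ 2.
  by move=> x0; rewrite /u; field; rewrite gt_eqF // profile_gt0 // ltW.
suff h : (\int[leb]_(x in halfline) (v x ^+ 2)%:E = +oo)%E by move: L2; rewrite h ltxx.
apply: (@integral_bounded_below (fun x => v x ^+ 2) (m ^+ 2 * (d / 2)) (Num.max x1 X)).
- by rewrite mulr_gt0 // ?exprn_gt0 // divr_gt0.
- by rewrite le_max X0 orbT.
- move=> x; rewrite in_itv /= andbT => /dv/der_cont cv.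
  exact: continuousM.
- by move=> x _; exact: sqr_ge0.
move=> x; rewrite gt_max => /andP[x1x Xx].
have x0 := gt0 _ (ltW x1x).
have /andP[Fm _] := profile_bounds pF (ltW x0).
have hx := hX x (ltW Xx).
have e0 := expR_gt0 (2 * a * x).
rewrite mulNr expRN ltr_pdivrMr // mul1r in hx.
have h2 := uu _ (ltW x1x).
have h3 : d * (expR (2 * a * x) / 2) <= u x ^+ 2.
  by apply: le_trans h2; rewrite ler_pM2l //; lra.
have h4 : m ^+ 2 * expR (- (2 * a * x)) <= F x ^+ 2.
  have -> : expR (- (2 * a * x)) = expR (- a * x) ^+ 2.
    by rewrite -expRM_natl; congr expR; ring.
  rewrite -exprMn; apply: lerXn2r => //; rewrite nnegrE.
    by rewrite mulr_ge0 ?expR_ge0 // ltW.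
  exact: ltW (profile_gt0 (ltW x0)).
rewrite vE //; apply: le_trans (ler_pM _ _ h3 h4).
- by rewrite expRN le_eqVlt; apply/orP; left; apply/eqP; field; rewrite gt_eqF.
- by apply: mulr_ge0; [exact: ltW|rewrite divr_ge0 ?expR_ge0].
- by rewrite mulr_ge0 ?sqr_ge0 ?expR_ge0.
Qed.

Lemma square_integrable_of_decay (v : R -> R) (C : R) :
  {in `]0, +oo[%R, continuous v} ->
  (forall x, 0 < x -> `|v x| <= C * expR (- a * x)) ->
  (\int[leb]_(x in halfline) (v x ^+ 2)%:E < +oo)%E.
Proof.
move=> cv vC; have a0 := profile_a pF.
have hE : halfline = `]0, +oo[%classic :> set R.
  by apply/seteqP; split => x /=; rewrite in_itv /= andbT.
pose g x := C ^+ 2 * expR (- (2 * a) * x).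
pose G x := - (C ^+ 2 / (2 * a)) * expR (- (2 * a) * x).
have dG (x : R) : is_derive x 1 G (g x).
  apply: der_eq (derZ _ (der_expM _ x)) _; rewrite /g; field.
  by rewrite gt_eqF.
have cg : continuous g.
  by move=> x; apply: cvgM; [exact: cvg_cst|exact: der_cont (der_expM _ x)].
have g0 x : 0 <= g x by rewrite mulr_ge0 ?sqr_ge0 ?expR_ge0.
have Gy : G x @[x --> +oo%R] --> (0 : R).
  apply/cvgrPdist_lt => e e0.
  have [X [X0 hX]] := @exp_small (2 * a) (C ^+ 2 / (2 * a)) e (mulr_gt0 (ltr0Sn _ 1) a0) e0.
  near=> x; rewrite sub0r /G mulNr opprK ger0_norm.
    by apply: hX; near: x; apply: nbhs_pinfty_ge; exact: num_real.
  by rewrite mulr_ge0 ?expR_ge0 // divr_ge0 ?sqr_ge0 // mulr_ge0 // ltW.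
have mg : measurable_fun (`]0, +oo[%classic : set R) (EFin \o g).
  apply/measurable_EFinP; apply: open_continuous_measurable_fun => //.
have mv : measurable_fun (`]0, +oo[%classic : set R) (EFin \o (fun x => v x ^+ 2)).
  apply/measurable_EFinP; apply: open_continuous_measurable_fun => //.
  move=> x; rewrite inE => /cv cvx; apply: cvgM; exact: cvx.
have h1 : (\int[leb]_(x in halfline) (v x ^+ 2)%:E <= \int[leb]_(x in `]0%R, +oo[) (g x)%:E)%E.
  rewrite hE; apply: ge0_le_integral => //.
  - by move=> x _; rewrite lee_fin sqr_ge0.
  - move=> x /=; rewrite in_itv /= andbT lee_fin => /vC h.
    rewrite -real_normK ?num_real // /g.
    have -> : expR (- (2 * a) * x) = expR (- a * x) ^+ 2.
      by rewrite -expRM_natl; congr expR; ring.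
    by rewrite -exprMn; apply: lerXn2r; rewrite ?nnegrE ?normr_ge0 ?(le_trans _ h).
apply: (le_lt_trans h1); rewrite integral_itv_obnd_cbnd //.
rewrite (@ge0_continuous_FTC2y R g G 0 0) //.
- by rewrite -EFinB ltry.
- by apply: continuous_subspaceT.
- by apply: cvg_at_right_filter; exact: (der_cont (dG 0)).
- by move=> x _; rewrite (der_derive1 (dG x)).
Unshelve. all: by end_near. Qed.

Lemma nonvanishing_same_sign (v : R -> R) (X : R) : 0 <= X ->
  (forall x, 0 <= x -> {for x, continuous v}) -> (forall x, 0 <= x -> v x != 0) ->
  0 < v X -> forall x, 0 <= x -> 0 < v x.
Proof.
move=> X0 cv v0 vX x x0; rewrite lt_neqAle eq_sym v0 //= leNgt; apply/negP => vx.
have key p q : 0 <= p -> p <= q -> Num.min (v p) (v q) <= 0 <= Num.max (v p) (v q) -> False.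
  move=> p0 pq h; have [|c] := @IVT R v p q 0 pq _ h.
    apply: continuous_in_subspaceT => y; rewrite inE /= in_itv /= => /andP[py _].
    exact: cv (le_trans p0 py).
  rewrite in_itv /= => /andP[pc _] /eqP.
  by apply/negP; exact: v0 (le_trans p0 pc).
have [h|/ltW h] := leP x X.
  by apply: (key x X x0 h); rewrite ge_min le_max (ltW vx) (ltW vX) orbT.
by apply: (key X x X0 h); rewrite ge_min le_max (ltW vx) (ltW vX) orbT.
Qed.

(** By [wronsk_sq_le0] the square of v / F decreases, and it is positive far
out, hence everywhere. *)
Lemma weyl_exists mu : 0 <= mu -> exists v v1, weyl a F H mu v v1.
Proof.
move=> mu0; have a0 := profile_a pF.
have [K HK] := profile_bounded pF.
pose k := Num.sqrt (mu + a ^+ 2).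
have s0 : 0 <= mu + a ^+ 2 by rewrite addr_ge0 ?sqr_ge0.
have kE : k ^+ 2 = mu + a ^+ 2 by rewrite sqr_sqrtr.
have k0 : 0 < k by rewrite sqrtr_gt0 ltr_wpDl // exprn_gt0.
have ak : a <= k.
  by rewrite -(@ler_pXn2r _ 2) ?nnegrE ?(ltW k0) ?(ltW a0) // kE lerDr.
have [v [v1 [C [dv dv1 vC [X [X0 vX]]]]]] := decaying_solution k0 (profile_cont pF) HK.
rewrite kE in dv1.
have C0 : 0 <= C.
  have [h _] := vC 0 (lexx 0); move: h; rewrite mulr0 expR0 mulr1.
  exact: le_trans.
have vCa x : 0 <= x -> `|v x| <= C * expR (- a * x) /\ `|v1 x| <= C * expR (- a * x).
  move=> x0; have [h1 h2] := vC _ x0.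
  have h : C * expR (- k * x) <= C * expR (- a * x).
    by rewrite ler_wpM2l // ler_expR ler_wpM2r // lerN2.
  by split; [apply: le_trans h1 h|apply: le_trans h2 h].
have L2 : (\int[leb]_(x in halfline) (v x ^+ 2)%:E < +oo)%E.
  apply: (@square_integrable_of_decay _ C).
    by move=> x _; exact: der_cont (dv x).
  by move=> x /ltW/vCa[].
have vW := @wronsk_sq_le0 mu v v1 mu0 (fun x _ => dv x) (fun x _ => dv1 x) L2.
pose u x := v x / F x.
have v0 x : 0 <= x -> v x != 0.
  move=> x0; pose y := Num.max x X.
  have y0 : 0 <= y by rewrite le_max x0.
  have vy : 0 < v y by apply: vX; rewrite le_max lexx orbT.
  have xy : x <= y by rewrite le_max lexx.
  have : - u x ^+ 2 <= - u y ^+ 2.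
    apply: (@der_homo R (fun t => - u t ^+ 2)
      (fun t => - (2 * u t * (wronsk v v1 t / F t ^+ 2)))) => //.
      move=> t /andP[xt _]; have t0 := le_trans x0 xt.
      apply: der_eq (derN (derX 1 (der_quotient t0 (dv t)))) _.
      by rewrite expr1.
    move=> t /andP[xt _]; have t0 := le_lt_trans x0 xt.
    rewrite oppr_ge0 /u.
    have F0 := profile_gt0 (ltW t0).
    rewrite (_ : _ * _ = 2 * (v t * wronsk v v1 t) / F t ^+ 3); last first.
      by field; rewrite gt_eqF.
    rewrite ler_pdivrMr ?exprn_gt0 // mul0r.
    by have := vW t t0; lra.
  rewrite lerN2 => h; apply/negP => /eqP vx0.
  move: h; rewrite leNgt => /negP; apply.
  by rewrite /u vx0 mul0r expr0n /= exprn_gt0 // divr_gt0 // profile_gt0.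
have vpos := nonvanishing_same_sign X0 (fun x _ => der_cont (dv x)) v0 (vX _ (lexx X)).
pose s := F 0 / v 0.
have s1 : 0 < s by rewrite divr_gt0 ?vpos ?profile_gt0.
exists (fun x => s * v x), (fun x => s * v1 x); split.
- by move=> x _; exact: derZ.
- by move=> x _; apply: der_eq (derZ s (dv1 x)) _; ring.
- by move=> x x0; rewrite mulr_gt0 // vpos.
- by rewrite /s; field; exact: v0.
- exists (s * C) => x x0; have [h1 h2] := vCa x x0.
  by rewrite !(normrM s) (gtr0_norm s1) -mulrA; split; rewrite ler_pM2l.
Qed.

End OneProfile.
End RadialEquation.

(** * Uniqueness, monotonicity and Riccati bounds *)
Section WeylSolutions.
Variable R : realType.
Notation leb := (@lebesgue_measure R).
Notation halfline := ([set x : R | 0 < x]).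

Section OneProfile.
Variables (a : R) (F F1 H : R -> R) (m M B : R).
Hypothesis pF : profile a F F1 H m M B.
Notation W := (wronsk F F1).

Lemma square_integrableB (v w : R -> R) (s : R) :
  {in `]0, +oo[%R, continuous v} -> {in `]0, +oo[%R, continuous w} ->
  (\int[leb]_(x in halfline) (v x ^+ 2)%:E < +oo)%E ->
  (\int[leb]_(x in halfline) (w x ^+ 2)%:E < +oo)%E ->
  (\int[leb]_(x in halfline) ((v x - s * w x) ^+ 2)%:E < +oo)%E.
Proof.
move=> cv cw iv iw.
have hE : halfline = `]0, +oo[%classic :> set R.
  by apply/seteqP; split => x /=; rewrite in_itv /= andbT.
have mcont (g : R -> R) : {in `]0, +oo[%R, continuous g} ->
    measurable_fun (`]0, +oo[%classic : set R) (EFin \o g).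
  move=> cg; apply/measurable_EFinP; apply: open_continuous_measurable_fun => //.
  by move=> x; rewrite inE => /cg.
have c2 (g : R -> R) k : {in `]0, +oo[%R, continuous g} ->
    {in `]0, +oo[%R, continuous (fun x => k * g x ^+ 2)}.
  move=> cg x x0; have h := cg x x0.
  by apply: cvgM; [exact: cvg_cst|apply: cvgM; exact: h].
have mZ (g : R -> R) k : {in `]0, +oo[%R, continuous g} ->
    measurable_fun (`]0, +oo[%classic : set R) (EFin \o (fun x => k * g x ^+ 2)).
  by move=> cg; apply: mcont; exact: c2.
have mX (g : R -> R) : {in `]0, +oo[%R, continuous g} ->
    measurable_fun (`]0, +oo[%classic : set R) (EFin \o (fun x => g x ^+ 2)).
  move=> cg; have := mZ g 1 cg; congr (measurable_fun _ _).
  by apply/funext => x /=; rewrite mul1r.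
have fin (g : R -> R) k : {in `]0, +oo[%R, continuous g} -> 0 <= k ->
    (\int[leb]_(x in `]0%R, +oo[) (g x ^+ 2)%:E < +oo)%E ->
    (\int[leb]_(x in `]0%R, +oo[) (k * g x ^+ 2)%:E < +oo)%E.
  move=> cg k0 ig; under eq_integral do rewrite EFinM.
  rewrite ge0_integralZl //; [|exact: mX|by move=> x _; rewrite lee_fin sqr_ge0].
  exact: lte_mul_pinfty.
rewrite hE in iv iw *.
have h : (\int[leb]_(x in `]0%R, +oo[) ((v x - s * w x) ^+ 2)%:E <=
    \int[leb]_(x in `]0%R, +oo[) ((2 * v x ^+ 2)%:E + ((2 * s ^+ 2) * w x ^+ 2)%:E))%E.
  apply: ge0_le_integral => //.
  - by move=> x _; rewrite lee_fin sqr_ge0.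
  - apply: mX => x x0; have hv := cv x x0; have hw := cw x x0.
    by apply: cvgB; [exact: hv|apply: cvgM; [exact: cvg_cst|exact: hw]].
  - by apply: emeasurable_funD; apply: mZ.
  - move=> x _; rewrite lee_fin -subr_ge0.
    rewrite (_ : _ - _ = (v x + s * w x) ^+ 2) ?sqr_ge0 //; ring.
apply: (le_lt_trans h); rewrite ge0_integralD //.
- apply: lte_add_pinfty; apply: fin => //.
  by rewrite mulr_ge0 ?sqr_ge0.
- by move=> x _; rewrite lee_fin; apply: mulr_ge0 => //; exact: sqr_ge0.
- exact: mZ.
- by move=> x _; rewrite lee_fin; apply: mulr_ge0; rewrite ?sqr_ge0 // mulr_ge0 ?sqr_ge0.
- exact: mZ.
Qed.

Lemma wronsk_quotient_antitone mu (v v1 : R -> R) : 0 <= mu ->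
  (forall x : R, 0 < x -> is_derive x 1 v (v1 x)) ->
  (forall x : R, 0 < x ->
    is_derive x 1 v1 ((mu + a ^+ 2 + expR (- x) * H (expR (- x))) * v x)) ->
  (\int[leb]_(x in halfline) (v x ^+ 2)%:E < +oo)%E ->
  forall x y, 0 < x -> x <= y -> (v y / F y) ^+ 2 <= (v x / F x) ^+ 2.
Proof.
move=> mu0 dv dv1 L2 x y x0 xy; rewrite -lerN2.
have vW := wronsk_sq_le0 pF mu0 dv dv1 L2.
apply: (@der_homo R (fun t => - (v t / F t) ^+ 2)
  (fun t => - (2 * (v t / F t) * (W v v1 t / F t ^+ 2)))) => //.
  move=> t /andP[xt _]; have t0 := lt_le_trans x0 xt.
  apply: der_eq (derN (derX 1 (der_quotient pF (ltW t0) (dv _ t0)))) _.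
  by rewrite expr1.
move=> t /andP[xt _]; have t0 := lt_trans x0 xt.
rewrite oppr_ge0.
have F0 := profile_gt0 pF (ltW t0).
rewrite (_ : _ * _ = 2 * (v t * W v v1 t) / F t ^+ 3); last first.
  by field; rewrite gt_eqF.
rewrite ler_pdivrMr ?exprn_gt0 // mul0r.
by have := vW t t0; lra.
Qed.

Lemma weyl_square_integrable mu (w w1 : R -> R) : weyl a F H mu w w1 ->
  (\int[leb]_(x in halfline) (w x ^+ 2)%:E < +oo)%E.
Proof.
move=> hw; have [C hC] := weyl_decay hw.
apply: (square_integrable_of_decay pF (C := C)).
  by move=> x; rewrite in_itv /= andbT => /ltW x0; exact: der_cont (weyl_der hw x0).
by move=> x /ltW/hC[].
Qed.

(** The difference of v and the multiple of w with the same boundary value is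
again square integrable, so that its quotient by F has a nonincreasing square
which starts from 0. *)
Lemma weyl_unique mu (v v1 w w1 : R -> R) : 0 <= mu -> weyl a F H mu w w1 ->
  (forall x : R, 0 < x -> is_derive x 1 v (v1 x)) ->
  (forall x : R, 0 < x ->
    is_derive x 1 v1 ((mu + a ^+ 2 + expR (- x) * H (expR (- x))) * v x)) ->
  v x @[x --> 0^'+] --> v 0 ->
  (\int[leb]_(x in halfline) (v x ^+ 2)%:E < +oo)%E ->
  forall x, 0 <= x -> v x = v 0 / F 0 * w x.
Proof.
move=> mu0 hw dv dv1 cv0 L2.
pose s := v 0 / F 0; pose d x := v x - s * w x; pose d1 x := v1 x - s * w1 x.
have F0 : F 0 != 0 by rewrite gt_eqF // (profile_gt0 pF).
have d0 : d 0 = 0 by rewrite /d (weyl_0 hw) /s; field.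
have dd (x : R) : 0 < x -> is_derive x 1 d (d1 x).
  by move=> x0; exact: derB (dv _ x0) (derZ s (weyl_der hw (ltW x0))).
have dd1 (x : R) : 0 < x ->
    is_derive x 1 d1 ((mu + a ^+ 2 + expR (- x) * H (expR (- x))) * d x).
  move=> x0; apply: der_eq (derB (dv1 _ x0) (derZ s (weyl_der1 hw (ltW x0)))) _.
  by rewrite /d; ring.
have cv : {in `]0, +oo[%R, continuous v}.
  by move=> x; rewrite in_itv /= andbT => /dv/der_cont.
have cw : {in `]0, +oo[%R, continuous w}.
  by move=> x; rewrite in_itv /= andbT => /ltW/(weyl_der hw)/der_cont.
have Ld := square_integrableB s cv cw L2 (weyl_square_integrable hw).
have anti := wronsk_quotient_antitone mu0 dd dd1 Ld.
have lim0 : (d x / F x) ^+ 2 @[x --> 0^'+] --> (0 : R).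
  have cF : F x @[x --> 0^'+] --> F 0.
    by apply: cvg_at_right_filter; exact: der_cont (profile_der pF (lexx 0)).
  have cw0 : w x @[x --> 0^'+] --> w 0.
    by apply: cvg_at_right_filter; exact: der_cont (weyl_der hw (lexx 0)).
  have h1 : d x @[x --> 0^'+] --> d 0.
    by apply: cvgB; [exact: cv0|apply: cvgM; [exact: cvg_cst|exact: cw0]].
  have h2 : d x / F x @[x --> 0^'+] --> d 0 / F 0.
    by apply: cvgM; [exact: h1|apply: cvgV; [exact: F0|exact: cF]].
  rewrite d0 mul0r in h2.
  have h3 := cvgM h2 h2.
  by rewrite mul0r in h3; exact: h3.
move=> x; rewrite le_eqVlt => /predU1P[<-|x0].
  by rewrite (weyl_0 hw); field.
apply/eqP; rewrite -subr_eq0 -[_ - _]/(d x).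
have Fx : F x != 0 by rewrite gt_eqF // (profile_gt0 pF (ltW x0)).
suff : (d x / F x) ^+ 2 <= 0.
  rewrite le_eqVlt ltNge sqr_ge0 orbF sqrf_eq0 mulf_eq0 invr_eq0 (negbTE Fx).
  by rewrite orbF.
apply/ler_addgt0Pr => e e0; rewrite add0r.
near (0 : R)^'+ => y.
apply: (@le_trans _ _ ((d y / F y) ^+ 2)).
  by apply: anti => //; near: y; exact: nbhs_right_le.
have : `|0 - (d y / F y) ^+ 2| <= e.
  by near: y; move/cvgrPdist_le : lim0; apply.
by rewrite sub0r normrN ger0_norm ?sqr_ge0.
Unshelve. all: by end_near. Qed.

(** The Wronskian E of v and w satisfies E' = (mu - mu') v w < 0 and tends to 0
at infinity, hence is positive at 0. *)
Lemma weyl_monotone mu mu' (v v1 w w1 : R -> R) : mu < mu' ->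
  weyl a F H mu v v1 -> weyl a F H mu' w w1 -> w1 0 < v1 0.
Proof.
move=> mumu hv hw; have a0 := profile_a pF.
pose E x := v1 x * w x - w1 x * v x.
have dE (x : R) : 0 <= x -> is_derive x 1 E (- ((mu' - mu) * (v x * w x))).
  move=> x0; apply: der_eq (derB (derM (weyl_der1 hv x0) (weyl_der hw x0))
    (derM (weyl_der1 hw x0) (weyl_der hv x0))) _.
  ring.
have E10 : E 1 < E 0.
  rewrite -ltrN2; apply: (@der_homo_lt R (fun x => - E x)
    (fun x => (mu' - mu) * (v x * w x))) => //.
    by move=> x /andP[x0 _]; apply: der_eq (derN (dE x x0)) _; rewrite opprK.
  move=> x /andP[/ltW x0 _].
  by rewrite !mulr_gt0 ?subr_gt0 ?(weyl_gt0 hv) ?(weyl_gt0 hw).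
have E1x x : 1 <= x -> E x <= E 1.
  move=> x1; rewrite -lerN2; apply: (@der_homo R (fun x => - E x)
    (fun x => (mu' - mu) * (v x * w x))) => //.
    move=> y /andP[y0 _]; apply: der_eq (derN (dE y _)) _; rewrite ?opprK //.
    exact: le_trans ler01 y0.
  move=> y /andP[/ltW y1 _]; have y0 := le_trans ler01 y1.
  by apply: ltW; rewrite !mulr_gt0 ?subr_gt0 ?(weyl_gt0 hv) ?(weyl_gt0 hw).
have E1 : 0 <= E 1.
  rewrite leNgt; apply/negP => E1.
  have [C hC] := weyl_decay hv; have [D hD] := weyl_decay hw.
  have D0 : 0 <= D.
    by have [h _] := hD 0 (lexx 0); move: h; rewrite mulr0 expR0 mulr1; exact: le_trans.
  have C0 : 0 <= C.
    by have [h _] := hC 0 (lexx 0); move: h; rewrite mulr0 expR0 mulr1; exact: le_trans.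
  have [|X [X0 hX]] := @exp_small R a (2 * C * D) (- E 1) a0; first by rewrite oppr_gt0.
  pose x := Num.max 1 X.
  have x1 : 1 <= x by rewrite le_max lexx.
  have x0 := le_trans ler01 x1.
  have xX : X <= x by rewrite le_max lexx orbT.
  have := hX x xX; have := E1x x x1.
  have [c1 c2] := hC x x0; have [e1 e2] := hD x x0.
  set t := expR (- a * x) in c1 c2 e1 e2 *.
  have t0 : 0 < t by exact: expR_gt0.
  have t1 : t <= 1 by rewrite -expR0 ler_expR mulNr oppr_le0 mulr_ge0 // ltW.
  have f1 : `|v1 x * w x| <= C * t * (D * t) by rewrite normrM ler_pM.
  have f2 : `|w1 x * v x| <= D * t * (C * t) by rewrite normrM ler_pM.
  have f3 : C * t * (D * t) <= C * D * t.
    rewrite (_ : _ * _ = C * D * t * t); last by ring.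
    by rewrite ler_piMr // !mulr_ge0 // ltW.
  have f4 : D * t * (C * t) = C * t * (D * t) by ring.
  have f5 := ler_norm (- (v1 x * w x)); have f6 := ler_norm (w1 x * v x).
  rewrite normrN in f5.
  rewrite /E; lra.
have := le_lt_trans E1 E10.
have F0 := profile_gt0 pF (lexx 0).
by rewrite /E (weyl_0 hv) (weyl_0 hw) -mulrBl pmulr_lgt0 // subr_gt0.
Qed.

Lemma profile_B_ge0 : 0 <= B.
Proof.
have F0 := profile_gt0 pF (lexx 0).
have := profile_log_der pF (lexx 0) => h.
by rewrite -(pmulr_lge0 B F0) (le_trans _ h).
Qed.

Lemma weyl_wronsk_le0 mu (v v1 : R -> R) : 0 <= mu -> weyl a F H mu v v1 ->
  forall x, 0 <= x -> W v v1 x <= 0.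
Proof.
move=> mu0 hv.
have pos x : 0 < x -> W v v1 x <= 0.
  move=> x0; rewrite -(pmulr_rle0 _ (weyl_gt0 hv (ltW x0))).
  apply: (@wronsk_sq_le0 R a F F1 H m M B pF mu v v1 mu0 _ _ _ _ x0).
  - by move=> y /ltW y0; exact: (weyl_der hv y0).
  - by move=> y /ltW y0; exact: (weyl_der1 hv y0).
  - exact: weyl_square_integrable hv.
move=> x; rewrite le_eqVlt => /predU1P[<-|]; last exact: pos.
apply: le_trans (pos 1 ltr01).
apply: (@der_homo R (W v v1) (fun t => mu * v t * F t)) => //.
  move=> t /andP[t0 _].
  exact: (der_wronsk pF t0 (weyl_der hv t0) (weyl_der1 hv t0)).
move=> t /andP[/ltW t0 _].
by rewrite !mulr_ge0 // ltW // ?(weyl_gt0 hv) // (profile_gt0 pF).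
Qed.

(** For u = v / F, the expression W + l v F is F^2 (u' + l u); multiplied by
exp (- l x) it has a derivative whose sign is that of
mu - l^2 + 2 l F1 / F. *)
Lemma der_riccati mu (v v1 : R -> R) (l : R) : weyl a F H mu v v1 ->
  forall x : R, 0 <= x ->
  is_derive x 1 (fun t => (W v v1 t + l * (v t * F t)) * expR (- l * t))
    (((mu - l ^+ 2) * F x + 2 * l * F1 x) * v x * expR (- l * x)).
Proof.
move=> hv x x0.
have dW := der_wronsk pF x0 (weyl_der hv x0) (weyl_der1 hv x0).
apply: der_eq (derM (derD dW (derZ l (derM (weyl_der hv x0) (profile_der pF x0))))
  (der_expM (- l) x)) _.
rewrite /W; ring.
Qed.

(** If u' + l u were negative somewhere, with l = sqrt mu + 2 B, then
[der_riccati] would keep it negative and u' below a negative constant, so that u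
would become negative. *)
Lemma weyl_riccati_lower mu (v v1 : R -> R) : 0 <= mu -> weyl a F H mu v v1 ->
  forall x, 0 <= x -> - ((Num.sqrt mu + 2 * B) * (v x * F x)) <= W v v1 x.
Proof.
move=> mu0 hv x1 x10; rewrite -subr_ge0 opprK leNgt; apply/negP.
set s := Num.sqrt mu; set l := s + 2 * B => neg.
have B0 := profile_B_ge0; have s0 : 0 <= s := sqrtr_ge0 mu.
have sE : s ^+ 2 = mu by rewrite sqr_sqrtr.
have l0 : 0 <= l by rewrite /l; lra.
pose h t := (W v v1 t + l * (v t * F t)) * expR (- l * t).
have hx1 : h x1 < 0 by rewrite pmulr_llt0 // expR_gt0.
have anti x : x1 <= x -> h x <= h x1.
  move=> x1x; rewrite -lerN2; apply: (@der_homo R (fun t => - h t)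
    (fun t => - (((mu - l ^+ 2) * F t + 2 * l * F1 t) * v t * expR (- l * t)))) => //.
    move=> t /andP[x1t _]; apply: derN; apply: der_riccati hv _ _.
    exact: le_trans x10 x1t.
  move=> t /andP[/ltW x1t _]; have t0 := le_trans x10 x1t.
  have F0 := profile_gt0 pF t0; have v0 := weyl_gt0 hv t0.
  have FB := le_trans (ler_norm _) (profile_log_der pF t0).
  rewrite oppr_ge0 -mulrA mulr_le0_ge0 //; last by rewrite mulr_ge0 ?expR_ge0 // ltW.
  have h1 : 2 * l * F1 t <= 2 * l * (B * F t) by rewrite ler_wpM2l // mulr_ge0.
  have h2 : (mu - l ^+ 2) * F t + 2 * l * (B * F t) = - (2 * B * s) * F t.
    by rewrite -sE /l; ring.
  have h3 : 0 <= 2 * B * s * F t by rewrite !mulr_ge0 // ltW.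
  rewrite mulNr in h2; lra.
have M0 := profile_M_gt0 pF.
have wle x : x1 <= x -> W v v1 x / F x ^+ 2 <= h x1 / M ^+ 2.
  move=> x1x; have x0 := le_trans x10 x1x.
  have F0 := profile_gt0 pF x0; have v0 := weyl_gt0 hv x0.
  have q1 : W v v1 x <= h x1.
    have p1 : W v v1 x <= W v v1 x + l * (v x * F x).
      by rewrite lerDl !mulr_ge0 // ltW.
    have p2 := anti x x1x.
    have p3 : 1 <= expR (l * x) by rewrite -expR0 ler_expR mulr_ge0.
    have p4 : W v v1 x + l * (v x * F x) = h x * expR (l * x).
      by rewrite /h -mulrA -expRD mulNr addNr expR0 mulr1.
    have p5 : h x * expR (l * x) <= h x1 * expR (l * x) by rewrite ler_wpM2r ?expR_ge0.
    have p6 : h x1 * expR (l * x) <= h x1 by rewrite ler_neMr // ltW.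
    lra.
  have /andP[_ FM] := profile_bounds pF x0.
  have FM' : F x <= M.
    apply: le_trans FM _; rewrite ler_piMr ?(ltW M0) // -expR0 ler_expR mulNr oppr_le0.
    by rewrite mulr_ge0 // ltW // (profile_a pF).
  have F2 : F x ^+ 2 <= M ^+ 2 by apply: lerXn2r => //; rewrite nnegrE ltW.
  rewrite ler_pdivrMr ?exprn_gt0 //; apply: (le_trans q1).
  rewrite mulrAC -mulrA ler_nMr // ?ler_pdivrMr ?exprn_gt0 // mul1r //.
pose c := - h x1 / M ^+ 2.
have c0 : 0 < c by rewrite divr_gt0 ?oppr_gt0 ?exprn_gt0.
have lin x : x1 <= x -> v x / F x + c * x <= v x1 / F x1 + c * x1.
  move=> x1x; rewrite -lerN2; apply: (@der_homo R (fun t => - (v t / F t + c * t))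
    (fun t => - (W v v1 t / F t ^+ 2 + c * 1))) => //.
    move=> t /andP[x1t _]; have t0 := le_trans x10 x1t.
    apply: derN; apply: derD; first exact: (der_quotient pF t0 (weyl_der hv t0)).
  move=> t /andP[/ltW x1t _]; have := wle t x1t.
  by rewrite mulr1 oppr_ge0 /c mulNr; lra.
have u1 : 0 < v x1 / F x1 by rewrite divr_gt0 // ?(weyl_gt0 hv) // (profile_gt0 pF).
pose x := x1 + v x1 / F x1 / c.
have x1x : x1 <= x by rewrite lerDl ltW // divr_gt0.
have := lin x x1x.
have x0 := le_trans x10 x1x.
have : 0 < v x / F x by rewrite divr_gt0 // ?(weyl_gt0 hv) // (profile_gt0 pF).
rewrite {4}/x mulrDr [c * (_ / c)]mulrC divfK ?gt_eqF //; lra.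
Qed.

(** If u' + l u were positive somewhere, with l = sqrt mu - 2 B, then
F^2 (u' + l u) would grow like exp (l x) by [der_riccati], whereas it is at most
l F^2 u, which is bounded. *)
Lemma weyl_riccati_upper mu (v v1 : R -> R) : 0 <= mu -> weyl a F H mu v v1 ->
  2 * B < Num.sqrt mu ->
  forall x, 0 <= x -> W v v1 x <= - ((Num.sqrt mu - 2 * B) * (v x * F x)).
Proof.
move=> mu0 hv sB x1 x10; rewrite -subr_le0 opprK leNgt; apply/negP.
move: sB; set s := Num.sqrt mu; set l := s - 2 * B => sB pos.
have B0 := profile_B_ge0.
have sE : s ^+ 2 = mu by rewrite sqr_sqrtr.
have l0 : 0 < l by rewrite /l; lra.
pose h t := (W v v1 t + l * (v t * F t)) * expR (- l * t).
have hx1 : 0 < h x1 by rewrite pmulr_lgt0 // expR_gt0.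
have homo x : x1 <= x -> h x1 <= h x.
  move=> x1x; apply: (@der_homo R h
    (fun t => (((mu - l ^+ 2) * F t + 2 * l * F1 t) * v t * expR (- l * t)))) => //.
    move=> t /andP[x1t _]; apply: der_riccati hv _ _.
    exact: le_trans x10 x1t.
  move=> t /andP[/ltW x1t _]; have t0 := le_trans x10 x1t.
  have F0 := profile_gt0 pF t0; have v0 := weyl_gt0 hv t0.
  have := ler_norm (- F1 t); rewrite normrN => /le_trans/(_ (profile_log_der pF t0)) FB.
  rewrite -mulrA mulr_ge0 //; last by rewrite mulr_ge0 ?expR_ge0 // ltW.
  have h1 : 2 * l * (- F1 t) <= 2 * l * (B * F t) by rewrite ler_wpM2l // mulr_ge0 // ltW.
  have h2 : (mu - l ^+ 2) * F t - 2 * l * (B * F t) = 2 * B * s * F t.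
    by rewrite -sE /l; ring.
  have h3 : 0 <= 2 * B * s * F t by rewrite !mulr_ge0 ?sqrtr_ge0 // ltW.
  rewrite mulrN in h1; lra.
have M0 := profile_M_gt0 pF.
have [C hC] := weyl_decay hv.
have a0 := profile_a pF.
have e1 x : 0 <= x -> expR (- a * x) <= 1.
  by move=> x0; rewrite -expR0 ler_expR mulNr oppr_le0 mulr_ge0 // ltW.
have C0 : 0 <= C.
  by have [g _] := hC 0 (lexx 0); move: g; rewrite mulr0 expR0 mulr1; exact: le_trans.
have [X [X0 hX]] := @exp_small R l (l * (C * M)) (h x1) l0 hx1.
pose x := Num.max x1 X.
have x1x : x1 <= x by rewrite le_max lexx.
have x0 := le_trans x10 x1x.
have xX : X <= x by rewrite le_max lexx orbT.
have := hX x xX; have := homo x x1x.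
have F0 := profile_gt0 pF x0; have v0 := weyl_gt0 hv x0.
have vC : v x <= C.
  have [g _] := hC x x0; apply: le_trans (ler_norm _) _; apply: (le_trans g).
  by rewrite ler_piMr // e1.
have FM : F x <= M.
  have /andP[_ g] := profile_bounds pF x0; apply: (le_trans g).
  by rewrite ler_piMr ?(ltW M0) // e1.
have vF : v x * F x <= C * M by rewrite ler_pM // ltW.
have W0 := weyl_wronsk_le0 mu0 hv x0.
have : h x <= l * (C * M) * expR (- l * x).
  rewrite ler_wpM2r ?expR_ge0 //.
  have : l * (v x * F x) <= l * (C * M) by rewrite ler_pM2l.
  lra.
lra.
Qed.

(** Integration of the two Riccati bounds from u(0) = 1. *)
Lemma weyl_exp_bounds mu (v v1 : R -> R) : 0 <= mu -> weyl a F H mu v v1 ->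
  2 * B < Num.sqrt mu -> forall x, 0 <= x ->
  expR (- (Num.sqrt mu + 2 * B) * x) <= v x / F x <= expR (- (Num.sqrt mu - 2 * B) * x).
Proof.
move=> mu0 hv sB x x0.
have u0 : v 0 / F 0 = 1.
  by rewrite (weyl_0 hv) divff // gt_eqF // (profile_gt0 pF).
have du t : 0 <= t -> is_derive (t : R) 1 (fun t => v t / F t) (W v v1 t / F t ^+ 2).
  by move=> t0; exact: (der_quotient pF t0 (weyl_der hv t0)).
have key l (t : R) : 0 <= t -> is_derive t 1 (fun t => v t / F t * expR (l * t))
    ((W v v1 t + l * (v t * F t)) / F t ^+ 2 * expR (l * t)).
  move=> t0; apply: der_eq (derM (du t t0) (der_expM l t)) _.
  by field; rewrite gt_eqF // (profile_gt0 pF).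
set s := Num.sqrt mu in sB *; apply/andP; split.
- rewrite mulNr expRN -[_^-1]mul1r ler_pdivrMr ?expR_gt0 //.
  suff : v 0 / F 0 * expR ((s + 2 * B) * 0) <= v x / F x * expR ((s + 2 * B) * x).
    by rewrite u0 mulr0 expR0 mulr1.
  apply: (@der_homo R (fun t => v t / F t * expR ((s + 2 * B) * t)) _ _ _ x0).
    by move=> t /andP[t0 _]; exact: key.
  move=> t /andP[/ltW t0 _].
  rewrite mulr_ge0 ?expR_ge0 // divr_ge0 ?sqr_ge0 //.
  by have := weyl_riccati_lower mu0 hv t0; rewrite -/s; lra.
- rewrite mulNr expRN -[leRHS]mul1r ler_pdivlMr ?expR_gt0 //.
  suff : - (v 0 / F 0 * expR ((s - 2 * B) * 0)) <= - (v x / F x * expR ((s - 2 * B) * x)).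
    by rewrite u0 mulr0 expR0 mulr1 lerN2.
  apply: (@der_homo R (fun t => - (v t / F t * expR ((s - 2 * B) * t))) _ _ _ x0).
    by move=> t /andP[t0 _]; apply: derN; exact: key.
  move=> t /andP[/ltW t0 _]; rewrite -mulNr -mulNr.
  rewrite mulr_ge0 ?expR_ge0 // divr_ge0 ?sqr_ge0 //.
  by have := weyl_riccati_upper mu0 hv sB t0; rewrite -/s; lra.
Qed.

End OneProfile.
End WeylSolutions.

(** * Comparison of two profiles *)
Section Comparison.
Variables (R : realType) (a : R).
Variables (F F1 H : R -> R) (m M B : R) (F' F1' H' : R -> R) (m' M' B' : R).
Hypotheses (pF : profile a F F1 H m M B) (pF' : profile a F' F1' H' m' M' B').
Notation W := (wronsk F F1).
Notation W' := (wronsk F' F1').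

(** The function E = W u' - W' u vanishes at 0 when W(0) = W'(0), where u, u'
are the quotients of the two solutions by their profiles, and has a nonnegative
derivative on (0, e).  Its growth on (d, 2 d) beats its size at 4 d as soon as
sqrt mu is large. *)
Lemma weyl_comparison (e : R) : 0 < e -> F 0 = F' 0 ->
  (forall x, 0 < x < e -> F' x < F x) ->
  exists T, forall mu v v1 v' v1', 0 <= mu -> T <= Num.sqrt mu ->
    weyl a F H mu v v1 -> weyl a F' H' mu v' v1' -> W v v1 0 <> W' v' v1' 0.
Proof.
move=> e0 FF0 FF.
have F0 x : 0 <= x -> 0 < F x by exact: profile_gt0 pF x.
have F0' x : 0 <= x -> 0 < F' x by exact: profile_gt0 pF' x.
have FF2 x : 0 < x < e -> F' x ^+ 2 < F x ^+ 2.
  move=> /[dup] /andP[/ltW x0 _] /FF h.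
  by rewrite ltr_pXn2r ?nnegrE ?(ltW (F0 _ x0)) ?(ltW (F0' _ x0)).
(* Any d with 4 d < e would do. *)
pose d := e / 5.
have dE5 : 5 * d = e by rewrite /d; field.
have d0 : 0 < d by rewrite divr_gt0.
pose b := 2 * Num.max B B'.
have B0 := profile_B_ge0 pF; have B0' := profile_B_ge0 pF'.
have bB : 2 * B <= b by rewrite ler_pM2l // le_max lexx.
have bB' : 2 * B' <= b by rewrite ler_pM2l // le_max lexx orbT.
have b0 : 0 <= b by rewrite (le_trans _ bB) // mulr_ge0.
have [eta eta0 hmin] : exists2 eta, 0 < eta &
    forall x, d <= x <= 2 * d -> eta <= F x ^+ 2 - F' x ^+ 2.
  have [||c] := @EVT_min R (fun x => F x ^+ 2 - F' x ^+ 2) d (2 * d).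
  - lra.
  - apply: continuous_in_subspaceT => x; rewrite inE /= in_itv /= => /andP[dx _].
    have x0 : 0 <= x by lra.
    have c1 := der_cont (profile_der pF x0); have c2 := der_cont (profile_der pF' x0).
    by apply: cvgB; apply: cvgM.
  rewrite in_itv /= => /andP[dc c2] hc.
  exists (F c ^+ 2 - F' c ^+ 2).
    by rewrite subr_gt0; apply: FF2; apply/andP; split; lra.
  by move=> x hx; apply: hc; rewrite in_itv.
(* The two estimates of E give 1 <= C exp (- 4 d sqrt mu). *)
pose C := 2 * M' ^+ 2 * expR (12 * b * d) / (eta * d).
have [X [X0 hX]] := @exp_small R (4 * d) C 1 (mulr_gt0 (ltr0Sn _ 3) d0) ltr01.
exists (Num.max X (b + 1)) => mu v v1 v' v1' mu0.
set s := Num.sqrt mu; rewrite ge_max => /andP[sX sb] hv hv' eqW.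
have sE : s ^+ 2 = mu by rewrite sqr_sqrtr.
have s1 : 1 <= s by lra.
pose u x := v x / F x; pose u' x := v' x / F' x.
have u0 x : 0 <= x -> 0 < u x by move=> x0; rewrite divr_gt0 ?F0 // (weyl_gt0 hv).
have u0' x : 0 <= x -> 0 < u' x by move=> x0; rewrite divr_gt0 ?F0' // (weyl_gt0 hv').
pose E x := W v v1 x * u' x - W' v' v1' x * u x.
pose E1 x := mu * u x * u' x * (F x ^+ 2 - F' x ^+ 2) +
  (F x ^+ 2 - F' x ^+ 2) * (W v v1 x / F x ^+ 2) * (W' v' v1' x / F' x ^+ 2).
have dE (x : R) : 0 <= x -> is_derive x 1 E (E1 x).
  move=> x0.
  have p1 := der_wronsk pF x0 (weyl_der hv x0) (weyl_der1 hv x0).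
  have p2 := der_wronsk pF' x0 (weyl_der hv' x0) (weyl_der1 hv' x0).
  have p3 := der_quotient pF x0 (weyl_der hv x0).
  have p4 := der_quotient pF' x0 (weyl_der hv' x0).
  apply: der_eq (derB (derM p1 p4) (derM p2 p3)) _.
  by rewrite /E1 /u /u'; field; rewrite !gt_eqF ?F0 ?F0'.
have E0 : E 0 = 0.
  by rewrite /E /u /u' (weyl_0 hv) (weyl_0 hv') !divff ?gt_eqF ?F0 ?F0' // eqW subrr.
have W0 x : 0 <= x -> W v v1 x / F x ^+ 2 <= 0.
  move=> x0; rewrite ler_pdivrMr ?exprn_gt0 ?F0 // mul0r.
  exact: (weyl_wronsk_le0 pF mu0 hv x0).
have W0' x : 0 <= x -> W' v' v1' x / F' x ^+ 2 <= 0.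
  move=> x0; rewrite ler_pdivrMr ?exprn_gt0 ?F0' // mul0r.
  exact: (weyl_wronsk_le0 pF' mu0 hv' x0).
have E1_ge x : 0 <= x < e -> mu * u x * u' x * (F x ^+ 2 - F' x ^+ 2) <= E1 x.
  move=> /andP[x0 xe].
  have dF : 0 <= F x ^+ 2 - F' x ^+ 2.
    move: x0; rewrite le_eqVlt => /predU1P[<-|x0]; first by rewrite FF0 subrr.
    by rewrite subr_ge0 ltW // FF2 // x0.
  by rewrite lerDl -mulrA mulr_ge0 // mulr_le0 // ?W0 ?W0'.
have sB : 2 * B < s by lra.
have sB' : 2 * B' < s by lra.
have ub x : 0 <= x -> expR (- (s + b) * x) <= u x <= expR (- (s - b) * x).
  move=> x0; have /andP[h1 h2] := weyl_exp_bounds pF mu0 hv sB x0; rewrite -/s in h1 h2.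
  apply/andP; split; [apply: le_trans h1|apply: (le_trans h2)];
    by rewrite ler_expR ler_wpM2r //; lra.
have ub' x : 0 <= x -> expR (- (s + b) * x) <= u' x <= expR (- (s - b) * x).
  move=> x0; have /andP[h1 h2] := weyl_exp_bounds pF' mu0 hv' sB' x0; rewrite -/s in h1 h2.
  apply/andP; split; [apply: le_trans h1|apply: (le_trans h2)];
    by rewrite ler_expR ler_wpM2r //; lra.
have d4 : 0 <= 4 * d by lra.
pose L := mu * (expR (- (s + b) * (2 * d)) ^+ 2) * eta.
have Ed : 0 <= E d.
  rewrite -E0; apply: (@der_homo R E E1 0 d) => //; first exact: ltW.
    by move=> x /andP[x0 _]; exact: dE.
  move=> x /andP[x0 xd]; apply: le_trans (E1_ge x _); last by apply/andP; split; lra.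
  have g1 := u0 _ (ltW x0); have g2 := u0' _ (ltW x0).
  have g3 : F' x ^+ 2 < F x ^+ 2 by apply: FF2; apply/andP; split; lra.
  apply: mulr_ge0; last by rewrite subr_ge0 ltW.
  exact: mulr_ge0 (mulr_ge0 mu0 (ltW g1)) (ltW g2).
(* On (d, 2 d) the derivative of E is at least L. *)
have E2d : E d + L * d <= E (2 * d).
  rewrite -lerBrDr.
  have -> : E (2 * d) - L * d = (E (2 * d) - L * (2 * d)) + L * d by ring.
  rewrite -lerBlDr; apply: (@der_homo R (fun x => E x - L * x) (fun x => E1 x - L * 1)).
  - lra.
  - move=> x /andP[dx _]; apply: derB; first by apply: dE; lra.
  move=> x /andP[dx x2d]; have x0 : 0 <= x by lra.
  rewrite mulr1 subr_ge0; apply: le_trans (E1_ge x _); last first.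
    by apply/andP; split; lra.
  have t0 := expR_gt0 (- (s + b) * (2 * d)).
  have tx : expR (- (s + b) * (2 * d)) <= expR (- (s + b) * x).
    by rewrite ler_expR ler_wnM2l //; lra.
  have /andP[/(le_trans tx) h1 _] := ub x x0.
  have /andP[/(le_trans tx) h2 _] := ub' x x0.
  rewrite /L; apply: ler_pM.
  - by rewrite mulr_ge0 // exprn_ge0 // ltW.
  - exact: ltW.
  - by rewrite -mulrA ler_wpM2l // expr2 ler_pM // ltW.
  - by apply: hmin; rewrite !ltW.
have E4d : E (2 * d) <= E (4 * d).
  apply: (@der_homo R E E1) => //; first lra.
    by move=> x /andP[x0 _]; apply: dE; lra.
  move=> x /andP[x0 xd]; have x0' : 0 < x by lra.
  apply: le_trans (E1_ge x _); last by apply/andP; split; lra.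
  have g1 := u0 _ (ltW x0'); have g2 := u0' _ (ltW x0').
  have g3 : F' x ^+ 2 < F x ^+ 2 by apply: FF2; apply/andP; split; lra.
  apply: mulr_ge0; last by rewrite subr_ge0 ltW.
  exact: mulr_ge0 (mulr_ge0 mu0 (ltW g1)) (ltW g2).
have Eup : E (4 * d) <= (s + b) * M' ^+ 2 * (expR (- (s - b) * (4 * d)) ^+ 2).
  set x := 4 * d in d4 *.
  have /andP[_ h1] := ub x d4; have /andP[_ h2] := ub' x d4.
  have w0 : W v v1 x <= 0 by exact: (weyl_wronsk_le0 pF mu0 hv d4).
  have w1 := weyl_riccati_lower pF' mu0 hv' d4; rewrite -/s in w1.
  have FM : F' x <= M'.
    have /andP[_ g] := profile_bounds pF' d4; apply: (le_trans g).
    rewrite ler_piMr ?(ltW (profile_M_gt0 pF')) // -expR0 ler_expR mulNr oppr_le0.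
    by rewrite mulr_ge0 // ltW // (profile_a pF').
  have F2 : F' x ^+ 2 <= M' ^+ 2.
    by apply: lerXn2r => //; rewrite nnegrE ?(ltW (F0' _ d4)) ?(ltW (profile_M_gt0 pF')).
  have v'E : v' x = u' x * F' x by rewrite /u' divfK // gt_eqF ?F0'.
  have g1 : W v v1 x * u' x <= 0 by rewrite mulr_le0_ge0 // ltW // u0'.
  have g2 : - W' v' v1' x <= (s + b) * (u' x * F' x ^+ 2).
    have -> : u' x * F' x ^+ 2 = v' x * F' x by rewrite v'E; ring.
    apply: (@le_trans _ _ ((s + 2 * B') * (v' x * F' x))); first lra.
    apply: ler_wpM2r; last lra.
    by rewrite mulr_ge0 // ltW ?F0' // (weyl_gt0 hv').
  have g3 : - W' v' v1' x * u x <= (s + b) * (u' x * F' x ^+ 2) * u x.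
    by rewrite ler_wpM2r // ltW // u0.
  have g4 : (s + b) * (u' x * F' x ^+ 2) * u x <=
      (s + b) * M' ^+ 2 * (expR (- (s - b) * x) ^+ 2).
    rewrite -2!mulrA; apply: ler_wpM2l; first lra.
    have -> : u' x * F' x ^+ 2 * u x = F' x ^+ 2 * (u' x * u x) by rewrite mulrAC mulrC.
    have q0 := ltW (u0 _ d4); have q1 := ltW (u0' _ d4).
    by apply: ler_pM; [exact: sqr_ge0|exact: mulr_ge0|exact: F2|rewrite expr2 ler_pM].
  rewrite /E; rewrite mulNr in g3; lra.
have fin : L * d <= (s + b) * M' ^+ 2 * (expR (- (s - b) * (4 * d)) ^+ 2) by lra.
have hs := hX s sX.
move: hs; rewrite ltNge => /negP; apply.
have eE : expR (- (s - b) * (4 * d)) ^+ 2 = expR (12 * b * d) * expR (- (4 * d) * s) *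
    expR (- (s + b) * (2 * d)) ^+ 2.
  by rewrite -!expRM_natl -!expRD; congr expR; ring.
move: fin; rewrite eE /L.
set t := expR (- (s + b) * (2 * d)) ^+ 2.
have t0 : 0 < t by rewrite exprn_gt0 // expR_gt0.
set P := expR (12 * b * d); set Q := expR (- (4 * d) * s).
have P0 : 0 < P by exact: expR_gt0. have Q0 : 0 < Q by exact: expR_gt0.
rewrite (_ : mu * t * eta * d = mu * eta * d * t); last by ring.
rewrite (_ : (s + b) * M' ^+ 2 * (P * Q * t) = (s + b) * M' ^+ 2 * P * Q * t); last by ring.
rewrite ler_pM2r // => fin.
have K0 : 0 <= M' ^+ 2 * P * Q by exact: mulr_ge0 (mulr_ge0 (sqr_ge0 _) (ltW P0)) (ltW Q0).
have f2 : s * (eta * d) <= s * (2 * (M' ^+ 2 * P * Q)).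
  apply: (@le_trans _ _ (mu * eta * d)).
    rewrite -sE expr2 -!mulrA; apply: ler_wpM2l; first lra.
    by apply: ler_peMl => //; rewrite mulr_ge0 // ltW.
  apply: (le_trans fin).
  rewrite (_ : (s + b) * M' ^+ 2 * P * Q = (s + b) * (M' ^+ 2 * P * Q)); last by ring.
  by rewrite [leRHS]mulrA; apply: ler_wpM2r => //; lra.
have s0 : 0 < s by lra.
rewrite ler_pM2l // in f2.
have ed0 : 0 < eta * d by rewrite mulr_gt0.
rewrite /C -/P -/Q mulrAC ler_pdivlMr // mul1r; apply: (le_trans f2).
by rewrite le_eqVlt; apply/orP; left; apply/eqP; ring.
Qed.

End Comparison.

(** * Analytic functions *)
Section PowerSeries.
Variable R : realType.
Implicit Types (g : R -> R) (a : nat -> R) (r rho : R).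

Definition power_series_at g (r0 : R) a rho := forall r, `|r - r0| < rho ->
  series (fun n => a n * (r - r0) ^+ n) @ \oo --> g r.

Definition analytic_at g (r0 : R) := exists a rho, 0 < rho /\ power_series_at g r0 a rho.

(** The form of Bernoulli's inequality that bounds n q^n by a geometric
sequence of ratio q + e. *)
Lemma bernoulli_geometric (q e : R) n : 0 <= q -> q <= 1 -> 0 <= e ->
  (1 + n%:R * e) * q ^+ n <= (q + e) ^+ n.
Proof.
move=> q0 q1 e0; elim: n => [|n ih]; first by rewrite mul0r addr0 mul1r !expr0.
have p0 : 0 <= (1 + n%:R * e) by rewrite addr_ge0 // mulr_ge0.
have s0 : 0 <= q ^+ n by rewrite exprn_ge0.
rewrite !exprS; apply: (@le_trans _ _ ((q + e) * ((1 + n%:R * e) * q ^+ n))); last first.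
  by rewrite ler_wpM2l // addr_ge0.
rewrite -subr_ge0 (_ : _ - _ = e * q ^+ n * ((1 - q) + n%:R * e)).
  by rewrite !mulr_ge0 // addr_ge0 ?subr_ge0 // mulr_ge0.
by rewrite -natr1; ring.
Qed.

Lemma cvg_pseries_diffs a (K L : R) : cvgn (pseries a L) -> `|K| < `|L| ->
  cvgn (pseries (pseries_diffs a) K).
Proof.
move=> cL KL; have L0 : 0 < `|L| by exact: le_lt_trans KL.
have [M [Mr hM]] := cvg_series_bounded cL.
pose N := `|M| + 1.
have N0 : 0 < N by rewrite ltr_wpDl.
have aN n : `|a n| * `|L| ^+ n <= N.
  rewrite -normrX -normrM; apply: (hM N _ n I).
  by rewrite /N (le_lt_trans (ler_norm M)) // ltrDl.
pose q := `|K| / `|L|.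
have q0 : 0 <= q by rewrite divr_ge0.
have q1 : q < 1 by rewrite ltr_pdivrMr // mul1r.
pose e := (1 - q) / 2.
have e0 : 0 < e by rewrite divr_gt0 // subr_gt0.
have e1 : e <= 1 by rewrite /e; lra.
pose p := q + e.
have p0 : 0 <= p by rewrite addr_ge0 // ltW.
have p1 : `|p| < 1 by rewrite ger0_norm // /p /e; lra.
apply: normed_cvg.
apply: (@series_le_cvg _ _ (geometric (N / `|L| / e) p)).
- by move=> n; exact: normr_ge0.
- move=> n /=; apply: mulr_ge0; last exact: exprn_ge0.
  exact: divr_ge0 (divr_ge0 (ltW N0) (ltW L0)) (ltW e0).
- move=> n /=; rewrite /pseries_diffs !normrM normrX ger0_norm //.
  have := bernoulli_geometric n q0 (ltW q1) (ltW e0) => h.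
  have h1 : n.+1%:R * q ^+ n <= p ^+ n / e.
    rewrite ler_pdivlMr // mulrAC; apply: le_trans h.
    rewrite ler_wpM2r ?exprn_ge0 // -natr1 mulrDl mul1r addrC lerD2r //.
  have h2 : `|a n.+1| * `|L| ^+ n <= N / `|L|.
    by rewrite ler_pdivlMr // -mulrA -exprSr.
  have -> : n.+1%:R * `|a n.+1| * `|K| ^+ n = (`|a n.+1| * `|L| ^+ n) * (n.+1%:R * q ^+ n).
    by rewrite /q expr_div_n; field; rewrite expf_neq0 // gt_eqF.
  have -> : N / `|L| / e * p ^+ n = N / `|L| * (p ^+ n / e) by field; rewrite !gt_eqF.
  by apply: ler_pM => //; rewrite mulr_ge0 // exprn_ge0.
- exact: is_cvg_geometric_series.
Qed.

Lemma power_series_cvg g (r0 : R) a rho (x : R) : power_series_at g r0 a rho -> `|x| < rho ->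
  pseries a x @ \oo --> g (r0 + x).
Proof.
move=> h xr; have := h (r0 + x).
rewrite (_ : r0 + x - r0 = x); last by ring.
exact.
Qed.

Lemma power_series_derive g (r0 : R) a rho : 0 < rho -> power_series_at g r0 a rho ->
  forall r, `|r - r0| < rho ->
  is_derive r 1 g (limn (pseries (pseries_diffs a) (r - r0))).
Proof.
move=> rho0 ga r hr.
pose K := (`|r - r0| + rho) / 2.
have K0 : 0 < K by rewrite divr_gt0 // ltr_wpDl.
pose L := (K + rho) / 2; pose L2 := (L + rho) / 2; pose L3 := (L2 + rho) / 2.
have [rK KL LL2 L2L3 L3r] : [/\ `|r - r0| < K, K < L, L < L2, L2 < L3 & L3 < rho].
  by split; rewrite /L3 /L2 /L /K; lra.
have nK : `|K| = K by rewrite ger0_norm // ltW.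
have nL : `|L| = L by rewrite ger0_norm //; lra.
have nL2 : `|L2| = L2 by rewrite ger0_norm //; lra.
have nL3 : `|L3| = L3 by rewrite ger0_norm //; lra.
have c3 : cvgn (pseries a L3).
  by apply/cvg_ex; exists (g (r0 + L3)); apply: power_series_cvg ga _; rewrite nL3.
have c2 : cvgn (pseries a K).
  apply/cvg_ex; exists (g (r0 + K)); apply: power_series_cvg ga _; rewrite nK; lra.
have d2 : cvgn (pseries (pseries_diffs a) L2).
  by apply: cvg_pseries_diffs c3 _; rewrite nL2 nL3.
have d1 : cvgn (pseries (pseries_diffs a) K).
  by apply: cvg_pseries_diffs c3 _; rewrite nK nL3; lra.
have dd : cvgn (pseries (pseries_diffs (pseries_diffs a)) K).
  by apply: cvg_pseries_diffs d2 _; rewrite nK nL2; lra.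
have h := pseries_snd_diffs c2 d1 dd (_ : `|r - r0| < `|K|).
rewrite nK in h; have {}h := h rK.
have hs : is_derive r 1 (fun x => x - r0) 1.
  by apply: der_eq (derB (is_derive_id r 1) (derC r0 r)) _; rewrite subr0.
apply: der_near; last first.
  by apply: der_eq (@der_comp R (fun x => limn (pseries a x)) (fun x => x - r0) r _ _ h hs) _; rewrite mulr1.
near=> x; apply: cvg_lim => //.
have xr : `|x - r0| < rho.
  near: x; have := @cvgr_lt R R _ _ (fun x => `|x - r0|) `|r - r0| _ rho hr; apply.
  by apply: cvg_norm; apply: cvgB; [exact: cvg_id|exact: cvg_cst].
by have := ga x xr.
Unshelve. all: by end_near. Qed.

Lemma analytic_der g (r0 : R) : analytic_at g r0 -> is_derive r0 1 g (derive1 g r0).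
Proof.
move=> [a [rho [rho0 ga]]].
have h : `|r0 - r0| < rho by rewrite subrr normr0.
have d := power_series_derive rho0 ga h.
by rewrite (der_derive1 d).
Qed.

Lemma analytic_derive1 g (r0 : R) : analytic_at g r0 -> analytic_at (derive1 g) r0.
Proof.
move=> [a [rho [rho0 ga]]]; exists (pseries_diffs a), rho; split => // r hr.
rewrite (der_derive1 (power_series_derive rho0 ga hr)).
suff : cvgn (pseries (pseries_diffs a) (r - r0)) by [].
pose K := (`|r - r0| + rho) / 2.
have K0 : 0 < K by rewrite divr_gt0 // ltr_wpDl.
have nK : `|K| = K by rewrite ger0_norm // ltW.
apply: (@cvg_pseries_diffs a _ K); last by rewrite nK /K; lra.
apply/cvg_ex; exists (g (r0 + K)); apply: power_series_cvg ga _; rewrite nK /K; lra.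
Qed.

Lemma analytic_sub f g (r0 : R) : analytic_at f r0 -> analytic_at g r0 ->
  analytic_at (fun r => f r - g r) r0.
Proof.
move=> [a [rho [rho0 fa]]] [b [eps [eps0 gb]]].
exists (fun n => a n - b n), (Num.min rho eps); split; first by rewrite lt_min rho0.
move=> r; rewrite lt_min => /andP[h1 h2].
have := cvgB (fa r h1) (gb r h2).
rewrite (_ : series (fun n => (a n - b n) * (r - r0) ^+ n) =
  series (fun n => a n * (r - r0) ^+ n) \- series (fun n => b n * (r - r0) ^+ n)).
  by apply.
apply/funext => n; rewrite /series /= -sumrB.
by apply: eq_bigr => i _; rewrite mulrBl.
Qed.

Lemma power_series_at_center g (r0 : R) a rho : 0 < rho -> power_series_at g r0 a rho ->
  g r0 = a 0%N.
Proof.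
move=> rho0 ga; have h : `|r0 - r0| < rho by rewrite subrr normr0.
have := ga _ h; rewrite subrr => c.
have c' : series (fun n => a n * 0 ^+ n) @ \oo --> a 0%N.
  apply: cvg_near_cst; exists 1%N => // n /= n1.
  rewrite /series /= -(prednK n1) big_nat_recl //= expr0 mulr1 big1_seq ?addr0 //.
  by move=> i _; rewrite expr0n mulr0.
by apply: cvg_unique c c'; exact: Rhausdorff.
Qed.

(** Induction on the order of vanishing: dividing g by r - r0 shifts the
coefficients. *)
Lemma isolated_zero_order N g (r0 : R) a rho : 0 < rho -> power_series_at g r0 a rho ->
  (forall i, (i < N)%N -> a i = 0) -> a N != 0 ->
  exists e, 0 < e /\ forall r, 0 < `|r - r0| < e -> g r != 0.
Proof.
elim: N g a => [|N ih] g a rho0 ga a0 aN.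
  have c : {for r0, continuous g}.
    apply: (@der_cont R _ r0); apply: analytic_der; by exists a, rho.
  have gr0 : g r0 != 0 by rewrite (power_series_at_center rho0 ga).
  have : \forall r \near r0, g r != 0 by exact: cvgr_neq0 c gr0.
  move=> /nbhs_ballP[e /= e0 he]; exists e; split => // r /andP[_ re].
  by apply: he; rewrite /ball /= distrC.
pose k r := if r == r0 then a 1%N else g r / (r - r0).
have ka : power_series_at k r0 (fun n => a n.+1) rho.
  move=> r hr; rewrite /k; case: eqVneq => [->|rr0].
    rewrite subrr; apply: cvg_near_cst; exists 1%N => // n /= n1.
    rewrite /series /= -(prednK n1) big_nat_recl //= expr0 mulr1 big1_seq ?addr0 //.
    by move=> i _; rewrite expr0n mulr0.
  have x0 : r - r0 != 0 by rewrite subr_eq0.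
  have := ga r hr; rewrite -(cvg_shiftS _) => h.
  rewrite (_ : series _ = fun n => series (fun n => a n * (r - r0) ^+ n) n.+1 / (r - r0)).
    by apply: cvgM; [exact: h|exact: cvg_cst].
  apply/funext => n; rewrite /series /= big_nat_recl // a0 // mul0r add0r mulr_suml.
  by apply: eq_bigr => i _; rewrite exprSr mulrA mulfK.
have [|e [e0 he]] := ih k (fun n => a n.+1) rho0 ka _ aN; first by move=> i iN; rewrite a0.
exists e; split => // r /andP[r0' re].
have := he r; rewrite r0' re => /(_ isT); rewrite /k.
have rr0 : r != r0 by rewrite -subr_eq0 -normr_gt0.
by rewrite (negbTE rr0) mulf_eq0 negb_or => /andP[].
Qed.

Lemma isolated_zero g (r0 : R) : analytic_at g r0 ->
  (exists e, 0 < e /\ forall r, `|r - r0| < e -> g r = 0) \/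
  (exists e, 0 < e /\ forall r, 0 < `|r - r0| < e -> g r != 0).
Proof.
move=> [a [rho [rho0 ga]]].
have [h|/existsNP/cid[n0 n0P]] := pselect (forall n, a n = 0).
  left; exists rho; split => // r /ga.
  rewrite (_ : series _ = fun=> 0); last first.
    by apply/funext => n; rewrite /series /= big1 // => i _; rewrite h mul0r.
  by move=> c; apply: (cvg_unique _ c (cvg_cst 0)); exact: Rhausdorff.
right; have ex : exists n, a n != 0 by exists n0; exact/eqP.
apply: (isolated_zero_order (N := ex_minn ex) rho0 ga); case: ex_minnP => N aN minN //.
move=> i iN; apply/eqP; apply: contraTT iN => /minN.
by rewrite -leqNgt.
Qed.

End PowerSeries.

Section AnalyticContinuation.
Variable R : realType.

(** Outside [0, 1] the extension is the sum of the power series at the nearest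
endpoint; it makes one-sided analyticity two-sided. *)
Lemma analytic_extension (c : R -> R) : analytic_on01 c ->
  exists C : R -> R, (forall r, 0 <= r <= 1 -> C r = c r) /\
    forall r0, 0 <= r0 <= 1 -> analytic_at C r0.
Proof.
move=> ac.
have [|a [rho [rho0 ha]]] := ac 0; first by rewrite lexx ler01.
have [|b [eps [eps0 hb]]] := ac 1; first by rewrite lexx ler01.
pose C r := if r < 0 then limn (pseries a r) else
  if 1 < r then limn (pseries b (r - 1)) else c r.
have C01 r : 0 <= r <= 1 -> C r = c r.
  by move=> /andP[r0 r1]; rewrite /C !ltNge r0 r1.
exists C; split => // r0 /andP[r00 r01].
have [->|r0n0] := eqVneq r0 0.
  exists a, (Num.min rho 1); split; first by rewrite lt_min rho0 ltr01.
  move=> r; rewrite subr0 lt_min => /andP[rr r1].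
  have [rneg|rpos] := ltP r 0; last first.
    have hr : 0 <= r <= 1 by rewrite rpos ltW // (le_lt_trans (ler_norm r)).
    by have := ha r hr; rewrite subr0 C01 //; apply.
  rewrite /C rneg; suff : cvgn (pseries a r) by [].
  pose L := (`|r| + Num.min rho 1) / 2.
  have mr : `|r| < Num.min rho 1 by rewrite lt_min rr.
  have Lr : `|r| < L by rewrite /L; lra.
  have Lm : L < Num.min rho 1 by rewrite /L; lra.
  have L0 : 0 <= L by apply: ltW; apply: le_lt_trans Lr.
  apply: (@is_cvg_pseries_inside _ a L); last by rewrite (ger0_norm L0).
  apply/cvg_ex; exists (c L).
  move: Lm; rewrite lt_min => /andP[Lrho L1].
  have := ha L; rewrite subr0 L0 (ltW L1) (ger0_norm L0); exact.
have [->|r0n1] := eqVneq r0 1.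
  exists b, (Num.min eps 1); split; first by rewrite lt_min eps0 ltr01.
  move=> r; rewrite lt_min => /andP[rr r1].
  have [rbig|rle] := ltP 1 r; last first.
    have hr : 0 <= r <= 1.
      by rewrite rle andbT; move: r1; rewrite ltr_distlC => /andP[_]; lra.
    by have := hb r hr; rewrite C01 //; apply.
  rewrite /C rbig ltNge (ltW (lt_trans ltr01 rbig)) /=.
  suff : cvgn (pseries b (r - 1)) by [].
  pose L := (`|r - 1| + Num.min eps 1) / 2.
  have mr : `|r - 1| < Num.min eps 1 by rewrite lt_min rr.
  have Lr : `|r - 1| < L by rewrite /L; lra.
  have Lm : L < Num.min eps 1 by rewrite /L; lra.
  have L0 : 0 <= L by apply: ltW; apply: le_lt_trans Lr.
  apply: (@is_cvg_pseries_inside _ b (- L)); last by rewrite normrN (ger0_norm L0).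
  apply/cvg_ex; exists (c (1 - L)).
  move: Lm; rewrite lt_min => /andP[Lrho L1].
  have := hb (1 - L); rewrite (_ : 1 - L - 1 = - L); last by ring.
  rewrite normrN (ger0_norm L0) => /(_ _ Lrho); apply; lra.
have r0p : 0 < r0 by rewrite lt_neqAle eq_sym r0n0.
have r0l : r0 < 1 by rewrite lt_neqAle r0n1.
have [|e [del [del0 he]]] := ac r0; first by rewrite r00.
exists e, (Num.min del (Num.min r0 (1 - r0))); split.
  by rewrite !lt_min del0 r0p subr_gt0.
move=> r; rewrite !lt_min => /and3P[h1 h2 h3].
have hr : 0 <= r <= 1.
  move: h2 h3; rewrite !ltr_distl => /andP[? ?] /andP[? ?]; apply/andP; split; lra.
by rewrite C01 //; exact: he.
Qed.

(** If g vanishes near 1, let t be the infimum of the points from which g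
vanishes up to 1.  The zeros accumulate at t, so g vanishes near t, which forces
t = 0 and g = 0 on [0, 1]. *)
Lemma analytic_identity (g : R -> R) : (forall r, 0 <= r <= 1 -> analytic_at g r) ->
  (exists2 r, 0 <= r <= 1 & g r != 0) ->
  exists e, 0 < e /\ forall r, 1 - e < r < 1 -> g r != 0.
Proof.
move=> ag [s /andP[s0 s1] gs].
have [|[e [e0 he]]|[e [e0 he]]] := isolated_zero (ag 1 _); first by rewrite ler01 lexx.
  exfalso.
  pose A := [set t : R | 0 <= t <= 1 /\ forall r, t <= r <= 1 -> g r = 0].
  have A1 : A 1.
    split; first by rewrite ler01 lexx.
    move=> r; rewrite -eq_le => /eqP <-; apply: he; by rewrite subrr normr0.
  have lbA : has_lbound A by exists 0 => t [/andP[]].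
  have infA : has_inf A by split => //; exists 1.
  pose t := inf A.
  have t1 : t <= 1 by apply: ge_inf.
  have t0 : 0 <= t by apply: lb_le_inf; [exists 1|move=> u [/andP[]]].
  have zero r : t < r -> r <= 1 -> g r = 0.
    move=> tr r1; have [u Au ur] := inf_lt (ex_intro _ 1 A1) tr.
    by have [_ h] := Au; apply: h; rewrite r1 (ltW ur).
  have [|[d [d0 hd]]|[d [d0 hd]]] := isolated_zero (ag t _); first by rewrite t0.
    pose u := Num.max 0 (t - d / 2).
    have Au : A u.
      have u1 : u <= 1 by rewrite ge_max ler01 /=; lra.
      split; first by rewrite le_max lexx.
      move=> r /andP[ur r1]; have [rt|] := ltP t r; first exact: zero.
      move: ur; rewrite ge_max => /andP[_ hr] rt.
      by apply: hd; rewrite ltr_distl; apply/andP; split; lra.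
    have [_ hu] := Au; have tu : t <= u by exact: ge_inf.
    have t00 : t = 0.
      apply/eqP; rewrite eq_le t0 andbT leNgt; apply/negP => tp.
      move: tu; rewrite le_max => /orP[|]; lra.
    have u0 : u = 0.
      by apply/eqP; rewrite eq_le le_max lexx /= andbT ge_max lexx /= t00; lra.
    by move: gs; rewrite hu ?eqxx // u0 s0.
  have [tl|] := ltP t 1.
    pose r := t + Num.min d (1 - t) / 2.
    have m0 : 0 < Num.min d (1 - t) by rewrite lt_min d0 subr_gt0.
    have md : Num.min d (1 - t) <= d by rewrite ge_min lexx.
    have m1 : Num.min d (1 - t) <= 1 - t by rewrite ge_min lexx orbT.
    have gr : g r = 0 by apply: zero; rewrite /r; lra.
    have := hd r; rewrite gr eqxx => /(_ _)/negP; apply => //.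
    rewrite /r addrAC subrr add0r ger0_norm; last by rewrite divr_ge0 // ltW.
    by apply/andP; split; lra.
  move=> tge; have tE : t = 1 by apply/eqP; rewrite eq_le t1.
  have m0 : 0 < Num.min d e by rewrite lt_min d0.
  have md : Num.min d e <= d by rewrite ge_min lexx.
  have me : Num.min d e <= e by rewrite ge_min lexx orbT.
  pose r := 1 - Num.min d e / 2.
  have rE : `|r - 1| = Num.min d e / 2.
    by rewrite /r addrAC subrr add0r normrN ger0_norm // divr_ge0 // ltW.
  have gr : g r = 0 by apply: he; rewrite rE; lra.
  have := hd r; rewrite tE gr eqxx rE => /(_ _)/negP; apply => //.
  by apply/andP; split; lra.
exists e; split => // r /andP[r1 r2]; apply: he.
by rewrite ltr_distl normr_gt0 subr_eq0 lt_eqF //=; apply/andP; split; lra.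
Qed.

Lemma analytic_sign (g : R -> R) : (forall r, 0 <= r <= 1 -> analytic_at g r) ->
  (exists2 r, 0 <= r <= 1 & g r != 0) ->
  exists e, 0 < e /\ e <= 1 /\ ((forall r, 1 - e < r < 1 -> 0 < g r) \/
                      (forall r, 1 - e < r < 1 -> g r < 0)).
Proof.
move=> ag hg; have [e [e0 he]] := analytic_identity ag hg.
have m0 : 0 < Num.min e 1 by rewrite lt_min e0 ltr01.
have me : Num.min e 1 <= e by rewrite ge_min lexx.
have m1 : Num.min e 1 <= 1 by rewrite ge_min lexx orbT.
exists (Num.min e 1); split => //; split => //.
set d := Num.min e 1 in m0 me m1 *.
have key p q : 1 - d < p -> p <= q -> q < 1 ->
    Num.min (g p) (g q) <= 0 <= Num.max (g p) (g q) -> False.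
  move=> p0 pq q1 h; have [|c] := @IVT R g p q 0 pq _ h.
    apply: continuous_in_subspaceT => y; rewrite inE /= in_itv /= => /andP[py yq].
    by apply: der_cont (analytic_der (ag y _)); apply/andP; split; lra.
  rewrite in_itv /= => /andP[pc cq] /eqP.
  by apply/negP; apply: he; apply/andP; split; lra.
pose z := 1 - d / 2.
have z1 : 1 - d < z < 1 by rewrite /z; apply/andP; split; lra.
have zn : g z != 0 by apply: he; move: z1 => /andP[? ?]; apply/andP; split; lra.
move: z1 => /andP[z1 z2].
have [gz|gz] : 0 < g z \/ g z < 0 by move: zn; rewrite neq_lt => /orP[] ?; [right|left].
- left => r /andP[r1 r2].
  rewrite lt_neqAle eq_sym he /= ?leNgt; last by apply/andP; split; lra.
  apply/negP => gr; have [h|/ltW h] := leP r z.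
    by apply: (key r z) => //; rewrite ge_min le_max (ltW gr) (ltW gz) orbT.
  by apply: (key z r) => //; rewrite ge_min le_max (ltW gr) (ltW gz) orbT.
- right => r /andP[r1 r2].
  rewrite lt_neqAle he /= ?leNgt; last by apply/andP; split; lra.
  apply/negP => gr; have [h|/ltW h] := leP r z.
    by apply: (key r z) => //; rewrite ge_min le_max (ltW gr) (ltW gz) orbT.
  by apply: (key z r) => //; rewrite ge_min le_max (ltW gr) (ltW gz) orbT.
Qed.

End AnalyticContinuation.

(** * The profile of an analytic warping function *)
Section WarpingProfile.
Variable R : realType.

Definition clamp (r : R) : R := Num.max 0 (Num.min 1 r).

Lemma clamp01 r : 0 <= clamp r <= 1.
Proof. by apply/andP; split; rewrite /clamp ?le_max ?lexx // ge_max ler01 ge_min lexx. Qed.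

Lemma clampE r : 0 <= r <= 1 -> clamp r = r.
Proof. by move=> /andP[r0 r1]; rewrite /clamp min_r ?max_r. Qed.

Lemma clamp_continuous : continuous clamp.
Proof.
move=> r; rewrite (_ : clamp = (fun=> 0 : R^o) \max ((fun=> 1 : R^o) \min id)) //.
apply: continuous_max; first exact: cvg_cst.
by apply: continuous_min; [exact: cvg_cst|exact: cvg_id].
Qed.

Lemma clamp_comp_continuous (h : R -> R) :
  (forall r, 0 <= r <= 1 -> {for r, continuous h}) -> continuous (fun r => h (clamp r)).
Proof.
move=> ch r; apply: (@continuous_comp _ _ _ clamp h); first exact: clamp_continuous.
exact: ch (clamp01 r).
Qed.

(** In terms of the extension C of c and L = C' / C one has
F1 = - n (r L + 1/2) F with r = exp (- x), whose derivative exhibits the potential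
as r times a continuous function of r in [0, 1]; clamping r extends that function
to the line. *)
Lemma warping_profile (c : R -> R) (n : nat) : (0 < n)%N -> warping c -> analytic_on01 c ->
  exists (F F1 H : R -> R) (m M B : R),
  [/\ profile (n%:R / 2) F F1 H m M B,
      forall x, 0 <= x -> F x = warp_f c x ^+ n
    & forall x, 0 < x ->
      derive1 (derive1 (fun y => warp_f c y ^+ n)) x / warp_f c x ^+ n - n%:R ^+ 2 / 4 =
      expR (- x) * H (expR (- x))].
Proof.
move=> n0 [cpos c01] ac.
have [C [Cc aC]] := analytic_extension ac.
pose C1 := derive1 C; pose C2 := derive1 C1.
have dC r : 0 <= r <= 1 -> is_derive (r : R) 1 C (C1 r) by move=> /aC/analytic_der.
have dC1 r : 0 <= r <= 1 -> is_derive (r : R) 1 C1 (C2 r).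
  by move=> /aC/analytic_derive1/analytic_der.
have cC2 r : 0 <= r <= 1 -> {for r, continuous C2}.
  by move=> /aC/analytic_derive1/analytic_derive1/analytic_der/der_cont.
have Cpos r : 0 <= r <= 1 -> 0 < C r by move=> hr; rewrite Cc // cpos.
have Cne r : 0 <= r <= 1 -> C r != 0 by move=> hr; rewrite gt_eqF // Cpos.
pose L r := C1 r / C r; pose L1 r := C2 r / C r - L r ^+ 2.
have dL r : 0 <= r <= 1 -> is_derive (r : R) 1 L (L1 r).
  move=> hr; have h := Cne r hr.
  apply: der_eq (derM (dC1 r hr) (derV h (dC r hr))) _.
  by rewrite /L1 /L; field.
have cC r : 0 <= r <= 1 -> {for r, continuous C} by move=> hr; exact: der_cont (dC r hr).
have cL r : 0 <= r <= 1 -> {for r, continuous L} by move=> hr; exact: der_cont (dL r hr).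
have cL1 r : 0 <= r <= 1 -> {for r, continuous L1}.
  move=> hr; have h1 := cC2 r hr; have h2 := cC r hr; have h3 := cL r hr.
  apply: cvgB; last by apply: cvgM; exact: h3.
  by apply: cvgM; [exact: h1|apply: cvgV; [exact: Cne|exact: h2]].
pose h r := n%:R * L r + n%:R * (r * L1 r) + n%:R ^+ 2 * (r * L r ^+ 2) + n%:R ^+ 2 * L r.
have ch r : 0 <= r <= 1 -> {for r, continuous h}.
  move=> hr; have h2 := cL r hr; have h3 := cL1 r hr.
  have i : x @[x --> r] --> r by exact: cvg_id.
  have k0 : (n%:R : R) @[x --> r] --> (n%:R : R) by exact: cvg_cst.
  have k2 : (n%:R ^+ 2 : R) @[x --> r] --> (n%:R ^+ 2 : R) by exact: cvg_cst.
  apply: cvgD; last by apply: cvgM; [exact: k2|exact: h2].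
  apply: cvgD; last by apply: cvgM; [exact: k2|apply: cvgM; [exact: i|apply: cvgM; exact: h2]].
  apply: cvgD; first by apply: cvgM; [exact: k0|exact: h2].
  by apply: cvgM; [exact: k0|apply: cvgM; [exact: i|exact: h3]].
pose H r := h (clamp r).
have cH : continuous H by exact: clamp_comp_continuous.
have [K K0 HK] := continuous_bounded01 cH.
have HK' s : `|H s| <= K.
  have -> : H s = H (clamp s) by rewrite /H (clampE (clamp01 s)).
  exact: HK (clamp01 s).
have exp01 (x : R) : 0 <= x -> 0 <= expR (- x) <= 1.
  by move=> x0; rewrite expR_ge0 -expR0 ler_expR oppr_le0.
pose f x := C (expR (- x)) * expR (- x / 2).
pose p x := - (expR (- x) * L (expR (- x)) + 2^-1).
have df (x : R) : 0 <= x -> is_derive x 1 f (p x * f x).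
  move=> x0; have hr := exp01 x x0.
  have e1 : is_derive x 1 (fun y => expR (- y / 2)) (- 2^-1 * expR (- x / 2)).
    have e0 : is_derive x 1 (fun y => - y / 2) (- 2^-1).
      apply: der_eq (derM (derN (is_derive_id x (1 : R))) (derC (2^-1 : R) x)) _.
      by rewrite mulr0 addr0 mulN1r.
    by apply: der_eq (der_comp (is_derive_expR _) e0) _; rewrite mulrC.
  apply: der_eq (derM (@der_comp R C (fun y => expR (- y)) x _ _ (dC _ hr) (der_expN x)) e1) _.
  rewrite /p /f /L; field; exact: Cne.
pose F x := f x ^+ n; pose F1 x := n%:R * p x * F x.
have dF (x : R) : 0 <= x -> is_derive x 1 F (F1 x).
  move=> x0; rewrite /F1 /F -(prednK n0).
  by apply: der_eq (derX _ (df x x0)) _; rewrite exprS; ring.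
have HE (x : R) : 0 <= x -> H (expR (- x)) = h (expR (- x)).
  by move=> x0; rewrite /H clampE // exp01.
have dF1 (x : R) : 0 <= x ->
    is_derive x 1 F1 (((n%:R / 2) ^+ 2 + expR (- x) * H (expR (- x))) * F x).
  move=> x0; have hr := exp01 x x0; rewrite HE //.
  have dLx := @der_comp R L (fun y => expR (- y)) x _ _ (dL _ hr) (der_expN x).
  have dp := derN (derD (derM (der_expN x) dLx) (derC (2^-1 : R) x)).
  apply: der_eq (derM (derZ n%:R dp) (dF x x0)) _.
  by rewrite /F1 /h /p; field.
have [m1 m10 hm1] : exists2 m1, 0 < m1 & forall r, 0 <= r <= 1 -> m1 <= C r.
  have [|r0 + hr0] := @EVT_min R C 0 1 ler01 _.
    by apply: continuous_in_subspaceT => y; rewrite inE /= in_itv /=; exact: cC.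
  rewrite in_itv /= => hr; exists (C r0); first exact: Cpos.
  by move=> r hr'; apply: hr0; rewrite in_itv.
have [M1 hM1] : exists M1, forall r, 0 <= r <= 1 -> C r <= M1.
  have [|r0 + hr0] := @EVT_max R C 0 1 ler01 _.
    by apply: continuous_in_subspaceT => y; rewrite inE /= in_itv /=; exact: cC.
  rewrite in_itv /= => hr; exists (C r0).
  by move=> r hr'; apply: hr0; rewrite in_itv.
have [B1 B10 hB1] := continuous_bounded01 (clamp_comp_continuous cL).
have fpos x : 0 <= x -> 0 < f x.
  by move=> x0; rewrite mulr_gt0 ?expR_gt0 // Cpos // exp01.
have Fc x : 0 <= x -> F x = warp_f c x ^+ n.
  by move=> x0; rewrite /F /f /warp_f Cc // exp01.
exists F, F1, H, (m1 ^+ n), (M1 ^+ n), (n%:R * (B1 + 2^-1)); split => //.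
- split => //.
  + by rewrite divr_gt0 // ltr0n.
  + by rewrite exprn_gt0.
  + move=> x x0; have hr := exp01 x x0.
    have -> : expR (- (n%:R / 2) * x) = expR (- x / 2) ^+ n.
      by rewrite -expRM_natl; congr expR; field.
    rewrite -!exprMn /F; apply/andP; split; apply: lerXn2r; rewrite ?nnegrE //.
    * by rewrite mulr_ge0 ?expR_ge0 // ltW.
    * exact: ltW (fpos x x0).
    * by rewrite ler_wpM2r ?expR_ge0 // hm1.
    * exact: ltW (fpos x x0).
    * by rewrite mulr_ge0 ?expR_ge0 // (le_trans _ (hM1 _ hr)) // ltW // Cpos.
    * by rewrite ler_wpM2r ?expR_ge0 // hM1.
  + move=> x x0; have hr := exp01 x x0; move: (hr) => /andP[r0 r1].
    have F0 : 0 < F x by rewrite exprn_gt0 // fpos.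
    rewrite /F1 normrM (gtr0_norm F0) ler_wpM2r ?(ltW F0) // normrM ger0_norm //.
    rewrite ler_wpM2l // /p normrN (le_trans (ler_normD _ _)) //.
    apply: lerD; last by rewrite ger0_norm.
    rewrite normrM ger0_norm // (le_trans _ (hB1 _ hr)) // clampE //.
    by rewrite ler_piMl.
  + by exists K.
- move=> x x0; have F0 : F x != 0 by rewrite gt_eqF // exprn_gt0 // fpos // ltW.
  have nearF : \forall y \near x, F y = warp_f c y ^+ n.
    by near=> y; apply: Fc; apply: ltW; near: y; exact: lt_nbhsr.
  have d1 y : 0 < y -> derive1 (fun y => warp_f c y ^+ n) y = F1 y.
    move=> y0; apply: der_derive1; apply: der_near (dF y (ltW y0)).
    by near=> z; apply: Fc; apply: ltW; near: z; exact: lt_nbhsr.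
  have d2 : derive1 (derive1 (fun y => warp_f c y ^+ n)) x =
      ((n%:R / 2) ^+ 2 + expR (- x) * H (expR (- x))) * F x.
    apply: der_derive1; apply: der_near (dF1 x (ltW x0)).
    by near=> z; rewrite d1 //; near: z; exact: lt_nbhsr.
  by rewrite d2 -Fc ?ltW //; field.
Unshelve. all: by end_near. Qed.

End WarpingProfile.

(** * Square integrable functions and dimension counting *)
Section SquareIntegrable.
Context d (T : measurableType d) (R : realType) (mu : {measure set T -> \bar R}).
Implicit Types f g h : T -> R.

Notation L2 := (Lfun mu 2%:E).
Notation N2 f := ('N[mu]_2%:E[EFin \o f%R])%E.

Definition inner f g : R := \int[mu]_w (f w * g w).

Let one_le_two : (1 <= 2%:E :> \bar R)%E. Proof. by rewrite lee_fin ler1n. Qed.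

Lemma L2Z k f : f \in L2 -> (fun w => k * f w) \in L2.
Proof.
move=> f2; have := Lfun_scale k (ler1n R 2) f2.
rewrite (_ : k \o* f = fun w => k * f w) //; apply/funext => w /=; exact: mulrC.
Qed.

Lemma L2D f g : f \in L2 -> g \in L2 -> (fun w => f w + g w) \in L2.
Proof. by move=> f2 g2; have [_ h] := Lfun_addr_closed mu one_le_two; exact: (h f g f2 g2). Qed.

Lemma L2_0 : (fun=> 0) \in L2.
Proof. by have [h _] := Lfun_addr_closed mu one_le_two; exact: h. Qed.

Lemma L2B f g : f \in L2 -> g \in L2 -> (fun w => f w - g w) \in L2.
Proof.
move=> f2 g2; have := L2D f2 (L2Z (-1) g2).
rewrite (_ : (fun w => f w + -1 * g w) = fun w => f w - g w) //.
by apply/funext => w; rewrite mulN1r.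
Qed.

Lemma L2_sum_mem (I : Type) (r : seq I) (P : pred I) (F : I -> T -> R) :
  (forall i, P i -> F i \in L2) -> (fun w => \sum_(i <- r | P i) F i w) \in L2.
Proof.
move=> F2; elim: r => [|i r ih].
  rewrite (_ : (fun w => _) = fun=> 0); first exact: L2_0.
  by apply/funext => w; rewrite big_nil.
have [Pi|Pi] := boolP (P i).
  rewrite (_ : (fun w => _) = (fun w => F i w + \sum_(i <- r | P i) F i w)).
    by apply: L2D => //; exact: F2.
  by apply/funext => w; rewrite big_cons Pi.
rewrite (_ : (fun w => _) = (fun w => \sum_(i <- r | P i) F i w)) //.
by apply/funext => w; rewrite big_cons (negbTE Pi).
Qed.

Lemma L2_measurable f : f \in L2 -> measurable_fun setT f.
Proof. by rewrite inE => /andP[]; rewrite inE. Qed.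

Lemma L2_finite f : f \in L2 -> (N2 f < +oo)%E.
Proof. by rewrite inE => /andP[_]; rewrite inE. Qed.

Lemma L2_integrable f g : f \in L2 -> g \in L2 ->
  mu.-integrable setT (EFin \o (fun w => f w * g w)).
Proof. by move=> f2 g2; apply/Lfun1_integrable; exact: (Lfun2_mul_Lfun1 f2 g2). Qed.

Lemma innerZ k f g : f \in L2 -> g \in L2 -> inner (fun w => k * f w) g = k * inner f g.
Proof.
move=> f2 g2; rewrite /inner -RintegralZl //; last exact: L2_integrable.
by apply: eq_Rintegral => w _; rewrite mulrA.
Qed.

Lemma innerD f g h : f \in L2 -> g \in L2 -> h \in L2 ->
  inner (fun w => f w + g w) h = inner f h + inner g h.
Proof.
move=> f2 g2 h2; rewrite /inner -RintegralD //; [|exact: L2_integrable..].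
by apply: eq_Rintegral => w _; rewrite mulrDl.
Qed.

Lemma innerB f g h : f \in L2 -> g \in L2 -> h \in L2 ->
  inner (fun w => f w - g w) h = inner f h - inner g h.
Proof.
move=> f2 g2 h2; rewrite /inner -RintegralB //; [|exact: L2_integrable..].
by apply: eq_Rintegral => w _; rewrite mulrBl.
Qed.

Lemma inner0 h : inner (fun=> 0) h = 0.
Proof.
rewrite /inner (_ : (fun w => 0 * h w) = cst 0); last by apply/funext => w; rewrite mul0r.
by rewrite Rintegral_cst // mul0r.
Qed.

Lemma inner_sum (I : Type) (r : seq I) (P : pred I) (F : I -> T -> R) h :
  (forall i, P i -> F i \in L2) -> h \in L2 ->
  inner (fun w => \sum_(i <- r | P i) F i w) h = \sum_(i <- r | P i) inner (F i) h.
Proof.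
move=> F2 h2; elim: r => [|i r ih].
  rewrite big_nil -[RHS](inner0 h); congr inner.
  by apply/funext => w; rewrite big_nil.
rewrite big_cons -ih; have [Pi|Pi] := boolP (P i).
  rewrite -innerD //; [|exact: F2|exact: L2_sum_mem].
  by congr inner; apply/funext => w; rewrite big_cons Pi.
by congr inner; apply/funext => w; rewrite big_cons (negbTE Pi).
Qed.

Lemma inner_ae f g h : f \in L2 -> g \in L2 -> h \in L2 -> f = g %[ae mu] ->
  inner f h = inner g h.
Proof.
move=> f2 g2 h2 fg; rewrite /inner /Rintegral; congr fine.
apply: ae_eq_integral => //.
- by have /integrableP[] := L2_integrable f2 h2.
- by have /integrableP[] := L2_integrable g2 h2.
- by apply: filterS fg => w /= -> .
Qed.

Lemma norm2Z k f : f \in L2 -> (N2 (fun w => k * f w) = `|k|%:E * N2 f)%E.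
Proof. by move=> f2; have := LnormZ (Lfun_Sub one_le_two f2) k. Qed.

Lemma norm2_0 : (N2 (fun=> 0) = 0)%E.
Proof. by rewrite -[RHS](@Lnorm0 _ _ _ mu 2%:E). Qed.

Lemma cauchy_schwarz f g : f \in L2 -> g \in L2 ->
  (`|inner f g|%:E <= N2 f * N2 g)%E.
Proof.
move=> f2 g2; rewrite /inner EFin_normr_Rintegral //; last exact: L2_integrable.
have mf := L2_measurable f2; have mg := L2_measurable g2.
apply: (@le_trans _ _ ('N[mu]_1[EFin \o (f \* g)%R])%E).
  rewrite Lnorm1; apply: le_abse_integral => //.
  by have /integrableP[] := L2_integrable f2 g2.
by apply: hoelder => //; rewrite [RHS]splitr !div1r.
Qed.

(** Pairing with a fixed h is continuous in norm, by the Cauchy-Schwarz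
inequality. *)
Lemma inner_cvg (I : Type) (F : set_system I) {FF : ProperFilter F}
    (f : I -> T -> R) g h : (\forall i \near F, f i \in L2) -> g \in L2 -> h \in L2 ->
  (N2 (f i \- g) @[i --> F] --> 0)%E -> inner (f i) h @[i --> F] --> inner g h.
Proof.
move=> fL gL hL /fine_cvgP[finf cf].
have hfin : (N2 h \is a fin_num)%E by rewrite ge0_fin_numE ?Lnorm_ge0 // L2_finite.
pose K := fine (N2 h).
have K0 : 0 <= K by rewrite fine_ge0 // Lnorm_ge0.
apply/cvgrPdist_lt => e e0.
have e1 : 0 < e / (K + 1) by rewrite divr_gt0 // ltr_wpDl.
move/cvgrPdist_lt : cf => /(_ _ e1) cf.
near=> i.
have fi : f i \in L2 by near: i.
have fin : (N2 (f i \- g) \is a fin_num)%E by near: i.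
have : `|0 - fine (N2 (f i \- g))%E| < e / (K + 1) by near: i.
rewrite sub0r normrN ger0_norm ?fine_ge0 ?Lnorm_ge0 // => small.
rewrite distrC -innerB //; apply: (@le_lt_trans _ _ (fine (N2 (f i \- g))%E * K)).
  have := cauchy_schwarz (L2B fi gL) hL.
  by rewrite -[X in (_ <= X * _)%E](fineK fin) -[X in (_ <= _ * X)%E](fineK hfin) -EFinM lee_fin.
apply: (@le_lt_trans _ _ (e / (K + 1) * K)); first by rewrite ler_wpM2r // ltW.
rewrite mulrAC ltr_pdivrMr ?ltr_wpDl //; by rewrite ltr_pM2l // ltrDl.
Unshelve. all: by end_near. Qed.

Lemma norm2_eq0 f g : f \in L2 -> g \in L2 -> (N2 (f \- g) = 0)%E -> f = g %[ae mu].
Proof.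
move=> f2 g2 n0.
have m : measurable_fun setT (EFin \o (f \- g)).
  by apply/measurable_EFinP; exact: (L2_measurable (L2B f2 g2)).
have := Lnorm_eq0_eq0 m (_ : (0 < 2%:E)%E) n0; rewrite lte_fin => /(_ (ltr0n _ _)) h.
by apply: filterS h => w /= /(_ I) [] /eqP; rewrite subr_eq0 => /eqP.
Qed.

Variable Y : nat -> T -> R.
Hypothesis Y2 : forall k, Y k \in L2.
Hypothesis Yorth : forall j k, inner (Y j) (Y k) = (j == k)%:R.

Lemma inner_combination (s : seq nat) (a : nat -> R) k : uniq s ->
  inner (fun w => \sum_(i <- s) a i * Y i w) (Y k) = if k \in s then a k else 0.
Proof.
move=> us; rewrite inner_sum //; last by move=> i _; exact: L2Z.
under eq_bigr do rewrite innerZ // Yorth.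
case: ifPn => ks.
  rewrite (bigD1_seq k) //= eqxx mulr1 big1 ?addr0 // => i /negbTE ->.
  by rewrite mulr0.
rewrite big1_seq // => i /= si; case: eqP => [ik|]; last by rewrite mulr0.
by rewrite -ik si in ks.
Qed.

Definition level_list (g : nat -> R) (s : R) (l : seq nat) :=
  uniq l /\ forall k, (k \in l) = (g k == s).

(** A space E that is spanned by the Y k with lam k = s, in the weak sense that
its elements are the sums of their expansions and have no other coefficients,
has as many of them as its dimension n.  A family b spanning E bounds the number
of these Y k; finitely many of them then span E, which bounds n. *)
Section Dimension.
Variables (lam : nat -> R) (s : R) (E : set (T -> R)) (n : nat) (b : 'I_n -> T -> R).
Hypothesis EL2 : forall psi, E psi -> psi \in L2.
Hypothesis EY : forall k, lam k = s -> E (Y k).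
Hypothesis Esum : forall psi, E psi ->
  (N2 (psi \- (fun w => \sum_(k < m) inner psi (Y k) * Y k w)%R) @[m --> \oo] --> 0)%E.
Hypothesis Ecoef : forall psi k, E psi -> lam k != s -> inner psi (Y k) = 0.
Hypothesis Eb : forall i, E (b i).
Hypothesis bfree : forall a : 'I_n -> R,
  (fun w => \sum_(i < n) a i * b i w) = cst 0 %[ae mu] -> forall i, a i = 0.
Hypothesis bspan : forall psi, E psi -> exists a : 'I_n -> R,
  psi = (fun w => \sum_(i < n) a i * b i w) %[ae mu].

Lemma wide_kernel p q (A : 'M[R]_(p, q)) : (q < p)%N ->
  exists2 x : 'rV[R]_p, x != 0 & x *m A = 0.
Proof.
move=> qp; have : kermx A != 0.
  rewrite kermx_eq0 /row_free; apply: contraTneq qp => e.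
  by rewrite -leqNgt -e rank_leq_col.
by move=> /rowV0Pn[x xA x0]; exists x => //; exact/sub_kermxP.
Qed.

Lemma level_size (ks : seq nat) : uniq ks -> all (fun k => lam k == s) ks ->
  (size ks <= n)%N.
Proof.
move=> uk ak; rewrite leqNgt; apply/negP => lt.
pose k (i : 'I_(size ks)) := nth 0%N ks i.
have kE i : E (Y (k i)).
  by apply: EY; apply/eqP; move/allP : ak; apply; exact: mem_nth.
have /choice[A hA] i := bspan (kE i).
have [x x0 xA] := @wide_kernel _ _ (\matrix_(i < size ks, j < n) A i j) lt.
pose g w := \sum_(i < size ks) x 0 i * Y (k i) w.
have gL : g \in L2 by apply: L2_sum_mem => i _; exact: L2Z.
have g0 : g = (fun=> 0) %[ae mu].
  have : \forall w \ae mu, forall i, Y (k i) w = \sum_(j < n) A i j * b j w.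
    by apply: filter_forall => i; apply: filterS (hA i) => w /(_ I).
  apply: filterS => w hw _; rewrite /g.
  under eq_bigr do rewrite hw mulr_sumr.
  rewrite exchange_big /= big1 // => j _.
  under eq_bigr do rewrite mulrA.
  rewrite -mulr_suml (_ : \sum_i _ = (x *m \matrix_(i < size ks, j < n) A i j) 0 j).
    by rewrite xA mxE mul0r.
  by rewrite mxE; apply: eq_bigr => i _; rewrite mxE.
move/eqP: x0; apply; apply/rowP => i; rewrite mxE.
have := inner_ae gL L2_0 (Y2 (k i)) g0; rewrite inner0 /g inner_sum //; last first.
  by move=> j _; exact: L2Z.
rewrite (bigD1 i) //= innerZ // Yorth eqxx mulr1 big1 ?addr0 // => j ji.
by rewrite innerZ // Yorth /k nth_uniq // (negbTE (_ : (j != i :> nat))) ?mulr0.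
Qed.

Lemma level_spans (ks : seq nat) psi : level_list lam s ks -> E psi ->
  psi = (fun w => \sum_(k <- ks) inner psi (Y k) * Y k w) %[ae mu].
Proof.
move=> [uk kP] Epsi; have pL := EL2 Epsi.
apply: norm2_eq0 => //; first by apply: L2_sum_mem => i _; exact: L2Z.
have c := Esum Epsi.
pose N := (\max_(k <- ks) k).+1.
apply: (@cvg_unique _ (@ereal_hausdorff R) _ _ _ _ _ c).
apply: cvg_near_cst; exists N => // m /= Nm.
apply: eq_Lnorm => w /=; congr (_ - _)%:E.
rewrite -(big_mkord xpredT (fun k => inner psi (Y k) * Y k w)).
rewrite (bigID (mem ks)) /= [X in _ + X]big1 ?addr0; last first.
  by move=> i; rewrite kP => /(Ecoef Epsi) ->; rewrite mul0r.
rewrite -big_filter; apply: perm_big; apply: uniq_perm => //.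
  by rewrite filter_uniq // iota_uniq.
move=> k; rewrite mem_filter mem_index_iota /=; have [kks|//] := boolP (k \in ks).
rewrite andTb; apply: leq_trans Nm; rewrite ltnS.
by rewrite (big_rem k) //= leq_maxl.
Qed.

Lemma level_list_of_dim : exists ks, level_list lam s ks /\ size ks = n.
Proof.
pose cnt N := [seq k <- iota 0 N | lam k == s].
have cu N : uniq (cnt N) by rewrite filter_uniq // iota_uniq.
have ca N : all (fun k => lam k == s) (cnt N).
  by apply/allP => k; rewrite mem_filter => /andP[].
have [N Nmax] : exists N, forall N', (size (cnt N') <= size (cnt N))%N.
  pose P m := `[< exists N, size (cnt N) = m >].
  have ex : exists m, P m by exists 0%N; apply/asboolP; exists 0%N.
  have bd m : P m -> (m <= n)%N by move=> /asboolP[N <-]; exact: level_size.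
  have [m /asboolP[N NE] mmax] := ex_maxnP ex bd.
  by exists N => N'; rewrite NE; apply: mmax; apply/asboolP; exists N'.
have lev : level_list lam s (cnt N).
  split => // k; rewrite mem_filter mem_iota add0n /=.
  have [lk|//] := boolP (lam k == s).
  rewrite /= ltnNge; apply/negP => Nk.
  have := Nmax k.+1; rewrite leqNgt => /negP; apply.
  rewrite /cnt -[k.+1]addn1 iotaD filter_cat size_cat /= add0n lk /= addn1 ltnS.
  by rewrite -(subnKC Nk) iotaD filter_cat size_cat leq_addr.
exists (cnt N); split => //; apply/eqP; rewrite eqn_leq level_size //=.
rewrite leqNgt; apply/negP => lt.
set ks := cnt N in lev lt.
have [x x0 xA] := @wide_kernel _ _
  (\matrix_(i < n, j < size ks) inner (b i) (Y (nth 0%N ks j))) lt.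
move/eqP: x0; apply; apply/rowP => i; rewrite mxE.
apply: (bfree (a := fun i => x 0 i)).
have : \forall w \ae mu, forall i, b i w = \sum_(k <- ks) inner (b i) (Y k) * Y k w.
  by apply: filter_forall => j; apply: filterS (level_spans lev (Eb j)) => w /(_ I).
apply: filterS => w hw _ /=.
under eq_bigr do rewrite hw (big_nth 0%N) big_mkord mulr_sumr.
rewrite exchange_big /= big1 // => j _.
under eq_bigr do rewrite mulrA.
rewrite -mulr_suml (_ : \sum_i _ =
  (x *m \matrix_(i < n, j < size ks) inner (b i) (Y (nth 0%N ks j))) 0 j).
  by rewrite xA mxE mul0r.
by rewrite mxE; apply: eq_bigr => l _; rewrite mxE.
Qed.

End Dimension.
End SquareIntegrable.

Lemma level_list_of_card (R : realType) (g : nat -> R) (s : R) n :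
  ([set j | g j = s] #= `I_n)%card -> exists l, level_list g s l /\ size l = n.
Proof.
move=> h.
have /finite_fsetP[X XE] : finite_set [set j | g j = s] by apply/finite_setP; exists n.
rewrite XE in h; move/card_eq_fsetP : h => h.
exists (finmap.enum_fset X); split => //; split; first exact: finmap.fset_uniq.
move=> k; apply/idP/eqP => [kX|gk].
  by have : [set j | g j = s] k by rewrite XE.
by have : [set j | g j = s] k by []; rewrite XE.
Qed.

(** At the first index k where the two sequences differ, say g k > f k, every
index at which g takes the value f k lies before k, hence is also one for f, but
k is one for f only. *)
Lemma nondecreasing_eq_of_levels (R : realType) (f g : nat -> R) :
  nondecreasing_seq f -> nondecreasing_seq g ->
  (forall s, exists l l', [/\ level_list f s l, level_list g s l' & size l = size l']) ->
  f =1 g.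
Proof.
have key (p q : nat -> R) k : nondecreasing_seq q -> (forall j, (j < k)%N -> p j = q j) ->
    (forall s, exists l l', [/\ level_list p s l, level_list q s l' & size l = size l']) ->
    q k <= p k.
  move=> ndq pq H; rewrite leNgt; apply/negP => lt.
  have [l [l' [[ul lP] [ul' l'P] sz]]] := H (p k).
  suff : (size (k :: l') <= size l)%N by rewrite sz ltnn.
  apply: uniq_leq_size.
    by rewrite /= ul' andbT l'P gt_eqF.
  move=> j; rewrite inE lP l'P => /predU1P[->//|/eqP qj].
  rewrite pq ?qj // ltnNge; apply/negP => /ndq; by rewrite qj leNgt lt.
move=> ndf ndg H k; have [m] := ubnP k; elim: m k => // m ih k km.
have ihk j : (j < k)%N -> f j = g j by move=> jk; apply: ih; exact: leq_trans jk km.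
apply/eqP; rewrite eq_le; apply/andP; split.
- apply: (key g f) => //; first by move=> j /ihk.
  by move=> s; have [l [l' [h1 h2 h3]]] := H s; exists l', l; split.
- exact: (key f g).
Qed.

(** * The Steklov spectrum *)
Section DirichletToNeumannMap.
Variables (R : realType) (d : nat) (mu : nat -> R) (Y : nat -> euclidean R d -> R).
Hypothesis mu_ge0 : forall k, 0 <= mu k.
Notation S := (sphere_measure R d).
Hypothesis Y2 : forall k, Y k \in Lfun S 2%:E.
Hypothesis Yorth : forall j k, inner S (Y j) (Y k) = (j == k)%:R.

Lemma L2dist_sym psi phi : psi \in Lfun S 2%:E -> phi \in Lfun S 2%:E ->
  L2dist psi phi = L2dist phi psi.
Proof.
move=> p2 q2; rewrite /L2dist.
have := norm2Z (-1) (L2B p2 q2); rewrite normrN normr1 mul1e => <-.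
by apply: eq_Lnorm => w /=; rewrite mulN1r opprB.
Qed.

Lemma L2_sum_single (g : nat -> euclidean R d -> R) psi k : psi \in Lfun S 2%:E ->
  (forall w, g k w = psi w) -> (forall j w, j != k -> g j w = 0) -> L2_sum g psi.
Proof.
move=> p2 gk g0; split => //; apply: cvg_near_cst; exists k.+1 => // n /= kn.
rewrite /L2dist -[RHS](norm2_0 S); apply: eq_Lnorm => w /=.
rewrite (bigD1 (Ordinal kn)) //= gk big1 ?addr0 ?subrr // => i ik.
by apply: g0; apply: contra ik => /eqP ik; apply/eqP/val_inj.
Qed.

Lemma L2_sum_coef (b : nat -> R) psi : L2_sum (fun k w => b k * Y k w) psi ->
  forall j, coef Y psi j = b j.
Proof.
move=> [p2 c] j.
pose s n w := \sum_(k < n) b k * Y k w.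
have s2 n : s n \in Lfun S 2%:E by apply: L2_sum_mem => i _; exact: L2Z.
have c' : ('N[S]_2%:E[EFin \o (s n \- psi)%R] @[n --> \oo] --> 0)%E.
  rewrite (_ : (fun n => _) = (fun n => L2dist psi (s n))) //.
  by apply/funext => n; rewrite -L2dist_sym.
have h : inner S (s n) (Y j) @[n --> \oo] --> inner S psi (Y j).
  by apply: inner_cvg => //; exact: nearW.
have h2 : inner S (s n) (Y j) @[n --> \oo] --> b j.
  apply: cvg_near_cst; exists j.+1 => // n /= jn.
  have -> : s n = (fun w => \sum_(k <- index_iota 0 n) b k * Y k w).
    by apply/funext => w; rewrite /s big_mkord.
  rewrite (inner_combination Y2 Yorth) ?iota_uniq //.
  by rewrite mem_index_iota jn.
rewrite -[LHS]/(inner S psi (Y j)).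
by apply: (cvg_unique _ h h2); exact: Rhausdorff.
Qed.

Variable c : R -> R.
Notation n := (d - 2)%N.
Notation a := (n%:R / 2 : R).
Hypothesis cpos : forall r, 0 <= r <= 1 -> 0 < c r.
Variables (F F1 H : R -> R) (m M B : R).
Hypothesis pF : profile a F F1 H m M B.
Hypothesis FE : forall x, 0 <= x -> F x = warp_f c x ^+ n.
Hypothesis potE : forall x, 0 < x -> potential d c x = expR (- x) * H (expR (- x)).

Lemma warp_f0_gt0 : 0 < warp_f c 0.
Proof. by rewrite /warp_f oppr0 expR0 mul0r expR0 mulr1 cpos // ler01 lexx. Qed.

Lemma kappa_sq l : 0 <= l -> kappa d l ^+ 2 = l + a ^+ 2.
Proof.
move=> l0; rewrite /kappa sqr_sqrtr; first by field.
by rewrite addr_ge0 // divr_ge0 // sqr_ge0.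
Qed.

Lemma radial_der l v : 0 <= l -> radial_solution d c (kappa d l) v ->
  [/\ forall x : R, 0 < x -> is_derive x 1 v (derive1 v x),
      forall x : R, 0 < x -> is_derive x 1 (derive1 v)
        ((l + a ^+ 2 + expR (- x) * H (expR (- x))) * v x),
      v x @[x --> 0^'+] --> v 0
    & (\int[@lebesgue_measure R]_(x in [set x : R | (0 < x)%R]) (v x ^+ 2)%:E < +oo)%E].
Proof.
move=> l0 [cv sol L2]; split => //.
- move=> x /sol[d1 _ _]; rewrite derive1E; exact/derivableP.
- move=> x x0; have [_ d2 eqn] := sol x x0.
  apply: (@der_eq R _ x (derive1 (derive1 v) x)).
    by rewrite derive1E; exact/derivableP.
  by move: eqn; rewrite kappa_sq // potE // => eqn; lra.
Qed.

Lemma radial_of_weyl l v v1 s : 0 <= l -> weyl a F H l v v1 ->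
  radial_solution d c (kappa d l) (fun x => s * v x).
Proof.
move=> l0 hv.
have dv (x : R) : 0 <= x -> is_derive x 1 (fun x => s * v x) (s * v1 x).
  by move=> x0; exact: derZ (weyl_der hv x0).
have dv1 (x : R) : 0 < x -> is_derive x 1 (derive1 (fun x => s * v x))
    (s * ((l + a ^+ 2 + expR (- x) * H (expR (- x))) * v x)).
  move=> x0; apply: der_near (derZ s (weyl_der1 hv (ltW x0))).
  near=> y; rewrite (der_derive1 (dv y _)) // ltW //.
  by near: y; exact: lt_nbhsr.
split.
- by apply: cvg_at_right_filter; exact: der_cont (dv 0 (lexx 0)).
- move=> x x0; split.
  + by have [] := dv x (ltW x0).
  + by have [] := dv1 x x0.
  + by rewrite (der_derive1 (dv1 x x0)) kappa_sq // potE //; ring.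
- have [C hC] := weyl_decay hv.
  apply: (square_integrable_of_decay pF (C := `|s| * C)).
    by move=> x; rewrite in_itv /= andbT => /ltW x0; exact: der_cont (dv x x0).
  move=> x /ltW x0; have [h _] := hC x x0.
  by rewrite normrM -mulrA ler_wpM2l.
Unshelve. all: by end_near. Qed.

Lemma radial_unique l v w w1 : 0 <= l -> weyl a F H l w w1 ->
  radial_solution d c (kappa d l) v -> forall x, 0 <= x -> v x = v 0 / F 0 * w x.
Proof.
move=> l0 hw /(radial_der l0)[dv dv1 cv L2].
exact: (weyl_unique pF l0 hw dv dv1 cv L2).
Qed.

Variables w w1 : nat -> R -> R.
Hypothesis hw : forall k, weyl a F H (mu k) (w k) (w1 k).

(** The Steklov eigenvalue - f(0)^-2 u'(0) that belongs to [mu k]. *)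
Definition steklov_value k : R :=
  - (warp_f c 0 ^- 2) * (wronsk F F1 (w k) (w1 k) 0 / F 0 ^+ 2).

Lemma weyl_quotient_0 k : w k 0 / F 0 = 1.
Proof. by rewrite (weyl_0 (hw k)) divff // gt_eqF // (profile_gt0 pF). Qed.

Lemma steklov_value_cvg k :
  - (warp_f c 0 ^- 2) * ((w k x / F x - 1) / x) @[x --> (0:R)^'+] --> steklov_value k.
Proof.
apply: cvgM; first exact: cvg_cst.
have [+ qE] := der_quotient pF (lexx 0) (weyl_der (hw k) (lexx 0)).
rewrite -qE => dq; have := cvg_dnbhs_at_right dq.
rewrite -/('D_1 (fun t => w k t / F t) 0).
apply: cvg_trans; apply: near_eq_cvg; near=> x.
by rewrite /= weyl_quotient_0 /GRing.scale /= mulr1 addr0 mulrC.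
Unshelve. all: by end_near. Qed.

(** The harmonic extension of Y k has the single component u(x) Y k, so its
difference quotient converges as soon as that of u does. *)
Lemma steklov_eigenfunction k :
  DN mu Y c (Y k) (fun t => steklov_value k * Y k t).
Proof.
have f0 := warp_f0_gt0.
have F0E : F 0 = warp_f c 0 ^+ n := FE (lexx 0).
have cE j : coef Y (Y k) j = (k == j)%:R by exact: Yorth.
split.
- split.
    apply: (@L2_sum_single _ _ k) => //.
      by move=> t; rewrite cE eqxx mul1r.
    by move=> j t jk; rewrite cE eq_sym (negbTE jk) mul0r.
  apply/cvg_ex; exists (Num.sqrt (1 + mu k)).
  apply: cvg_near_cst; exists k.+1 => // N /= kN.
  rewrite /series /= big_mkord (bigD1 (Ordinal kN)) //= cE eqxx expr1n mulr1.
  rewrite big1 ?addr0 // => i ik; rewrite cE eq_sym.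
  rewrite (_ : (i == k :> nat) = false) ?expr0n ?mulr0 //.
  by apply: negbTE; apply: contra ik => /eqP ik; apply/eqP/val_inj.
- exact: L2Z.
pose u x t := w k x / F x * Y k t.
exists u.
  exists (fun j => if j == k then fun x => 1 * w k x else fun x => 0 * w j x); split.
    move=> j; split; first by case: eqP => [->|_]; exact: radial_of_weyl.
    rewrite cE -F0E; have [_|_] := eqVneq j k.
      by rewrite mul1r mulr1 (weyl_0 (hw k)).
    by rewrite mul0r mulr0.
  move=> x x0; apply: (@L2_sum_single _ _ k).
  - exact: L2Z.
  - by move=> t; rewrite eqxx mul1r -FE // /u mulrC [_^-1 * _]mulrC mulrC.
  - by move=> j t jk; rewrite (negbTE jk) mul0r mulr0 mul0r.
have Yfin : ('N[S]_2%:E[EFin \o Y k] \is a fin_num)%E.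
  by rewrite ge0_fin_numE ?Lnorm_ge0 // L2_finite.
pose e x := - (warp_f c 0 ^- 2) * ((w k x / F x - 1) / x) - steklov_value k.
have distE x : L2dist (fun t => - (warp_f c 0 ^- 2) * ((u x t - u 0 t) / x))
    (fun t => steklov_value k * Y k t) =
    (`|e x| * fine ('N[S]_2%:E[EFin \o Y k])%E)%:E.
  rewrite EFinM (fineK Yfin) -norm2Z // /L2dist; apply: eq_Lnorm => t /=.
  by congr (_ %:E); rewrite /u /e weyl_quotient_0; ring.
rewrite (_ : (fun x => L2dist _ _) = fun x => (`|e x| * fine ('N[S]_2%:E[EFin \o Y k])%E)%:E); last first.
  by apply/funext => x; exact: distE.
have e0 : e x @[x --> (0:R)^'+] --> (0 : R).
  have := cvgB (@steklov_value_cvg k) (cvg_cst (steklov_value k)).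
  by rewrite subrr => h; exact: h.
have := cvgM (cvg_norm e0) (cvg_cst (fine ('N[S]_2%:E[EFin \o Y k])%E)).
by rewrite normr0 mul0r => h; apply: cvg_EFin; [exact: nearW|exact: h].
Qed.

(** The k-th component of a harmonic extension is coef psi k times u, by
uniqueness of the decaying solution, and taking a coefficient commutes with the
limit in the mean.  Hence an eigenfunction has
steklov_value k * coef psi k = s * coef psi k. *)
Lemma DN_coef psi s k : DN mu Y c psi (fun t => s * psi t) ->
  steklov_value k != s -> coef Y psi k = 0.
Proof.
move=> [[[p2 _] _] sp2 [u [v [hv hu]] lim]].
have f0 := warp_f0_gt0.
have F0E : F 0 = warp_f c 0 ^+ n := FE (lexx 0).
have F0 : F 0 != 0 by rewrite gt_eqF // (profile_gt0 pF).
have ck x : 0 <= x -> coef Y (u x) k = coef Y psi k * (w k x / F x).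
  move=> x0; rewrite (L2_sum_coef (hu x x0)) -FE //.
  have [rv v0] := hv k.
  rewrite (radial_unique (mu_ge0 k) (hw k) rv x0) v0 -F0E.
  have Fx : F x != 0 by rewrite gt_eqF // (profile_gt0 pF).
  by field; rewrite F0 Fx.
have u2 x : 0 <= x -> u x \in Lfun S 2%:E by move=> /hu[].
pose q x t := - (warp_f c 0 ^- 2) * ((u x t - u 0 t) / x).
have qE x : q x = fun t => (- (warp_f c 0 ^- 2) / x) * (u x t - u 0 t).
  by apply/funext => t; rewrite /q; ring.
have q2 x : 0 <= x -> q x \in Lfun S 2%:E.
  by move=> x0; rewrite qE; apply: L2Z; apply: L2B; exact: u2.
have qc x : 0 <= x -> inner S (q x) (Y k) =
    - (warp_f c 0 ^- 2) * ((w k x / F x - 1) / x) * coef Y psi k.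
  move=> x0; rewrite qE innerZ ?innerB //; [|exact: u2..|by apply: L2B; exact: u2].
  rewrite -[inner S (u x) _]/(coef Y (u x) k) -[inner S (u 0) _]/(coef Y (u 0) k).
  by rewrite !ck // weyl_quotient_0; ring.
have near2 : \forall x \near (0:R)^'+, q x \in Lfun S 2%:E.
  by near=> x; apply: q2.
have h1 : inner S (q x) (Y k) @[x --> (0:R)^'+] --> inner S (fun t => s * psi t) (Y k).
  exact: inner_cvg.
have h2 : inner S (q x) (Y k) @[x --> (0:R)^'+] --> steklov_value k * coef Y psi k.
  have h : - (warp_f c 0 ^- 2) * ((w k x / F x - 1) / x) * coef Y psi k
      @[x --> (0:R)^'+] --> steklov_value k * coef Y psi k.
    by apply: cvgM; [exact: steklov_value_cvg|exact: cvg_cst].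
  apply: cvg_trans h; apply: near_eq_cvg; near=> x.
  by rewrite qc.
have : inner S (fun t => s * psi t) (Y k) = steklov_value k * coef Y psi k.
  by apply: cvg_unique h1 h2; exact: Rhausdorff.
rewrite innerZ // -[inner S psi _]/(coef Y psi k) => /eqP.
rewrite -subr_eq0 -mulrBl mulf_eq0 subr_eq0 eq_sym => /orP[/eqP <-|/eqP //].
by rewrite eqxx.
Unshelve. all: by end_near. Qed.

Lemma spectrum_levels sigma : steklov_spectrum mu Y c sigma ->
  forall s, exists l l', [/\ level_list sigma s l, level_list steklov_value s l' & size l = size l'].
Proof.
move=> [_ spec] s; have [N [[b [bE bfree bspan]] card]] := spec s.
have [l [hl sl]] := level_list_of_card card.
have [l' [hl' sl']] : exists ks, level_list steklov_value s ks /\ size ks = N.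
  apply: (@level_list_of_dim _ _ _ S Y Y2 Yorth steklov_value s
    (steklov_eigenspace mu Y c s) N b) => //.
  - by move=> psi [[[p2 _] _] _ _].
  - by move=> k <-; exact: steklov_eigenfunction.
  - move=> psi [[[p2 h] _] _ _]; exact: h.
  - by move=> psi k hpsi ks; exact: DN_coef hpsi ks.
by exists l, l'; rewrite sl sl'.
Qed.

Lemma steklov_value_monotone j k : mu j <= mu k -> steklov_value j <= steklov_value k.
Proof.
rewrite le_eqVlt => /predU1P[e|lt].
  have E x : 0 <= x -> w j x = w k x.
    have hj := hw j; rewrite e in hj.
    have d1 (y : R) : 0 < y -> is_derive y 1 (w j) (w1 j y).
      by move=> /ltW y0; exact: (weyl_der hj y0).
    have d2 (y : R) : 0 < y -> is_derive y 1 (w1 j)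
        ((mu k + a ^+ 2 + expR (- y) * H (expR (- y))) * w j y).
      by move=> /ltW y0; exact: (weyl_der1 hj y0).
    have d3 : w j y @[y --> (0:R)^'+] --> w j 0.
      by apply: cvg_at_right_filter; exact: der_cont (weyl_der hj (lexx 0)).
    have L2 := weyl_square_integrable pF hj.
    move=> x0; rewrite (weyl_unique pF (mu_ge0 k) (hw k) d1 d2 d3 L2 x0).
    by rewrite (weyl_0 hj) divff ?mul1r // gt_eqF // (profile_gt0 pF).
  have h1 := @steklov_value_cvg j; have h2 := @steklov_value_cvg k.
  suff : steklov_value j = steklov_value k by move=> ->.
  apply: (cvg_unique _ h1); first exact: Rhausdorff.
  apply: cvg_trans h2; apply: near_eq_cvg; near=> x.
  by rewrite E.
have f0 := warp_f0_gt0.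
have F0 := profile_gt0 pF (lexx 0).
have h := weyl_monotone pF lt (hw j) (hw k).
rewrite /steklov_value -lerN2 !mulNr !opprK ler_wpM2l //.
  by rewrite invr_ge0 exprn_ge0 // ltW.
rewrite ler_pM2r ?invr_gt0 ?exprn_gt0 //.
rewrite /wronsk (weyl_0 (hw j)) (weyl_0 (hw k)) lerB //.
by rewrite ler_wpM2r ?(ltW F0) // ltW.
Unshelve. all: by end_near. Qed.

End DirichletToNeumannMap.

(** * The eigenvalues of the round sphere are unbounded *)
Section DirectionalDerivatives.
Variables (R : realType) (d : nat).
Implicit Types (x v : 'rV[R]_d) (f g : 'rV[R]_d -> R).

(** Reduces directional derivatives to derivatives on the line. *)
Lemma is_derive_line f x v a :
  is_derive (0 : R) 1 (fun t : R => f (t *: v + x)) a -> is_derive x v f a.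
Proof.
have E : (fun h : R => h^-1 *: (((fun t : R => f (t *: v + x)) \o shift (0 : R)) (h *: (1 : R)) -
   f ((0 : R) *: v + x))) = (fun h : R => h^-1 *: ((f \o shift x) (h *: v) - f x)).
  apply/funext => h; rewrite /= scale0r add0r addr0.
  by rewrite [h *: 1]mulr1.
move=> [d1 d2]; split.
  by rewrite /derivable -E; exact: d1.
by rewrite /derive -E; exact: d2.
Qed.

Lemma der_coord x (i j : 'I_d) :
  is_derive (0 : R) 1 (fun t : R => (t *: 'e_i + x) 0 j) (j == i)%:R.
Proof.
rewrite (_ : (fun t : R => _) = (fun t : R => t * (j == i)%:R + x 0 j)); last first.
  by apply/funext => t; rewrite !mxE eqxx.
apply: der_eq (derD (derM (is_derive_id (0:R) 1) (derC (j == i)%:R 0)) (derC (x 0 j) 0)) _.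
by rewrite mul0r !addr0 mul1r.
Qed.

End DirectionalDerivatives.

Section PlanarHarmonics.
Variable R : realType.

(** The real and imaginary parts of (p + i q)^n. *)
Fixpoint re_im (n : nat) (p q : R) : R * R :=
  if n is n'.+1 then
    let z := re_im n' p q in (p * z.1 - q * z.2, q * z.1 + p * z.2)
  else (1, 0).

Notation A n p q := (re_im n p q).1.
Notation B n p q := (re_im n p q).2.

Lemma der_re_im n (p q : R -> R) (t p' q' : R) :
  is_derive t 1 p p' -> is_derive t 1 q q' ->
  is_derive t 1 (fun t => A n.+1 (p t) (q t))
    (n.+1%:R * (A n (p t) (q t) * p' - B n (p t) (q t) * q')) /\
  is_derive t 1 (fun t => B n.+1 (p t) (q t))
    (n.+1%:R * (B n (p t) (q t) * p' + A n (p t) (q t) * q')).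
Proof.
move=> dp dq; elim: n => [|n [ihA ihB]].
  split.
  - by apply: der_eq (derB (derM dp (derC 1 t)) (derM dq (derC 0 t))) _; rewrite /=; ring.
  - by apply: der_eq (derD (derM dq (derC 1 t)) (derM dp (derC 0 t))) _; rewrite /=; ring.
split.
- apply: der_eq (derB (derM dp ihA) (derM dq ihB)) _.
  by rewrite /= -[n.+2%:R]natr1 -[n.+1%:R]natr1; ring.
- apply: der_eq (derD (derM dq ihA) (derM dp ihB)) _.
  by rewrite /= -[n.+2%:R]natr1 -[n.+1%:R]natr1; ring.
Qed.

Lemma re_im_scale n (k p q : R) :
  A n (p * k) (q * k) = A n p q * k ^+ n /\ B n (p * k) (q * k) = B n p q * k ^+ n.
Proof.
elim: n => [|n [hA hB]] /=; first by rewrite expr0 !mulr1.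
by rewrite hA hB !exprS; split; ring.
Qed.

Lemma re_im_10 n : re_im n 1 0 = (1, 0).
Proof. by elim: n => [//|n /= ->] /=; congr pair; ring. Qed.

Lemma re_im_cvg (T : Type) (F : set_system T) {FF : Filter F} (p q : T -> R) (a b : R) n :
  p t @[t --> F] --> a -> q t @[t --> F] --> b ->
  A n (p t) (q t) @[t --> F] --> A n a b /\ B n (p t) (q t) @[t --> F] --> B n a b.
Proof.
move=> hp hq; elim: n => [|n [ihA ihB]]; first by split; exact: cvg_cst.
split; first by apply: cvgB; apply: cvgM.
by apply: cvgD; apply: cvgM.
Qed.

End PlanarHarmonics.

Section SphereEigenvalues.
Variables (R : realType) (d : nat).
Hypothesis d2 : (1 < d)%N.
Let i0 : 'I_d := Ordinal (ltnW d2).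
Let i1 : 'I_d := Ordinal d2.
Variable m : nat.
Let N := m.+1.*2.

Let sq (x : 'rV[R]_d) : R := \sum_i x 0 i ^+ 2.
Let a n (x : 'rV[R]_d) : R := (re_im n (x 0 i0) (x 0 i1)).1.
Let b n (x : 'rV[R]_d) : R := (re_im n (x 0 i0) (x 0 i1)).2.
Let e (i j : 'I_d) : R := (i == j)%:R.

(** The restriction to the sphere of the harmonic polynomial Re (x0 + i x1)^N.
For even N its extension that is constant along rays is a rational function,
with denominator a power of the squared norm. *)
Definition planar_harmonic (t : euclidean R d) : R :=
  (re_im N (tnth t i0 : R) (tnth t i1 : R)).1.

Let Phi x := a N x * (sq x)^-1 ^+ m.+1.

Lemma hom_ext_planar_harmonic : hom_ext planar_harmonic = Phi.
Proof.
apply/funext => x; rewrite /hom_ext /planar_harmonic /normalize !tnth_mktuple.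
have -> : enorm ([tuple x 0 i | i < d] : euclidean R d) = Num.sqrt (sq x).
  by congr Num.sqrt; apply: eq_bigr => i _; rewrite tnth_mktuple.
have [-> _] := re_im_scale N (Num.sqrt (sq x))^-1 (x 0 i0) (x 0 i1).
have E : (Num.sqrt (sq x))^-1 ^+ 2 = (sq x)^-1.
  by rewrite exprVn sqr_sqrtr // sumr_ge0 // => i _; exact: sqr_ge0.
by rewrite /Phi /N -mul2n exprM E.
Qed.

Lemma der_sq (x : 'rV[R]_d) i : is_derive (0 : R) 1 (fun t : R => sq (t *: 'e_i + x)) (2 * x 0 i).
Proof.
have E t : sq (t *: 'e_i + x) = t ^+ 2 + 2 * x 0 i * t + sq x.
  rewrite /sq (bigD1 i) //= [in RHS](bigD1 i) //= !mxE !eqxx mulr1.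
  rewrite (eq_bigr (fun j => x 0 j ^+ 2)); first by ring.
  by move=> j ji; rewrite !mxE eqxx (negbTE ji) mulr0 add0r.
rewrite (_ : (fun t : R => _) = (fun t => t ^+ 2 + 2 * x 0 i * t + sq x)); last first.
  by apply/funext => t; exact: E.
apply: der_eq (derD (derD (derX 1 (is_derive_id (0:R) 1)) (derZ (2 * x 0 i) (is_derive_id (0:R) 1)))
  (derC (sq x) 0)) _.
by rewrite expr1; ring.
Qed.

Lemma sq_gt0 (x : 'rV[R]_d) : x != 0 -> 0 < sq x.
Proof.
move=> x0; rewrite lt_neqAle eq_sym sumr_ge0 ?andbT; last by move=> i _; exact: sqr_ge0.
apply: contra x0; rewrite psumr_eq0 => [/allP h|i _]; last exact: sqr_ge0.
apply/eqP/rowP => i; rewrite mxE; apply/eqP.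
by have := h i (mem_index_enum i); rewrite sqrf_eq0.
Qed.

Lemma der_sqV (x : 'rV[R]_d) i n : x != 0 ->
  is_derive (0 : R) 1 (fun t : R => (sq (t *: 'e_i + x))^-1 ^+ n.+1)
   (- (2 * n.+1%:R) * x 0 i * (sq x)^-1 ^+ n.+2).
Proof.
move=> x0; have s0 := sq_gt0 x0.
have E0 : (0 : R) *: 'e_i + x = x by rewrite scale0r add0r.
have dV := derV (f := fun t : R => sq (t *: 'e_i + x)) (x := 0) _ (der_sq x i).
rewrite E0 in dV; have {}dV := dV (lt0r_neq0 s0).
apply: der_eq (derX n dV) _; rewrite /= E0 !exprS.
by field; rewrite gt_eqF.
Qed.

Lemma der_a (x : 'rV[R]_d) i n : is_derive (0 : R) 1 (fun t : R => a n.+1 (t *: 'e_i + x))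
  (n.+1%:R * (a n x * e i0 i - b n x * e i1 i)).
Proof.
have [h _] := der_re_im n (der_coord x i i0) (der_coord x i i1).
by apply: der_eq h _; rewrite scale0r add0r.
Qed.

Lemma der_b (x : 'rV[R]_d) i n : is_derive (0 : R) 1 (fun t : R => b n.+1 (t *: 'e_i + x))
  (n.+1%:R * (b n x * e i0 i + a n x * e i1 i)).
Proof.
have [_ h] := der_re_im n (der_coord x i i0) (der_coord x i i1).
by apply: der_eq h _; rewrite scale0r add0r.
Qed.

Let N1 := N.-1.
Let N2 := N.-2.

Let ai i x := N%:R * (a N1 x * e i0 i - b N1 x * e i1 i).
Let aij i j x := N%:R * (N1%:R * (a N2 x * e i0 j - b N2 x * e i1 j) * e i0 i -
  N1%:R * (b N2 x * e i0 j + a N2 x * e i1 j) * e i1 i).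

Let D1 i x := ai i x * (sq x)^-1 ^+ m.+1 -
  2 * m.+1%:R * (x 0 i * a N x * (sq x)^-1 ^+ m.+2).

Let D2 i j x := aij i j x * (sq x)^-1 ^+ m.+1 -
  2 * m.+1%:R * (x 0 j * ai i x * (sq x)^-1 ^+ m.+2) -
  2 * m.+1%:R * (e i j * a N x * (sq x)^-1 ^+ m.+2) -
  2 * m.+1%:R * (x 0 i * ai j x * (sq x)^-1 ^+ m.+2) +
  4 * m.+1%:R * m.+2%:R * (x 0 i * x 0 j * a N x * (sq x)^-1 ^+ m.+3).

Lemma der_Phi (x : 'rV[R]_d) i : x != 0 -> is_derive x 'e_i Phi (D1 i x).
Proof.
move=> x0; apply: is_derive_line.
apply: der_eq (derM (der_a x i N1) (der_sqV i m x0)) _.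
rewrite scale0r add0r /D1 /ai -[N1.+1]/N; ring.
Qed.

Lemma der_D1 (x : 'rV[R]_d) i j : x != 0 -> is_derive x 'e_j (D1 i) (D2 i j x).
Proof.
move=> x0; apply: is_derive_line.
have dai : is_derive (0 : R) 1 (fun t : R => ai i (t *: 'e_j + x)) (aij i j x).
  apply: der_eq (derZ N%:R (derB (derM (der_a x j N2) (derC (e i0 i) 0))
    (derM (der_b x j N2) (derC (e i1 i) 0)))) _.
  by rewrite /aij -[N2.+1]/N1; ring.
apply: der_eq (derB (derM dai (der_sqV j m x0))
  (derZ (2 * m.+1%:R) (derM (derM (der_coord x j i) (der_a x j N1)) (der_sqV j m.+1 x0)))) _.
rewrite scale0r add0r /D2 -/(e i j) -[N1.+1]/N -/(ai j x); ring.
Qed.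

Lemma near_neq0 (x : 'rV[R]_d) : x != 0 -> \forall y \near x, y != 0 :> 'rV[R]_d.
Proof.
move=> x0; have h : id y @[y --> x] --> x by exact: cvg_id.
exact: (@cvgr_neq0 _ _ _ (nbhs x) _ id x h x0).
Qed.

Lemma coord_cvg (x : 'rV[R]_d) (i : 'I_d) :
  (fun y : 'rV[R]_d => y 0 i) @ x --> (x 0 i : R).
Proof. exact: coord_continuous. Qed.

Lemma D2_continuous (x : 'rV[R]_d) i j : x != 0 -> {for x, continuous (D2 i j)}.
Proof.
move=> x0; have s0 := sq_gt0 x0.
have FF : Filter (nbhs x) := nbhs_filter x.
have csq : sq @ x --> sq x.
  rewrite /sq; elim: (index_enum _) => [|k r ih].
    rewrite (_ : (fun y => _) = fun=> 0); last by apply/funext => y; rewrite big_nil.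
    by rewrite big_nil; exact: (@cvg_cst _ _ _ _ FF).
  rewrite (_ : (fun y => _) =
    (fun y : 'rV[R]_d => y 0 k ^+ 2 + \sum_(i <- r) y 0 i ^+ 2)); last first.
    by apply/funext => y; rewrite big_cons.
  rewrite big_cons; apply: cvgD ih; have h := @coord_cvg x k; exact: (cvgM h h).
have cV n : (fun y => (sq y)^-1 ^+ n) @ x --> (sq x)^-1 ^+ n.
  elim: n => [|n ih]; first by rewrite expr0; exact: (@cvg_cst _ _ _ _ FF).
  rewrite exprS (_ : (fun y => _) = (fun y => (sq y)^-1 * (sq y)^-1 ^+ n)); last first.
    by apply/funext => y; rewrite exprS.
  by apply: cvgM => //; apply: cvgV => //; exact: lt0r_neq0.
have [ca cb] : (forall n, a n @ x --> a n x) /\ (forall n, b n @ x --> b n x).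
  by split=> n; have [h1 h2] := @re_im_cvg R _ _ FF _ _ _ _ n (@coord_cvg x i0) (@coord_cvg x i1).
have cc (k : R) : (fun=> k) @ x --> k by exact: (@cvg_cst _ _ _ _ FF).
have cx k := @coord_cvg x k.
have cai k : ai k @ x --> ai k x.
  by apply: cvgM => //; apply: cvgB; apply: cvgM.
have caij : aij i j @ x --> aij i j x.
  apply: cvgM => //; apply: cvgB; apply: cvgM => //; apply: cvgM => //.
    by apply: cvgB; apply: cvgM.
  by apply: cvgD; apply: cvgM.
apply: cvgD; [apply: cvgB; [apply: cvgB; [apply: cvgB|]|]|].
- exact: cvgM.
- by do 3! [apply: cvgM => //].
- by do 3! [apply: cvgM => //].
- by do 3! [apply: cvgM => //].
- by do 4! [apply: cvgM => //].
Qed.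

Lemma near_derive_Phi (x : 'rV[R]_d) i : x != 0 -> \forall y \near x, D1 i y = 'D_'e_i Phi y.
Proof.
move=> x0; apply: filterS (near_neq0 x0) => y y0.
by have [_ ->] := der_Phi i y0.
Qed.

Lemma der_derive_Phi (x : 'rV[R]_d) i j : x != 0 -> is_derive x 'e_j ('D_'e_i Phi) (D2 i j x).
Proof. by move=> x0; apply: near_eq_is_derive (near_derive_Phi i x0) (der_D1 i j x0). Qed.

Lemma sum_delta (f : 'I_d -> R) k : \sum_i f i * e k i = f k.
Proof.
rewrite (bigD1 k) //= /e eqxx mulr1 big1 ?addr0 // => i ik.
by rewrite eq_sym (negbTE ik) mulr0.
Qed.

Let sum_four (p q r : 'I_d -> R) (k1 k2 k3 u : R) :
  \sum_i (p i - k1 * q i - k2 * u + k3 * r i) =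
  \sum_i p i - k1 * \sum_i q i - k2 * (d%:R * u) + k3 * \sum_i r i.
Proof.
rewrite big_split /= !sumrB -!mulr_sumr sumr_const card_ord -[u *+ d]mulr_natl.
by [].
Qed.

(** At a point of the unit sphere the second derivatives of the ray-constant
extension sum to - N (N + d - 2) times its value: the polynomial is harmonic and,
by Euler's identity, sum_i x_i a_i = N a. *)
Lemma planar_harmonic_eigenfun :
  sphere_eigenfun (N%:R * (N%:R + d%:R - 2)) planar_harmonic.
Proof.
split.
  move=> x x0 i j; rewrite hom_ext_planar_harmonic; split.
  - by have [] := der_Phi i x0.
  - by have [] := der_derive_Phi i j x0.
  - have E : \forall y \near x, D2 i j y = 'D_'e_j ('D_'e_i Phi) y.
      apply: filterS (near_neq0 x0) => y y0.
      by have [_ ->] := der_derive_Phi i j y0.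
    have h : D2 i j @ x --> D2 i j x := @D2_continuous x i j x0.
    suff : ('D_'e_j ('D_'e_i Phi)) @ x --> D2 i j x by rewrite (nbhs_singleton E).
    have FF : Filter (nbhs x) := nbhs_filter x.
    apply: cvg_trans h; apply: near_eq_cvg.
    exact: E.
move=> t t1; set x : 'rV[R]_d := \row_j (tnth t j : R).
have sx : sq x = 1.
  have -> : sq x = \sum_(i < d) (tnth t i : R) ^+ 2.
    by apply: eq_bigr => i _; rewrite mxE.
  rewrite -[LHS]sqr_sqrtr ?sqsum_ge0 // -[Num.sqrt _]/(enorm t) t1 expr1n //.
have x0 : x != 0.
  apply/eqP => x0; move: sx; rewrite x0 /sq big1 => [/eqP|i _]; last by rewrite mxE expr0n.
  by rewrite eq_sym oner_eq0.
have -> : planar_harmonic t = a N x by rewrite /a !mxE.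
rewrite /sphere_laplacian hom_ext_planar_harmonic -/x.
have -> : \sum_(i < d) 'D_'e_i ('D_'e_i Phi) x = \sum_i D2 i i x.
  by apply: eq_bigr => i _; have [_ ->] := der_derive_Phi i i x0.
have -> : \sum_i D2 i i x = \sum_i aij i i x - 4 * m.+1%:R * \sum_i x 0 i * ai i x
   - 2 * m.+1%:R * (d%:R * a N x) + 4 * m.+1%:R * m.+2%:R * sq x * a N x.
  rewrite (eq_bigr (fun i => aij i i x - 4 * m.+1%:R * (x 0 i * ai i x) -
    2 * m.+1%:R * a N x + 4 * m.+1%:R * m.+2%:R * a N x * x 0 i ^+ 2)).
    by rewrite sum_four -/(sq x) [_ * sq x]mulrAC.
  move=> i _; rewrite /D2 sx invr1 !expr1n (_ : e i i = 1) ?/e ?eqxx //.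
  move: (aij i i x) (ai i x) (a N x) (x 0 i) => p q r y; ring.
have i01 : e i0 i1 = 0 by [].
have i10 : e i1 i0 = 0 by [].
have e00 k : e k k = 1 by rewrite /e eqxx.
have -> : \sum_i aij i i x = 0.
  rewrite (eq_bigr (fun i => N%:R * N1%:R * (a N2 x * e i0 i - b N2 x * e i1 i) * e i0 i -
    N%:R * N1%:R * (b N2 x * e i0 i + a N2 x * e i1 i) * e i1 i)); last first.
    by move=> i _; rewrite /aij; ring.
  rewrite sumrB !sum_delta !e00 i01 i10; ring.
have -> : \sum_i x 0 i * ai i x = N%:R * a N x.
  rewrite (eq_bigr (fun i => N%:R * a N1 x * x 0 i * e i0 i -
    N%:R * b N1 x * x 0 i * e i1 i)); last by move=> i _; rewrite /ai; ring.
  rewrite sumrB !sum_delta /a /b -[N]/(N1.+1) /=; ring.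
rewrite sx (_ : N%:R = 2 * m.+1%:R); last by rewrite /N -mul2n natrM.
rewrite -[m.+2%:R]natr1; ring.
Qed.

Lemma planar_harmonic_neq0 : exists2 t : euclidean R d, enorm t = 1 & planar_harmonic t = 1.
Proof.
exists [tuple ((i == i0)%:R : R) | i < d].
  rewrite /enorm (bigD1 i0) //= tnth_mktuple eqxx expr1n big1 ?addr0 ?sqrtr1 //.
  by move=> i ii; rewrite tnth_mktuple (negbTE ii) expr0n.
rewrite /planar_harmonic !tnth_mktuple eqxx (_ : (i1 == i0) = false) //.
by rewrite re_im_10.
Qed.

End SphereEigenvalues.

(** The eigenvalue N (N + d - 2) must occur among the [mu k], since its
eigenfunction takes the value 1 somewhere and is a combination of the Y k with
that eigenvalue. *)
Lemma sphere_eigenvalues_unbounded (R : realType) (d : nat) mu (Y : nat -> euclidean R d -> R) :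
  (1 < d)%N -> sphere_eigenbasis mu Y -> forall K, exists k, K < mu k.
Proof.
move=> d2 hY K.
pose m := Num.truncn `|K|.
have mK : `|K| < m.+1%:R by exact: truncnS_gt.
have [n [a ha]] := eigenbasis_multiplicity hY (planar_harmonic_eigenfun R d2 m).
have [t t1 Zt] := planar_harmonic_neq0 R d2 m.
move: (ha t t1); rewrite Zt; set N := m.+1.*2.
set lam : R := N%:R * (N%:R + d%:R - 2) => h.
have [[k /eqP kE]|none] := pselect (exists k : 'I_n, mu k == lam).
  exists k; rewrite kE; apply: (le_lt_trans (ler_norm K)); apply: (lt_le_trans mK).
  have N2 : (m.+1%:R : R) <= N%:R by rewrite ler_nat /N -addnn leq_addr.
  have d2R : (2 : R) <= d%:R by rewrite ler_nat.
  have N1 : (1 : R) <= N%:R by rewrite (le_trans _ N2) // ler1n.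
  apply: (le_trans N2); rewrite /lam ler_peMr //; lra.
move: h; rewrite big1 => [/eqP|k hk]; first by rewrite oner_eq0.
by case: none; exists k.
Qed.

(** * Uniqueness of the warping function *)
Section LeadingOrder.
Variable R : realType.

(** Comparison of the leading coefficients of two affine functions of s. *)
Lemma leading_coefficient_le (p q b b' : R) :
  (forall K, exists s, K < s /\ (s - b) * p <= (s + b') * q) -> p <= q.
Proof.
move=> h; rewrite leNgt; apply/negP => qp.
have d0 : 0 < p - q by rewrite subr_gt0.
have [s [sK hs]] := h ((b * p + b' * q) / (p - q)).
rewrite ltr_pdivrMr // in sK; lra.
Qed.

Lemma sqrt_unbounded (mu : nat -> R) : (forall K, exists k, K < mu k) ->
  forall K, exists k, K < Num.sqrt (mu k).
Proof.
move=> h K; have [k hk] := h (K ^+ 2); exists k.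
apply: (le_lt_trans (ler_norm K)); rewrite -sqrtr_sqr.
by rewrite ltr_sqrt // (le_lt_trans (sqr_ge0 K)).
Qed.

Lemma weyl_wronsk0_bounds (a : R) (F F1 H : R -> R) (m M B : R) :
  profile a F F1 H m M B -> forall mu v v1, 0 <= mu -> weyl a F H mu v v1 ->
  2 * B < Num.sqrt mu ->
  Num.sqrt mu - 2 * B <= - (wronsk F F1 v v1 0 / F 0 ^+ 2) <= Num.sqrt mu + 2 * B.
Proof.
move=> pF mu v v1 mu0 hv sB; have F0 := profile_gt0 pF (lexx 0).
have F2 : 0 < F 0 ^+ 2 by rewrite exprn_gt0.
have h1 := weyl_riccati_lower pF mu0 hv (lexx 0).
have h2 := weyl_riccati_upper pF mu0 hv sB (lexx 0).
rewrite (weyl_0 hv) -expr2 in h1 h2.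
rewrite -(mulNr (wronsk _ _ _ _ _)) ler_pdivlMr // ler_pdivrMr //.
by apply/andP; split; lra.
Qed.

End LeadingOrder.

Section Uniqueness.
Variables (R : realType) (d : nat) (mu : nat -> R) (Y : nat -> euclidean R d -> R).
Hypotheses (hd : (3 <= d)%N) (hY : sphere_eigenbasis mu Y).
Notation n := (d - 2)%N.
Notation a := (n%:R / 2 : R).

Lemma eigenvalue_ge0 k : 0 <= mu k.
Proof. by rewrite -(eigenbasis_mu0 hY); exact: (eigenbasis_nondecreasing hY). Qed.

Lemma weyl_family (F F1 H : R -> R) (m M B : R) : profile a F F1 H m M B ->
  exists w w1 : nat -> R -> R, forall k, weyl a F H (mu k) (w k) (w1 k).
Proof.
move=> pF.
have ex k : exists p : (R -> R) * (R -> R), weyl a F H (mu k) p.1 p.2.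
  by have [v [v1 h]] := weyl_exists pF (eigenvalue_ge0 k); exists (v, v1).
have [w hw] := choice ex.
by exists (fun k => (w k).1), (fun k => (w k).2).
Qed.

Section Spectrum.
Variables (c : R -> R) (F F1 H : R -> R) (m M B : R) (w w1 : nat -> R -> R).
Hypothesis hc : warping c.
Hypothesis pF : profile a F F1 H m M B.
Hypothesis FE : forall x, 0 <= x -> F x = warp_f c x ^+ n.
Hypothesis potE : forall x, 0 < x -> potential d c x = expR (- x) * H (expR (- x)).
Hypothesis hw : forall k, weyl a F H (mu k) (w k) (w1 k).

Lemma spectrum_eq_steklov_value sigma : steklov_spectrum mu Y c sigma ->
  sigma =1 steklov_value c F F1 w w1.
Proof.
move=> hs.
have [cpos _] := hc.
apply: nondecreasing_eq_of_levels.
- by case: hs.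
- move=> i j ij; apply: (steklov_value_monotone eigenvalue_ge0 cpos pF hw).
  exact: (eigenbasis_nondecreasing hY).
- exact: (spectrum_levels eigenvalue_ge0 (eigenbasis_L2 hY)
    (eigenbasis_orthonormal hY) cpos pF FE potE hw hs).
Qed.

Lemma steklov_value_bounds k : 2 * B < Num.sqrt (mu k) ->
  (Num.sqrt (mu k) - 2 * B) * (warp_f c 0 ^- 2) <= steklov_value c F F1 w w1 k <=
  (Num.sqrt (mu k) + 2 * B) * (warp_f c 0 ^- 2).
Proof.
move=> sB; have [cpos _] := hc.
have f0 := warp_f0_gt0 cpos.
have /andP[h1 h2] := weyl_wronsk0_bounds pF (eigenvalue_ge0 k) (hw k) sB.
rewrite /steklov_value mulNr -mulrN [X in _ <= X <= _]mulrC.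
have i0 : 0 <= warp_f c 0 ^- 2 by rewrite invr_ge0 exprn_ge0 // ltW.
by apply/andP; split; apply: ler_wpM2r.
Qed.

End Spectrum.

Section TwoMetrics.
Variables (c c' : R -> R) (F F1 H : R -> R) (m M B : R) (w w1 : nat -> R -> R).
Variables (F' F1' H' : R -> R) (m' M' B' : R) (w' w1' : nat -> R -> R).
Hypotheses (hc : warping c) (hc' : warping c').
Hypotheses (pF : profile a F F1 H m M B) (pF' : profile a F' F1' H' m' M' B').
Hypothesis FE : forall x, 0 <= x -> F x = warp_f c x ^+ n.
Hypothesis FE' : forall x, 0 <= x -> F' x = warp_f c' x ^+ n.
Hypothesis hw : forall k, weyl a F H (mu k) (w k) (w1 k).
Hypothesis hw' : forall k, weyl a F' H' (mu k) (w' k) (w1' k).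
Hypothesis same : forall k, steklov_value c F F1 w w1 k = steklov_value c' F' F1' w' w1' k.

Let mu_unbounded : forall K, exists k, K < Num.sqrt (mu k).
Proof. by apply: sqrt_unbounded; apply: sphere_eigenvalues_unbounded hY; exact: ltnW. Qed.

(** Steklov eigenvalues are f(0)^-2 (sqrt mu + O(1)), so their growth determines
f(0). *)
Lemma boundary_conformal_le : warp_f c 0 ^- 2 <= warp_f c' 0 ^- 2.
Proof.
apply: (@leading_coefficient_le R _ _ (2 * B) (2 * B')) => K.
have [k] := mu_unbounded (Num.max K (Num.max (2 * B) (2 * B'))).
rewrite !gt_max => /and3P[hK hB hB']; exists (Num.sqrt (mu k)); split => //.
have /andP[h1 _] := steklov_value_bounds hc pF hw hB.
have /andP[_ h2] := steklov_value_bounds hc' pF' hw' hB'.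
by apply: (le_trans h1); rewrite same.
Qed.

(** The interval (1 - e, 1) in r corresponds to a neighbourhood of x = 0 that
contains (0, e), on which [weyl_comparison] applies. *)
Lemma not_eventually_larger (e : R) : warp_f c 0 = warp_f c' 0 -> 0 < e -> e <= 1 ->
  (forall r, 1 - e < r < 1 -> c' r < c r) -> False.
Proof.
move=> f0 e0 e1 cc; have [cpos _] := hc; have [cpos' _] := hc'.
have n0 : (0 < n)%N by rewrite subn_gt0.
have F0 : F 0 = F' 0 by rewrite FE // FE' // f0.
have FF x : 0 < x < e -> F' x < F x.
  move=> /andP[x0 xe]; rewrite FE ?ltW // FE' ?ltW //.
  have r1 : expR (- x) < 1 by rewrite -expR0 ltr_expR oppr_lt0.
  have re : 1 - e < expR (- x).
    by apply: lt_le_trans (expR_ge1Dx (- x)); lra.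
  have r01 : 0 <= expR (- x) <= 1 by rewrite expR_ge0 ltW.
  have ex := expR_gt0 (- x / 2).
  rewrite ltr_pXn2r //; last 2 first.
  - by rewrite nnegrE mulr_ge0 ?ltW // cpos'.
  - by rewrite nnegrE mulr_ge0 ?ltW // cpos.
  by rewrite /warp_f ltr_pM2r // cc // re.
have [T hT] := weyl_comparison pF pF' e0 F0 FF.
have [k hk] := mu_unbounded T.
apply: (hT _ _ _ _ _ (eigenvalue_ge0 k) (ltW hk) (hw k) (hw' k)).
have := same k; rewrite /steklov_value f0 F0.
have f0' := warp_f0_gt0 cpos'.
have F0' := profile_gt0 pF' (lexx 0).
move=> /mulfI h; have {}h := h _.
by apply: (mulIf (_ : (F' 0 ^+ 2)^-1 != 0)); rewrite ?invr_eq0 ?expf_neq0 ?gt_eqF //;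
  apply: h; rewrite oppr_eq0 invr_eq0 expf_neq0 // gt_eqF.
Qed.

End TwoMetrics.
End Uniqueness.

Theorem corollary1p2 (R : realType) (d : nat) (hd : (3 <= d)%N)
  (mu : nat -> R) (Y : nat -> euclidean R d -> R) (hY : sphere_eigenbasis mu Y)
  (c c' : R -> R) (hc : warping c) (hc' : warping c')
  (ac : analytic_on01 c) (ac' : analytic_on01 c')
  (sigma : nat -> R) (hsigma : steklov_spectrum mu Y c sigma)
  (hsigma' : steklov_spectrum mu Y c' sigma) :
  forall r : R, 0 <= r <= 1 -> c r = c' r.
Proof.
have n0 : (0 < d - 2)%N by rewrite subn_gt0.
have [F [F1 [H [m [M [B [pF FE potE]]]]]]] := warping_profile n0 hc ac.
have [F' [F1' [H' [m' [M' [B' [pF' FE' potE']]]]]]] := warping_profile n0 hc' ac'.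
have [w [w1 hw]] := weyl_family hY pF.
have [w' [w1' hw']] := weyl_family hY pF'.
have same k : steklov_value c F F1 w w1 k = steklov_value c' F' F1' w' w1' k.
  rewrite -(spectrum_eq_steklov_value hY hc pF FE potE hw hsigma).
  by rewrite -(spectrum_eq_steklov_value hY hc' pF' FE' potE' hw' hsigma').
have same' k := esym (same k).
have f0 : warp_f c 0 = warp_f c' 0.
  have [cpos _] := hc; have [cpos' _] := hc'.
  have p := warp_f0_gt0 cpos; have p' := warp_f0_gt0 cpos'.
  have h1 := boundary_conformal_le hd hY hc hc' pF pF' hw hw' same.
  have h2 := boundary_conformal_le hd hY hc' hc pF' pF hw' hw same'.
  have : warp_f c 0 ^+ 2 = warp_f c' 0 ^+ 2.
    by apply: invr_inj; apply/eqP; rewrite eq_le h1.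
  by move/eqP; rewrite eqrXn2 ?ltW // => /eqP.
have [C [Cc aC]] := analytic_extension ac.
have [C' [Cc' aC']] := analytic_extension ac'.
move=> r hr; apply/eqP; rewrite -subr_eq0 -(Cc r hr) -(Cc' r hr).
apply/negPn/negP => Cr.
have [||e [e0 [e1 sgn]]] := @analytic_sign R (fun t => C t - C' t).
- by move=> t ht; apply: analytic_sub; [exact: aC|exact: aC'].
- by exists r.
have in01 t : 1 - e < t < 1 -> 0 <= t <= 1.
  by move=> /andP[t0 t1]; apply/andP; split; lra.
case: sgn => sgn.
- apply: (not_eventually_larger hd hY hc hc' pF pF' FE FE' hw hw' same f0 e0 e1) => t ht.
  by have := sgn t ht; rewrite subr_gt0 Cc ?Cc' // in01.
- apply: (not_eventually_larger hd hY hc' hc pF' pF FE' FE hw' hw same' (esym f0) e0 e1) => t ht.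
  by have := sgn t ht; rewrite subr_lt0 Cc ?Cc' // in01.
Qed.
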